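(* Assume that $\omega\le h<2\omega$ and let $\Phi=(\varphi_1,\varphi_2)$ with $\varphi_1,\varphi_2\in B_\omega$. Suppose that there exist positive constants $\delta,\gamma,\eta$ such that $\delta\le|\widehat{\varphi_1}|^2+|\widehat{\varphi_2}|^2\le\gamma$ a.e. in $(-\omega,\omega)$ and $|\det J_{\Phi,t_o}|\ge\eta$ a.e. in $(h-\omega,\omega)$ (i.e. that $E_{\Phi,t_o}$ is a frame for $B_\omega$). Then the Fourier transform $\widehat{\Phi^*}=(\widehat{\varphi_1^*},\widehat{\varphi_2^*})$ of the vector of dual generators is $$\widehat{\Phi^*}=\begin{cases} D\,\tau_h\overline{\widehat\Phi}^{\perp} & \text{in } [-\omega,\omega-h],\\ h^{-1}\|\widehat\Phi\|^{-2}\,\widehat\Phi & \text{in } (\omega-h,h-\omega),\\ -D\,\tau_{-h}\overline{\widehat\Phi}^{\perp} & \text{in } [h-\omega,\omega],\end{cases}$$ where $D=(\det J_{\Phi,t_o}^* )^{-1}$ and $\widehat\Phi^\perp=(\widehat{\varphi_2},-\widehat{\varphi_1})$. If $h=\omega$ the central interval is empty.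
   Context: Conventions: $\hat f(\xi)=\frac{1}{\sqrt{2\pi}}\int f(t)e^{-it\xi}\,dt$ (extended to $L^2(\mathbb R)$); $\tau_a f(x)=f(x+a)$, applied componentwise to vectors; bar denotes complex conjugation, $\|\cdot\|$ the Euclidean norm in $\mathbb C^2$. Fix $\omega>0$ and $B_\omega=\{f\in L^2(\mathbb R):\operatorname{supp}\hat f\subset[-\omega,\omega]\}$; $t_o>0$ and $h=2\pi/t_o$. $\widehat\Phi=(\widehat{\varphi_1},\widehat{\varphi_2})$. $E_{\Phi,t_o}=\{\tau_{nt_o}\varphi_j:n\in\mathbb Z,\ j=1,2\}$ is a frame for $B_\omega$ if there are $0<A\le B$ with $A\|f\|^2\le\sum_j\sum_n|\langle f,\tau_{nt_o}\varphi_j\rangle|^2\le B\|f\|^2$ for all $f\in B_\omega$. In that case the frame operator $Sf=\sum_j\sum_n\langle f,\tau_{nt_o}\varphi_j\rangle\tau_{nt_o}\varphi_j$ is invertible on $B_\omega$, and the dual generators are $\varphi_j^*=S^{-1}\varphi_j$. The pre-Gramian $J_{\Phi,t_o}$ is the $h$-periodic matrix-valued function given for $x\in[0,h]$ by the $2\times2$ matrix whose first row is $\sqrt h\,\widehat\Phi(x-h)$ and whose second row is $\sqrt h\,\widehat\Phi(x)$; $J_{\Phi,t_o}^*$ is its adjoint (conjugate transpose). $D$ is the $h$-periodic function thus defined (where the determinant is nonzero, in particular on $(h-\omega,\omega)$ and its translates by multiples of $h$). Equalities hold almost everywhere. *)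

(* Defs.v *)
From HB Require Import structures.
From mathcomp Require Import all_boot all_order all_algebra.
From mathcomp Require Import finmap complex.
From mathcomp Require Import all_classical all_reals all_analysis.

Set Implicit Arguments.
Unset Strict Implicit.
Unset Printing Implicit Defensive.

Import Order.TTheory GRing.Theory Num.Theory.
Import numFieldNormedType.Exports.

Local Open Scope classical_set_scope.
Local Open Scope complex_scope.
Local Open Scope ring_scope.

(* The norm `|z| of z : R[i] lives in R[i]; this is the modulus as an element
   of R. *)
Definition cmod (R : rcfType) (z : R[i]) : R := ComplexField.Normc.normc z.

Section L2.
Context {R : realType}.
Notation mu := (@lebesgue_measure R).
Implicit Types f g : R -> R[i].

Definition cmeasurable f :=
  measurable_fun [set: R] (fun x => complex.Re (f x)) /\
  measurable_fun [set: R] (fun x => complex.Im (f x)).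

Definition cintegral (A : set R) f : R[i] :=
  (\int[mu]_(x in A) complex.Re (f x)) +i* (\int[mu]_(x in A) complex.Im (f x)).

(* ||f||^2, possibly infinite *)
Definition sqnormL2 f : \bar R := (\int[mu]_x ((cmod (f x)) ^+ 2)%:E)%E.

Definition L2 : set (R -> R[i]) :=
  [set f | cmeasurable f /\ (sqnormL2 f < +oo)%E].

Definition innerL2 f g : R[i] := cintegral [set: R] (fun x => f x * (g x)^*).

(* u is unconditionally summable in L2, with sum g: the finite partial sums
   converge to g along the directed set of finite sets of indices. *)
Definition sum_inL2 (K : choiceType) (u : K -> R -> R[i]) g :=
  forall e : R, 0 < e -> exists F0 : {fset K}, forall F : {fset K},
    (F0 `<=` F)%fset ->
    (sqnormL2 (fun x => g x - \sum_(k <- F) u k x)%R <= e%:E)%E.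

End L2.

Section Fourier.
Context {R : realType}.
Notation mu := (@lebesgue_measure R).

Definition tau (T : Type) (a : R) (f : R -> T) : R -> T := fun x => f (x + a).

Definition expi (x : R) : R[i] := cos x +i* sin x.

Definition fourier_trunc (N : nat) (f : R -> R[i]) (xi : R) : R[i] :=
  ((Num.sqrt (2 * pi))^-1)%:C *
  cintegral `[- N%:R, N%:R] (fun t => f t * expi (- (t * xi))).

(* The Fourier-Plancherel transform on L2: the limit in L2 of the transforms of
   the truncations of f, which are integrable.  It is determined only up to a
   null set. *)
Definition fourier (f : R -> R[i]) : R -> R[i] :=
  xget (fun=> 0)
    [set g | L2 g /\
      (fun N => sqnormL2 (fun xi => g xi - fourier_trunc N f xi)) @ \oo
        --> 0%E].

(* Square integrable functions band-limited to [-omega, omega]. *)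
Definition Bspace (omega : R) : set (R -> R[i]) :=
  [set f | L2 f /\
    {ae mu, forall xi, ~ (- omega <= xi <= omega) -> fourier f xi = 0}].

End Fourier.

Section Frame.
Context {R : realType}.
Notation mu := (@lebesgue_measure R).
Implicit Types (Phi : 'I_2 -> R -> R[i]) (omega h : R).

Definition shift_family (t0 : R) Phi (k : 'I_2 * int) : R -> R[i] :=
  tau (k.2%:~R * t0) (Phi k.1).

Definition is_frame omega (t0 : R) Phi :=
  exists A B : R, [/\ 0 < A, A <= B & forall f, Bspace omega f ->
    let s := (\sum_(j < 2) \esum_(n in [set: int])
      ((cmod (innerL2 f (shift_family t0 Phi (j, n)))) ^+ 2)%:E)%E in
    (A%:E * sqnormL2 f <= s /\ s <= B%:E * sqnormL2 f)%E].

Definition frame_operator (t0 : R) Phi (f : R -> R[i]) : R -> R[i] :=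
  xget (fun=> 0)
    [set g | L2 g /\
      sum_inL2 (fun k x => innerL2 f (shift_family t0 Phi k) *
                           shift_family t0 Phi k x) g].

(* Functions being representatives of classes modulo null sets, the inverse
   image under the frame operator is taken up to almost everywhere equality. *)
Definition frame_operator_inv omega (t0 : R) Phi (g : R -> R[i]) : R -> R[i] :=
  xget (fun=> 0)
    [set f | Bspace omega f /\
      {ae mu, forall x, frame_operator t0 Phi f x = g x}].

Definition dual_generators omega (t0 : R) Phi : 'I_2 -> R -> R[i] :=
  fun j => frame_operator_inv omega t0 Phi (Phi j).

Definition fourier_vec Phi (x : R) : 'rV[R[i]]_2 :=
  \row_j fourier (Phi j) x.

Definition enorm (v : 'rV[R[i]]_2) : R :=
  Num.sqrt (\sum_(j < 2) (cmod (v 0 j)) ^+ 2).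

Definition conj_vec (v : 'rV[R[i]]_2) : 'rV[R[i]]_2 :=
  map_mx (fun z => z^*) v.

Definition perp (v : 'rV[R[i]]_2) : 'rV[R[i]]_2 :=
  \row_j (if j == 0 then v 0 1 else - v 0 0).

(* The representative of x in [0, h[ modulo h. *)
Definition mod_period h (x : R) : R := x - (Num.floor (x / h))%:~R * h.

Definition pregramian h Phi (x : R) : 'M[R[i]]_2 :=
  let y := mod_period h x in
  (Num.sqrt h)%:C *: col_mx (fourier_vec Phi (y - h)) (fourier_vec Phi y).

Definition adjoint_mx (M : 'M[R[i]]_2) : 'M[R[i]]_2 :=
  (map_mx (fun z => z^*) M)^T.

Definition invdet h Phi (x : R) : R[i] :=
  (\det (adjoint_mx (pregramian h Phi x)))^-1.

End Frame.

(* Main.v *)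
(* By Plancherel's theorem, the frame coefficients of f are the Fourier
   coefficients on [0, h[ of the h-periodizations of the products of the
   transform F of f with the conjugates of the transforms of the generators.
   Parseval's identity turns the frame inequalities into pointwise ones for the
   pair (F x, F (x - h)), of which only one component is nonzero when x is
   outside ]h - omega, omega[; there the lower bound comes from delta, and
   inside from the determinant.  By the same token, S f = phi_i becomes for each
   x a linear system: two equations in (F x, F (x - h)) on ]h - omega, omega[,
   solved by Cramer's rule, and a single equation on ]omega - h, h - omega[. *)

Require Import Defs.
From HB Require Import structures.
From mathcomp Require Import all_boot all_order all_algebra.
From mathcomp Require Import finmap complex.
From mathcomp Require Import all_classical all_reals all_analysis.
From mathcomp Require Import measurable_realfun ring lra.

Set Implicit Arguments.
Unset Strict Implicit.
Unset Printing Implicit Defensive.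

Import Order.TTheory GRing.Theory Num.Theory.
Import numFieldNormedType.Exports.

Local Open Scope classical_set_scope.
Local Open Scope complex_scope.
Local Open Scope ring_scope.

(** * Square integrable complex functions *)

(** [fourier], [frame_operator] and [frame_operator_inv] are choices by [xget] with default 0: a
    formula about them needs an existence proof first, and then holds only up to null sets. For the
    transform, existence comes from the completeness of L2; for the sum of the frame series and for
    the dual generators, from an inversion theorem for transforms of bounded support. The frame
    operator is never inverted abstractly: an explicit solution of the pointwise systems is shown to
    be the transform of a preimage of phi_i, and uniqueness for these systems carries its formula
    over to whichever preimage was chosen. The hypotheses hold almost everywhere only. The argument
    therefore runs on representatives [psi] that are bounded everywhere and vanish off the open
    band, and inverses are replaced by 0 where the lower bounds fail, which keeps the explicit
    solution in L2. Plancherel's theorem is itself deduced from Parseval's identity for Fourier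
    series, which thus serves twice: in time on [-N, N[ and in frequency on [0, h[. *)

Section ComplexNumbers.
Context {R : realType}.
Implicit Types z w : R[i].
Local Notation Re := complex.Re.
Local Notation Im := complex.Im.

Lemma cRe0 : Re (0 : R[i]) = 0. Proof. by []. Qed.
Lemma cIm0 : Im (0 : R[i]) = 0. Proof. by []. Qed.
Lemma cReD z w : Re (z + w) = Re z + Re w. Proof. by case: z; case: w. Qed.
Lemma cImD z w : Im (z + w) = Im z + Im w. Proof. by case: z; case: w. Qed.
Lemma cReN z : Re (- z) = - Re z. Proof. by case: z. Qed.
Lemma cImN z : Im (- z) = - Im z. Proof. by case: z. Qed.
Lemma cReB z w : Re (z - w) = Re z - Re w. Proof. by case: z; case: w. Qed.
Lemma cImB z w : Im (z - w) = Im z - Im w. Proof. by case: z; case: w. Qed.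
Lemma cReM z w : Re (z * w) = Re z * Re w - Im z * Im w.
Proof. by case: z; case: w. Qed.
Lemma cImM z w : Im (z * w) = Re z * Im w + Im z * Re w.
Proof. by case: z => a b; case: w => c d /=. Qed.
Lemma conjE z : Num.conj z = (Re z) -i* (Im z). Proof. by case: z. Qed.
Lemma cReJ z : Re (z^*) = Re z. Proof. by rewrite conjE. Qed.
Lemma cImJ z : Im (z^*) = - Im z. Proof. by rewrite conjE. Qed.
Lemma cReC (r : R) : Re r%:C = r. Proof. by []. Qed.
Lemma cImC (r : R) : Im r%:C = 0. Proof. by []. Qed.

Definition cE := (cRe0, cIm0, cReD, cImD, cReN, cImN, cReM, cImM, cReJ, cImJ, cReC, cImC).

Lemma eq_ReIm z w : Re z = Re w -> Im z = Im w -> z = w.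
Proof. by case: z; case: w => a b c d /= -> ->. Qed.

Lemma cmod_ge0 z : 0 <= cmod z.
Proof. by case: z => a b; rewrite /cmod /= sqrtr_ge0. Qed.

Lemma cmod_sqr z : cmod z ^+ 2 = Re z ^+ 2 + Im z ^+ 2.
Proof. by case: z => a b; rewrite /cmod /= sqr_sqrtr// addr_ge0 ?sqr_ge0. Qed.

Lemma cmodM z w : cmod (z * w) = cmod z * cmod w.
Proof. exact: ComplexField.Normc.normcM. Qed.

Lemma cmodV z : cmod z^-1 = (cmod z)^-1.
Proof. exact: ComplexField.Normc.normcV. Qed.

Lemma cmodN z : cmod (- z) = cmod z.
Proof. by case: z => a b; rewrite /cmod/= !sqrrN. Qed.

Lemma cmodJ z : cmod z^* = cmod z.
Proof. by rewrite conjE; case: z => a b; rewrite /cmod/= !sqrrN. Qed.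

Lemma cmod0 : cmod (0 : R[i]) = 0.
Proof. exact: ComplexField.Normc.normc0. Qed.

Lemma cmod1 : cmod (1 : R[i]) = 1.
Proof. exact: ComplexField.Normc.normc1. Qed.

Lemma cmod_eq0 z : (cmod z == 0) = (z == 0).
Proof.
apply/eqP/eqP => [/ComplexField.Normc.eq0_normc//|->]; exact: cmod0.
Qed.

Lemma cmodC (r : R) : cmod r%:C = `|r|.
Proof. by rewrite /cmod /= expr0n /= addr0 sqrtr_sqr. Qed.

Lemma ler_cmodD z w : cmod (z + w) <= cmod z + cmod w.
Proof. exact: le_normcD. Qed.

Lemma ler_Re_cmod z : `|Re z| <= cmod z.
Proof.
rewrite -(@ler_pXn2r _ 2)// ?nnegrE ?cmod_ge0// cmod_sqr real_normK ?num_real//.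
by rewrite lerDl sqr_ge0.
Qed.

Lemma ler_Im_cmod z : `|Im z| <= cmod z.
Proof.
rewrite -(@ler_pXn2r _ 2)// ?nnegrE ?cmod_ge0// cmod_sqr real_normK ?num_real//.
by rewrite lerDr sqr_ge0.
Qed.

Lemma mulcJ_cmod z : z * z^* = (cmod z ^+ 2)%:C.
Proof.
by apply: eq_ReIm; rewrite !cE ?cmod_sqr; ring.
Qed.

Lemma cmod_sqrD_le z w : cmod (z + w) ^+ 2 <= 2 * cmod z ^+ 2 + 2 * cmod w ^+ 2.
Proof.
rewrite !cmod_sqr !cE.
have := sqr_ge0 (Re z - Re w); have := sqr_ge0 (Im z - Im w).
by rewrite !sqrrB !sqrrD; lra.
Qed.

Lemma ler_cmodM2 z w : cmod (z * w) <= cmod z ^+ 2 + cmod w ^+ 2.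
Proof.
rewrite cmodM; have := sqr_ge0 (cmod z - cmod w).
have := sqr_ge0 (cmod z); have := sqr_ge0 (cmod w).
by rewrite sqrrB; lra.
Qed.

Lemma cmod_sum (I : Type) (s : seq I) (F : I -> R[i]) :
  cmod (\sum_(i <- s) F i) <= \sum_(i <- s) cmod (F i).
Proof.
elim/big_ind2 : _ => //; first by rewrite cmod0.
by move=> ? ? ? ? h1 h2; apply: (le_trans (ler_cmodD _ _)); exact: lerD.
Qed.

Lemma cRe_sum (I : Type) (s : seq I) (F : I -> R[i]) :
  Re (\sum_(i <- s) F i) = \sum_(i <- s) Re (F i).
Proof. by elim/big_ind2 : _ => // ? ? ? ? <- <-; rewrite cReD. Qed.

Lemma cRe_invE z : Re z^-1 = Re z / (Re z ^+ 2 + Im z ^+ 2).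
Proof. by case: z. Qed.
Lemma cIm_invE z : Im z^-1 = - Im z / (Re z ^+ 2 + Im z ^+ 2).
Proof. by case: z => a b /=; rewrite mulNr. Qed.

Lemma expiD (x y : R) : expi (x + y) = expi x * expi y.
Proof. by apply: eq_ReIm; rewrite !cE /= ?cosD ?sinD; ring. Qed.

Lemma expi0 : expi (0 : R) = 1.
Proof. by rewrite /expi cos0 sin0. Qed.

Lemma expiJ (x : R) : (expi x)^* = expi (- x).
Proof. by rewrite conjE /expi /= cosN sinN. Qed.

Lemma cmod_expi (x : R) : cmod (expi x) = 1.
Proof. by rewrite /cmod /= cos2Dsin2 sqrtr1. Qed.

Lemma expi_2piz (n : int) : expi (n%:~R * (2 * pi) : R) = 1.
Proof.
have h (m : nat) : expi (m%:R * (2 * pi) : R) = 1.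
  elim: m => [|m ih]; first by rewrite mul0r expi0.
  by rewrite -natr1 mulrDl mul1r expiD ih mul1r /expi mulr_natl cos2pi sin2pi.
case: n => m; first exact: h.
by rewrite NegzE mulrNz mulNr -expiJ (h m.+1) conjE /= oppr0.
Qed.

End ComplexNumbers.

(** * Measurable complex-valued functions *)

Section ComplexMeasurable.
Context {R : realType}.
Notation mu := (@lebesgue_measure R).
Implicit Types f g : R -> R[i].

Lemma eq_meas (u v : R -> R) : u =1 v -> measurable_fun [set: R] v ->
  measurable_fun [set: R] u.
Proof. by move=> /funext ->. Qed.

Lemma cmeasD f g : cmeasurable f -> cmeasurable g ->
  cmeasurable (fun x => f x + g x).
Proof.
move=> [f1 f2] [g1 g2]; split.
  by apply: eq_meas (measurable_funD f1 g1) => x; rewrite cE.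
by apply: eq_meas (measurable_funD f2 g2) => x; rewrite cE.
Qed.

Lemma cmeasN f : cmeasurable f -> cmeasurable (fun x => - f x).
Proof.
move=> [f1 f2]; split.
  by apply: eq_meas (measurable_funN f1) => x; rewrite cE.
by apply: eq_meas (measurable_funN f2) => x; rewrite cE.
Qed.

Lemma cmeasB f g : cmeasurable f -> cmeasurable g ->
  cmeasurable (fun x => f x - g x).
Proof. by move=> mf mg; apply: cmeasD => //; exact: cmeasN. Qed.

Lemma cmeasM f g : cmeasurable f -> cmeasurable g ->
  cmeasurable (fun x => f x * g x).
Proof.
move=> [f1 f2] [g1 g2]; split.
  apply: eq_meas (measurable_funB (measurable_funM f1 g1) (measurable_funM f2 g2)) => x.
  by rewrite cE.
apply: eq_meas (measurable_funD (measurable_funM f1 g2) (measurable_funM f2 g1)) => x.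
by rewrite cE.
Qed.

Lemma cmeasJ f : cmeasurable f -> cmeasurable (fun x => (f x)^*).
Proof.
move=> [f1 f2]; split; first by apply: eq_meas f1 => x; rewrite cE.
by apply: eq_meas (measurable_funN f2) => x; rewrite cE.
Qed.

Lemma cmeas_cst (c : R[i]) : cmeasurable (fun=> c).
Proof. by split; exact: measurable_cst. Qed.

Lemma cmeasR (r : R -> R) : measurable_fun [set: R] r ->
  cmeasurable (fun x => (r x)%:C).
Proof. by move=> mr; split => //; exact: measurable_cst. Qed.

Lemma cmeas_sum (I : Type) (s : seq I) (F : I -> R -> R[i]) :
  (forall i, cmeasurable (F i)) -> cmeasurable (fun x => \sum_(i <- s) F i x).
Proof.
move=> mF; elim: s => [|i s ih].
  by under eq_fun do rewrite big_nil; exact: cmeas_cst.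
by under eq_fun do rewrite big_cons; exact: cmeasD.
Qed.

Lemma measurable_cmod2 f : cmeasurable f ->
  measurable_fun [set: R] (fun x => cmod (f x) ^+ 2).
Proof.
move=> [f1 f2].
apply: eq_meas (measurable_funD (measurable_funX 2 f1) (measurable_funX 2 f2)) => x.
exact: cmod_sqr.
Qed.

Lemma measurable_cmod2E f : cmeasurable f ->
  measurable_fun [set: R] (fun x => (cmod (f x) ^+ 2)%:E).
Proof. by move=> /measurable_cmod2 mf; exact/measurable_EFinP. Qed.

Lemma measurable_cmod f : cmeasurable f ->
  measurable_fun [set: R] (fun x => cmod (f x)).
Proof.
move=> mf; rewrite (_ : (fun _ => _) = (fun x => Num.sqrt (cmod (f x) ^+ 2))).
  apply: (@measurableT_comp _ _ _ _ _ _ (@Num.sqrt R)); last exact: measurable_cmod2.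
  by apply: continuous_measurable_fun; exact: sqrt_continuous.
by apply/funext => x; rewrite sqrtr_sqr ger0_norm// cmod_ge0.
Qed.

Lemma measurable_shift (a : R) : measurable_fun [set: R] (fun x : R => x + a).
Proof. exact: measurable_funD. Qed.

Lemma cmeas_tau (a : R) f : cmeasurable f -> cmeasurable (tau a f).
Proof.
move=> [f1 f2]; split.
  exact: (measurableT_comp f1 (measurable_shift a)).
exact: (measurableT_comp f2 (measurable_shift a)).
Qed.

Lemma cmeasV f : cmeasurable f -> cmeasurable (fun x => (f x)^-1).
Proof.
move=> [f1 f2].
have m2 : measurable_fun [set: R]
    (fun x => (complex.Re (f x) ^+ 2 + complex.Im (f x) ^+ 2)^-1).
  (* On nonnegative reals, 0 included, the inverse is the power of exponent -1, and real powers are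
     measurable. *)
  apply: (@eq_meas _
    (fun x => (complex.Re (f x) ^+ 2 + complex.Im (f x) ^+ 2) `^ (-1))).
    by move=> x; rewrite powR_inv1// addr_ge0 ?sqr_ge0.
  apply: (measurableT_comp (f := fun x : R => x `^ (-1))); first exact: measurable_powR.
  by apply: measurable_funD; exact: measurable_funX.
split.
  by apply: eq_meas (measurable_funM f1 m2) => x; rewrite cRe_invE.
by apply: eq_meas (measurable_funM (measurable_funN f2) m2) => x; rewrite cIm_invE.
Qed.

(** Complex-valued, so that restricting to a set is a multiplication and commutes with the algebra
    of integrands. *)
Definition ind (A : set R) (x : R) : R[i] := (\1_A x)%:C.

Lemma indE A x : ind A x = if x \in A then 1 else 0.
Proof. by rewrite /ind indicE; case: (x \in A). Qed.

Lemma cmeas_ind (A : set R) : measurable A -> cmeasurable (ind A).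
Proof. by move=> mA; apply: cmeasR; exact: measurable_indic. Qed.

Lemma indM A x : ind A x * ind A x = ind A x.
Proof. by rewrite indE; case: ifP; rewrite ?mulr1 ?mulr0. Qed.

Lemma indJ A x : (ind A x)^* = ind A x.
Proof. by rewrite /ind conjE /= oppr0. Qed.

Lemma cmod_ind_le1 A x : cmod (ind A x) <= 1.
Proof. by rewrite indE; case: ifP; rewrite ?cmod1 ?cmod0. Qed.

Lemma cmeas_if (A : set R) f g : measurable A -> cmeasurable f ->
  cmeasurable g -> cmeasurable (fun x => if x \in A then f x else g x).
Proof.
move=> mA mf mg.
rewrite (_ : (fun _ => _) = fun x => ind A x * f x + (1 - ind A x) * g x).
  apply: cmeasD; apply: cmeasM => //; [exact: cmeas_ind|].
  by apply: cmeasB; [exact: cmeas_cst|exact: cmeas_ind].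
apply/funext => x; rewrite indE; case: ifP => _.
  by rewrite subrr mul0r addr0 mul1r.
by rewrite subr0 mul0r add0r mul1r.
Qed.

Lemma cmeas_expi (r : R) : cmeasurable (fun x => expi (r * x)).
Proof.
split => /=; (apply: measurableT_comp; last exact: measurable_funM).
  by apply: continuous_measurable_fun; exact: continuous_cos.
by apply: continuous_measurable_fun; exact: continuous_sin.
Qed.

End ComplexMeasurable.

(** * The integral of complex-valued functions *)

Section ComplexIntegral.
Context {R : realType}.
Notation mu := (@lebesgue_measure R).
Implicit Types f g : R -> R[i].

Definition cintegrable f :=
  mu.-integrable [set: R] (EFin \o (fun x => complex.Re (f x))) /\
  mu.-integrable [set: R] (EFin \o (fun x => complex.Im (f x))).

Lemma cintegrable_dom (r : R -> R) f : cmeasurable f ->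
  mu.-integrable [set: R] (EFin \o r) -> (forall x, cmod (f x) <= r x) ->
  cintegrable f.
Proof.
move=> [f1 f2] ir fr; split.
  apply: (le_integrable _ _ _ ir) => //; first exact/measurable_EFinP.
  move=> x _ /=; rewrite lee_fin (le_trans (ler_Re_cmod _))//.
  by rewrite (le_trans (fr x))// ler_norm.
apply: (le_integrable _ _ _ ir) => //; first exact/measurable_EFinP.
move=> x _ /=; rewrite lee_fin (le_trans (ler_Im_cmod _))//.
by rewrite (le_trans (fr x))// ler_norm.
Qed.

Definition cint f := cintegral [set: R] f.

Lemma eq_cint f g : f =1 g -> cint f = cint g.
Proof. by move=> /funext ->. Qed.

Lemma cintegral_ind (A : set R) f : cintegral A f = cint (fun x => ind A x * f x).
Proof.
apply: eq_ReIm => /=; rewrite Rintegral_mkcond; apply: eq_Rintegral => x _;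
  by rewrite patchE indE; case: ifP; rewrite ?mul1r ?mul0r.
Qed.

Lemma cintegrableD f g : cintegrable f -> cintegrable g ->
  cintegrable (fun x => f x + g x).
Proof.
move=> [f1 f2] [g1 g2]; split.
  rewrite (_ : _ \o _ = (fun x => (complex.Re (f x))%:E + (complex.Re (g x))%:E)%E).
    exact: integrableD.
  by apply/funext => x /=; rewrite cE.
rewrite (_ : _ \o _ = (fun x => (complex.Im (f x))%:E + (complex.Im (g x))%:E)%E).
  exact: integrableD.
by apply/funext => x /=; rewrite cE.
Qed.

Lemma cintD f g : cintegrable f -> cintegrable g ->
  cint (fun x => f x + g x) = cint f + cint g.
Proof.
move=> [f1 f2] [g1 g2]; apply: eq_ReIm; rewrite !cE /=.
  by rewrite -RintegralD//; apply: eq_Rintegral => x _; rewrite cE.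
by rewrite -RintegralD//; apply: eq_Rintegral => x _; rewrite cE.
Qed.

Lemma integrable_Zl (c : R) (u : R -> R) : mu.-integrable [set: R] (EFin \o u) ->
  mu.-integrable [set: R] (EFin \o (fun x => c * u x)).
Proof.
move=> iu; rewrite (_ : _ \o _ = (fun x => c%:E * (EFin \o u) x)%E).
  exact: integrableZl.
by apply/funext.
Qed.

Lemma cintegrableZ (c : R[i]) f : cintegrable f ->
  cintegrable (fun x => c * f x).
Proof.
case: c => a b [f1 f2]; split.
  rewrite (_ : _ \o _ = (fun x => (EFin \o (fun x => (a * complex.Re (f x))%R)) x
     - (EFin \o (fun x => (b * complex.Im (f x))%R)) x)%E).
    by apply: integrableB => //; exact: integrable_Zl.
  by apply/funext => x /=; rewrite !cE.
rewrite (_ : _ \o _ = (fun x => (EFin \o (fun x => (a * complex.Im (f x))%R)) x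
   + (EFin \o (fun x => (b * complex.Re (f x))%R)) x)%E).
  by apply: integrableD => //; exact: integrable_Zl.
by apply/funext => x /=; rewrite !cE.
Qed.

Lemma cintZ (c : R[i]) f : cintegrable f ->
  cint (fun x => c * f x) = c * cint f.
Proof.
case: c => a b [f1 f2]; apply: eq_ReIm; rewrite !cE /=.
  rewrite -!RintegralZl// -RintegralB//; try exact: integrable_Zl.
  by apply: eq_Rintegral => x _; rewrite !cE.
rewrite -!RintegralZl// -RintegralD//; try exact: integrable_Zl.
by apply: eq_Rintegral => x _; rewrite !cE.
Qed.

Lemma cint0 : cint (fun=> 0 : R[i]) = 0.
Proof. by apply: eq_ReIm => /=; rewrite /Rintegral integral0. Qed.

Lemma cintegrable0 : cintegrable (fun=> 0).
Proof. by split; exact: integrable0. Qed.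

Lemma cintJ f : cintegrable f -> cint (fun x => (f x)^*) = (cint f)^*.
Proof.
move=> [f1 f2]; apply: eq_ReIm; rewrite !cE /=.
  by apply: eq_Rintegral => x _; rewrite cE.
rewrite -mulN1r -RintegralZl//.
by apply: eq_Rintegral => x _; rewrite cE mulN1r.
Qed.

Lemma cintegrable_sum (I : Type) (s : seq I) (F : I -> R -> R[i]) :
  (forall i, cintegrable (F i)) ->
  cintegrable (fun x => \sum_(i <- s) F i x).
Proof.
move=> iF; elim: s => [|i s ih].
  by under [X in cintegrable X]eq_fun do rewrite big_nil; exact: cintegrable0.
by under [X in cintegrable X]eq_fun do rewrite big_cons; exact: cintegrableD.
Qed.

Lemma cint_sum (I : Type) (s : seq I) (F : I -> R -> R[i]) :
  (forall i, cintegrable (F i)) ->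
  cint (fun x => \sum_(i <- s) F i x) = \sum_(i <- s) cint (F i).
Proof.
move=> iF; elim: s => [|i s ih].
  by rewrite big_nil -[RHS]cint0; apply: eq_cint => x; rewrite big_nil.
rewrite big_cons -ih -cintD//; last exact: cintegrable_sum.
by apply: eq_cint => x; rewrite big_cons.
Qed.

End ComplexIntegral.

(** * The space of square integrable functions and its inner product *)

Section SquareIntegrable.
Context {R : realType}.
Notation mu := (@lebesgue_measure R).

Lemma ae_imply (P Q : R -> Prop) : (forall x, P x -> Q x) ->
  {ae mu, forall x, P x} -> {ae mu, forall x, Q x}.
Proof. by move=> PQ; apply: (@filterS _ _ (ae_filter_ringOfSetsType mu)). Qed.

Lemma ae_imply2 (P Q T : R -> Prop) : (forall x, P x -> Q x -> T x) ->
  {ae mu, forall x, P x} -> {ae mu, forall x, Q x} -> {ae mu, forall x, T x}.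
Proof. by move=> PQ; apply: (@filterS2 _ _ (ae_filter_ringOfSetsType mu)). Qed.

Lemma ae_imply3 (P Q T U : R -> Prop) : (forall x, P x -> Q x -> T x -> U x) ->
  {ae mu, forall x, P x} -> {ae mu, forall x, Q x} -> {ae mu, forall x, T x} ->
  {ae mu, forall x, U x}.
Proof. by move=> PQ; apply: (@filterS3 _ _ (ae_filter_ringOfSetsType mu)). Qed.

Implicit Types f g : R -> R[i].

(** A real number, for the sake of real arithmetic. An infinite norm is sent to 0, so that smallness
    of [N2] means something only together with membership in [L2]. *)
Definition N2 f : R := fine (sqnormL2 f).

Lemma sqnormL2_ge0 f : (0 <= sqnormL2 f)%E.
Proof. by apply: integral_ge0 => x _; rewrite lee_fin sqr_ge0. Qed.

Lemma sqnormE f : L2 f -> sqnormL2 f = (N2 f)%:E.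
Proof. by move=> [_ fin]; rewrite /N2 fineK// ge0_fin_numE// sqnormL2_ge0. Qed.

Lemma N2_ge0 f : 0 <= N2 f.
Proof. by rewrite /N2 fine_ge0// sqnormL2_ge0. Qed.

Lemma sqnormL2_leM (c : R) (f g : R -> R[i]) : cmeasurable f -> cmeasurable g ->
  0 <= c -> (forall x, cmod (f x) ^+ 2 <= c * cmod (g x) ^+ 2) ->
  (sqnormL2 f <= c%:E * sqnormL2 g)%E.
Proof.
move=> mf mg c0 fg; rewrite /sqnormL2 -ge0_integralZl//; last 2 first.
- exact: measurable_cmod2E.
- by move=> x _; rewrite lee_fin sqr_ge0.
apply: ge0_le_integral => //.
- by move=> x _; rewrite lee_fin sqr_ge0.
- exact: measurable_cmod2E.
- by apply: measurable_funeM; exact: measurable_cmod2E.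
- by move=> x _; rewrite -EFinM lee_fin fg.
Qed.

Lemma sqnormL2D_le f g : cmeasurable f -> cmeasurable g ->
  (sqnormL2 (fun x => f x + g x)%R
   <= 2%:E * sqnormL2 f + 2%:E * sqnormL2 g)%E.
Proof.
move=> mf mg; rewrite /sqnormL2.
have m2 u : cmeasurable u -> measurable_fun [set: R] (fun x => (cmod (u x) ^+ 2)%:E).
  exact: measurable_cmod2E.
have p2 u : forall x, [set: R] x -> (0 <= (cmod (u x) ^+ 2)%:E)%E.
  by move=> x _; rewrite lee_fin sqr_ge0.
rewrite -!ge0_integralZl//; [|exact: m2|exact: p2|exact: m2|exact: p2].
rewrite -ge0_integralD//; last 4 first.
- by move=> x _; rewrite -EFinM lee_fin mulr_ge0// sqr_ge0.
- by apply: measurable_funeM; exact: m2.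
- by move=> x _; rewrite -EFinM lee_fin mulr_ge0// sqr_ge0.
- by apply: measurable_funeM; exact: m2.
apply: ge0_le_integral => //.
- by move=> x _; rewrite lee_fin sqr_ge0.
- exact: (m2 _ (cmeasD mf mg)).
- by apply: emeasurable_funD; apply: measurable_funeM; exact: m2.
- by move=> x _; rewrite -!EFinM -EFinD lee_fin cmod_sqrD_le.
Qed.

Lemma L2_meas f : L2 f -> cmeasurable f. Proof. by case. Qed.

Lemma L2_le (c : R) f g : cmeasurable f -> L2 g -> 0 <= c ->
  (forall x, cmod (f x) ^+ 2 <= c * cmod (g x) ^+ 2) -> L2 f.
Proof.
move=> mf [mg g2] c0 fg; split => //.
apply: (le_lt_trans (sqnormL2_leM mf mg c0 fg)).
by rewrite lte_mul_pinfty.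
Qed.

Lemma L2D f g : L2 f -> L2 g -> L2 (fun x => f x + g x).
Proof.
move=> [mf f2] [mg g2]; split; first exact: cmeasD.
apply: (le_lt_trans (sqnormL2D_le mf mg)).
by rewrite lte_add_pinfty// lte_mul_pinfty.
Qed.

Lemma L2M_bnd (M : R) m f : cmeasurable m -> (forall x, cmod (m x) <= M) ->
  L2 f -> L2 (fun x => m x * f x).
Proof.
move=> mm mM fL; apply: (@L2_le (M ^+ 2) _ f) => //.
- by apply: cmeasM => //; exact: L2_meas.
- exact: sqr_ge0.
move=> x; rewrite cmodM exprMn ler_wpM2r ?sqr_ge0//.
by rewrite ler_pXn2r// ?nnegrE ?cmod_ge0// (le_trans (cmod_ge0 (m x))).
Qed.

Lemma L2Z (c : R[i]) f : L2 f -> L2 (fun x => c * f x).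
Proof. by apply: (@L2M_bnd (cmod c)) => //; exact: cmeas_cst. Qed.

Lemma L2N f : L2 f -> L2 (fun x => - f x).
Proof.
by move=> /(L2Z (-1)); rewrite (_ : (fun _ => _) = (fun x => - f x))//;
  apply/funext => x; rewrite mulN1r.
Qed.

Lemma L2B f g : L2 f -> L2 g -> L2 (fun x => f x - g x).
Proof. by move=> fL /L2N gL; exact: L2D. Qed.

Lemma L2J f : L2 f -> L2 (fun x => (f x)^*).
Proof.
move=> fL; apply: (@L2_le 1 _ f) => //.
  by apply: cmeasJ; exact: L2_meas.
by move=> x; rewrite cmodJ mul1r.
Qed.

Lemma L20 : L2 (fun=> 0 : R[i]).
Proof.
split; first exact: cmeas_cst.
by rewrite /sqnormL2 cmod0 expr0n /= integral0.
Qed.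

Lemma L2_sum (I : Type) (s : seq I) (F : I -> R -> R[i]) :
  (forall i, L2 (F i)) -> L2 (fun x => \sum_(i <- s) F i x).
Proof.
move=> LF; elim: s => [|i s ih].
  by under [X in L2 X]eq_fun do rewrite big_nil; exact: L20.
by under [X in L2 X]eq_fun do rewrite big_cons; exact: L2D.
Qed.

Lemma L2_ind (A : set R) f : measurable A -> L2 f -> L2 (fun x => ind A x * f x).
Proof.
move=> mA; apply: (@L2M_bnd 1); first exact: cmeas_ind.
by move=> x; exact: cmod_ind_le1.
Qed.

Lemma integrable_cmod2 f : L2 f ->
  mu.-integrable [set: R] (EFin \o (fun x => cmod (f x) ^+ 2)).
Proof.
move=> [mf f2]; apply/integrableP; split.
  exact: measurable_cmod2E.
by under eq_integral do rewrite /= ger0_norm ?sqr_ge0//.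
Qed.

Lemma cintegrable_ip f g : L2 f -> L2 g -> cintegrable (fun x => f x * (g x)^*).
Proof.
move=> fL gL.
apply: (@cintegrable_dom _ (fun x => cmod (f x) ^+ 2 + cmod (g x) ^+ 2)).
- by apply: cmeasM; [|apply: cmeasJ]; exact: L2_meas.
- rewrite (_ : _ \o _ = (fun x => (EFin \o (fun x => (cmod (f x) ^+ 2)%R)) x
    + (EFin \o (fun x => (cmod (g x) ^+ 2)%R)) x)%E); last by apply/funext.
  by apply: integrableD => //; exact: integrable_cmod2.
- by move=> x; rewrite (le_trans (ler_cmodM2 _ _))// cmodJ.
Qed.

Local Notation ip := innerL2.

Lemma ipDl f g h : L2 f -> L2 g -> L2 h ->
  ip (fun x => f x + g x) h = ip f h + ip g h.
Proof.
move=> fL gL hL; rewrite /ip -[cintegral _ _]/(cint _) -cintD//; try exact: cintegrable_ip.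
by apply: eq_cint => x; rewrite mulrDl.
Qed.

Lemma ipZl (c : R[i]) f h : L2 f -> L2 h ->
  ip (fun x => c * f x) h = c * ip f h.
Proof.
move=> fL hL; rewrite /ip -[cintegral _ _]/(cint _) -cintZ//; last exact: cintegrable_ip.
by apply: eq_cint => x; rewrite mulrA.
Qed.

Lemma ipC f g : L2 f -> L2 g -> ip g f = (ip f g)^*.
Proof.
move=> fL gL; rewrite /ip -[cintegral _ _]/(cint _) -cintJ; last exact: cintegrable_ip.
by apply: eq_cint => x; rewrite rmorphM /= conjCK mulrC.
Qed.

Lemma ipDr f g h : L2 f -> L2 g -> L2 h ->
  ip h (fun x => f x + g x) = ip h f + ip h g.
Proof.
move=> fL gL hL; rewrite ipC//; last exact: L2D.
by rewrite ipDl// rmorphD /= -!ipC.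
Qed.

Lemma ipZr (c : R[i]) f h : L2 f -> L2 h ->
  ip h (fun x => c * f x) = c^* * ip h f.
Proof.
move=> fL hL; rewrite ipC//; last exact: L2Z.
by rewrite ipZl// rmorphM /= -ipC.
Qed.

Lemma ipNr f h : L2 f -> L2 h -> ip h (fun x => - f x) = - ip h f.
Proof.
move=> fL hL; rewrite -mulN1r -[in RHS](rmorphN1 (Num.conj : {rmorphism R[i] -> R[i]})).
by rewrite -ipZr//; congr (ip h _); apply/funext => x; rewrite mulN1r.
Qed.

Lemma ip0l h : ip (fun=> 0 : R[i]) h = 0.
Proof.
rewrite /ip -[cintegral _ _]/(cint _) -[RHS]cint0.
by apply: eq_cint => x; rewrite mul0r.
Qed.

Lemma ip_suml (I : Type) (s : seq I) (F : I -> R -> R[i]) h :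
  (forall i, L2 (F i)) -> L2 h ->
  ip (fun x => \sum_(i <- s) F i x) h = \sum_(i <- s) ip (F i) h.
Proof.
move=> LF hL; elim: s => [|i s ih].
  by rewrite big_nil -[RHS](ip0l h); congr (ip _ h); apply/funext => x; rewrite big_nil.
rewrite big_cons -ih -ipDl//; last exact: L2_sum.
by congr (ip _ h); apply/funext => x; rewrite big_cons.
Qed.

Lemma ip_sumr (I : Type) (s : seq I) (F : I -> R -> R[i]) h :
  (forall i, L2 (F i)) -> L2 h ->
  ip h (fun x => \sum_(i <- s) F i x) = \sum_(i <- s) ip h (F i).
Proof.
move=> LF hL; rewrite ipC//; last exact: L2_sum.
by rewrite ip_suml// rmorph_sum; apply: eq_bigr => i _ /=; rewrite -ipC.
Qed.

Lemma ipff f : ip f f = (N2 f)%:C.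
Proof.
apply: eq_ReIm; rewrite /= /N2 /sqnormL2.
  by congr fine; apply: eq_integral => x _; rewrite mulcJ_cmod.
rewrite /Rintegral (eq_integral (fun=> 0%E)); first by rewrite integral0.
by move=> x _; rewrite mulcJ_cmod.
Qed.

Lemma N2D f g : L2 f -> L2 g ->
  N2 (fun x => f x + g x) = N2 f + N2 g + 2 * complex.Re (ip f g).
Proof.
move=> fL gL; have fgL := L2D fL gL.
have := ipff (fun x => f x + g x).
rewrite ipDl// !ipDr// !ipff (ipC fL gL) => /(congr1 (@complex.Re R)).
by rewrite !cE /= => <-; ring.
Qed.

Lemma N2B f g : L2 f -> L2 g ->
  N2 (fun x => f x - g x) = N2 f + N2 g - 2 * complex.Re (ip f g).
Proof.
move=> fL gL; rewrite N2D//; last exact: L2N.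
rewrite ipNr// cE mulrN; congr (_ + _ - _).
by rewrite /N2 /sqnormL2; congr fine; apply: eq_integral => x _; rewrite cmodN.
Qed.

Lemma N2Z (c : R[i]) f : L2 f -> N2 (fun x => c * f x) = cmod c ^+ 2 * N2 f.
Proof.
move=> fL; have /(congr1 (@complex.Re R)) := ipff (fun x => c * f x).
rewrite ipZl ?ipZr//; [|exact: L2Z]; rewrite ipff mulrA mulcJ_cmod !cE.
by rewrite mul0r subr0.
Qed.

Lemma N2N f : N2 (fun x => - f x) = N2 f.
Proof. by rewrite /N2 /sqnormL2; under eq_integral do rewrite cmodN. Qed.

Lemma N20 : N2 (fun=> 0) = 0.
Proof. by rewrite /N2 /sqnormL2 cmod0 expr0n /= integral0. Qed.

Lemma N2D_le f g : L2 f -> L2 g ->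
  N2 (fun x => f x + g x) <= 2 * N2 f + 2 * N2 g.
Proof.
move=> fL gL; rewrite -lee_fin EFinD !EFinM -!sqnormE//; last exact: L2D.
by apply: sqnormL2D_le; exact: L2_meas.
Qed.

Lemma N2B_le f g : L2 f -> L2 g ->
  N2 (fun x => f x - g x) <= 2 * N2 f + 2 * N2 g.
Proof.
by move=> fL gL; rewrite (le_trans (N2D_le fL (L2N gL)))// N2N.
Qed.

Lemma N2_leM (c : R) f g : L2 f -> L2 g -> 0 <= c ->
  (forall x, cmod (f x) ^+ 2 <= c * cmod (g x) ^+ 2) -> N2 f <= c * N2 g.
Proof.
move=> fL gL c0 fg; rewrite -lee_fin EFinM -!sqnormE//.
by apply: sqnormL2_leM => //; exact: L2_meas.
Qed.

(** Expanding the squared norm of f - t <f, g> g for real t gives a nonnegative real quadratic in t,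
    the factor <f, g> having absorbed the phase. Its minimum is at t = 1 / [N2 g]. *)
Lemma CauchySchwarz f g : L2 f -> L2 g -> cmod (ip f g) ^+ 2 <= N2 f * N2 g.
Proof.
move=> fL gL; set w := ip f g.
have key (t : R) : 0 <= N2 f - 2 * t * cmod w ^+ 2 + t ^+ 2 * (cmod w ^+ 2 * N2 g).
  have := N2_ge0 (fun x => f x - (t%:C * w) * g x).
  rewrite N2B//; last exact: L2Z.
  rewrite N2Z// ipZr// -/w.
  have -> : ((t%:C * w)^* * w) = (t * cmod w ^+ 2)%:C.
    have -> : (t%:C * w)^* = t%:C * w^* by apply: eq_ReIm; rewrite !cE; ring.
    by rewrite -mulrA (mulrC _ w) mulcJ_cmod; apply: eq_ReIm; rewrite !cE; ring.
  rewrite cmodM cmodC exprMn real_normK ?num_real// cReC.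
  by move=> h; rewrite [X in _ <= X](_ : _ =
    N2 f + t ^+ 2 * cmod w ^+ 2 * N2 g - 2 * (t * cmod w ^+ 2)); last by ring.
have [g0|gN0] := eqVneq (N2 g) 0.
  have [->|wN0] := eqVneq (cmod w) 0; first by rewrite expr0n /= mulr_ge0 ?N2_ge0.
  have w2 : 0 < cmod w ^+ 2 by rewrite exprn_gt0// lt_neqAle eq_sym wN0 cmod_ge0.
  (* With [N2 g] = 0 the quadratic is affine with negative slope; at this t its value is - [N2 f] -
     2, which is impossible. *)
  have := key ((N2 f + 1) / cmod w ^+ 2).
  rewrite g0 !mulr0 addr0 -!mulrA mulVf ?gt_eqF// mulr1.
  by have := N2_ge0 f; lra.
have gp : 0 < N2 g by rewrite lt_neqAle eq_sym gN0 N2_ge0.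
have := key ((N2 g)^-1).
rewrite -(ler_pM2r gp) mul0r.
rewrite [X in _ <= X](_ : _ = N2 f * N2 g - cmod w ^+ 2); last by field.
by lra.
Qed.

Lemma ae_N2_eq0 f : L2 f -> N2 f = 0 -> {ae mu, forall x, f x = 0}.
Proof.
move=> fL f0.
have : (\int[mu]_(x in [set: R]) `|(cmod (f x) ^+ 2)%:E| = 0)%E.
  under eq_integral do rewrite gee0_abs ?lee_fin ?sqr_ge0//.
  by rewrite -/(sqnormL2 f) sqnormE// f0.
move/(ae_eq_integral_abs mu measurableT
  (measurable_cmod2E (L2_meas fL))).
apply: filterS => x /(_ I) [] /eqP.
by rewrite sqrf_eq0 cmod_eq0 => /eqP.
Qed.

Lemma ae_sqnormL2 f g : cmeasurable f -> cmeasurable g ->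
  {ae mu, forall x, f x = g x} -> sqnormL2 f = sqnormL2 g.
Proof.
move=> mf mg fg; apply: ae_eq_integral => //.
- exact: measurable_cmod2E.
- exact: measurable_cmod2E.
- by apply: ae_imply fg => x -> _.
Qed.

Lemma L2_ae f g : L2 f -> cmeasurable g -> {ae mu, forall x, f x = g x} -> L2 g.
Proof.
by move=> [mf f2] mg fg; split => //; rewrite -(ae_sqnormL2 mf mg fg).
Qed.

End SquareIntegrable.

(** * Translation invariance of Lebesgue measure and of the norm *)

Section Translation.
Context {R : realType}.
Notation mu := (@lebesgue_measure R).
Implicit Types f g : R -> R[i].
Local Notation ip := innerL2.

(** The image of [mu] under the translation is a measure that agrees with [mu] on half-open
    intervals, and Lebesgue measure is determined by its values there. *)
Lemma lebesgue_measure_shift (a : R) (A : set R) : measurable A ->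
  mu A = mu [set x | A (x + a)].
Proof.
move=> mA.
have ms : @measurable_fun _ _ (measurableTypeR R) (measurableTypeR R) setT (fun x => x + a).
  exact: measurable_shift.
pose nu : {measure set (measurableTypeR R) -> \bar R} :=
  measure_function_pushforward__canonical__measure_function_Measure mu ms.
suff h : forall X, (@ocitv R) X -> mu X = nu X.
  by have := @lebesgue_measure_unique R nu h A mA.
move=> _ [[x y] _ <-] /=.
rewrite /pushforward /= (_ : _ @^-1` _ = `]x - a, y - a]%classic); last first.
  by apply/seteqP; split => z /=; rewrite !in_itv /= lerBrDr ltrBlDr.
rewrite !lebesgue_measure_itv /= !lte_fin ltrD2r; case: ifP => // _.
by rewrite -!EFinB; congr (_%:E); ring.
Qed.

Lemma ge0_integral_shift (a : R) (f : R -> \bar R) :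
  measurable_fun [set: R] f -> (forall x, (0 <= f x)%E) ->
  (\int[mu]_x f (x + a)%R = \int[mu]_x f x)%E.
Proof.
move=> mf f0.
have ms : @measurable_fun _ _ (measurableTypeR R) (measurableTypeR R) setT (fun x => x + a).
  exact: measurable_shift.
have := ge0_integral_pushforward ms mu measurableT mf (fun y _ => f0 y).
rewrite preimage_setT => <-.
apply: eq_measure_integral => A mA _.
exact: (esym (lebesgue_measure_shift a mA)).
Qed.

Lemma integral_shift (a : R) (f : R -> \bar R) : measurable_fun [set: R] f ->
  (\int[mu]_x f (x + a)%R = \int[mu]_x f x)%E.
Proof.
move=> mf; rewrite integralE [RHS]integralE.
congr (_ - _)%E.
  rewrite (funepos_comp f (fun x : R => x + a)).
  by rewrite ge0_integral_shift//; exact: measurable_funepos.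
rewrite (funeneg_comp f (fun x : R => x + a)).
by rewrite ge0_integral_shift//; exact: measurable_funeneg.
Qed.

Lemma sqnormL2_tau (a : R) f : cmeasurable f -> sqnormL2 (tau a f) = sqnormL2 f.
Proof.
by move=> mf; apply: (@ge0_integral_shift a (fun x => (cmod (f x) ^+ 2)%:E)) => //;
  [exact: measurable_cmod2E | move=> x; rewrite lee_fin sqr_ge0].
Qed.

Lemma L2_tau (a : R) f : L2 f -> L2 (tau a f).
Proof.
by move=> [mf f2]; split; [exact: cmeas_tau|rewrite sqnormL2_tau].
Qed.

Lemma N2_tau (a : R) f : cmeasurable f -> N2 (tau a f) = N2 f.
Proof. by move=> mf; rewrite /N2 sqnormL2_tau. Qed.

Lemma cint_tau (a : R) f : cmeasurable f -> cint (tau a f) = cint f.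
Proof.
move=> [f1 f2]; apply: eq_ReIm => /=; rewrite /Rintegral; congr fine.
  by apply: (@integral_shift a (fun x => (complex.Re (f x))%:E)); exact/measurable_EFinP.
by apply: (@integral_shift a (fun x => (complex.Im (f x))%:E)); exact/measurable_EFinP.
Qed.

End Translation.

(** * Convergence in the mean and completeness of L2 *)

Section Convergence.
Context {R : realType}.
Notation mu := (@lebesgue_measure R).
Implicit Types f g : R -> R[i].
Local Notation ip := innerL2.

Definition nrm f : R := Num.sqrt (N2 f).

Lemma nrm_ge0 f : 0 <= nrm f. Proof. exact: sqrtr_ge0. Qed.

Lemma nrm_sqr f : nrm f ^+ 2 = N2 f.
Proof. by rewrite sqr_sqrtr// N2_ge0. Qed.

Lemma nrm_le f (e : R) : 0 <= e -> (nrm f <= e) = (N2 f <= e ^+ 2).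
Proof. by move=> e0; rewrite -nrm_sqr ler_pXn2r// ?nnegrE// nrm_ge0. Qed.

Lemma ip_le f g : L2 f -> L2 g -> cmod (ip f g) <= nrm f * nrm g.
Proof.
move=> fL gL; rewrite -(@ler_pXn2r _ 2)// ?nnegrE ?cmod_ge0 ?mulr_ge0 ?nrm_ge0//.
by rewrite exprMn !nrm_sqr CauchySchwarz.
Qed.

Lemma nrmD f g : L2 f -> L2 g -> nrm (fun x => f x + g x) <= nrm f + nrm g.
Proof.
move=> fL gL; rewrite nrm_le ?addr_ge0 ?nrm_ge0// N2D// sqrrD !nrm_sqr.
rewrite [leRHS]addrAC lerD2l -[leRHS]mulr_natl ler_wpM2l//.
by rewrite (le_trans (ler_norm _))// (le_trans (ler_Re_cmod _))// ip_le.
Qed.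

Lemma nrmN f : nrm (fun x => - f x) = nrm f.
Proof. by rewrite /nrm N2N. Qed.

Lemma nrmBC f g : nrm (fun x => f x - g x) = nrm (fun x => g x - f x).
Proof. by rewrite -nrmN; congr nrm; apply/funext => x; rewrite opprB. Qed.

Lemma nrm_triangle f g h : L2 f -> L2 g -> L2 h ->
  nrm (fun x => f x - h x) <= nrm (fun x => f x - g x) + nrm (fun x => g x - h x).
Proof.
move=> fL gL hL.
rewrite (_ : (fun x => f x - h x) = (fun x => (f x - g x) + (g x - h x))).
  by apply: nrmD; exact: L2B.
by apply/funext => x; ring.
Qed.

Lemma nrm_dist f g : L2 f -> L2 g -> `|nrm f - nrm g| <= nrm (fun x => f x - g x).
Proof.
move=> fL gL; rewrite ler_norml; apply/andP; split.
  have := nrmD (L2B gL fL) fL; rewrite nrmBC.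
  by rewrite (_ : (fun x => _ + f x) = g); [lra|apply/funext => x; ring].
have := nrmD (L2B fL gL) gL.
by rewrite (_ : (fun x => _ + g x) = f); [lra|apply/funext => x; ring].
Qed.

(** Stated with the norm and not its square, so that the triangle inequality applies; [L2cvg_sqnorm]
    and [sqnorm_L2cvg] connect it with the limit that defines [fourier]. *)
Definition L2cvg (u : nat -> R -> R[i]) g := forall e : R, 0 < e ->
  exists N, forall n, (N <= n)%N -> nrm (fun x => g x - u n x) <= e.

Lemma L2cvg_sqnorm u g : (forall n, L2 (u n)) -> L2 g -> L2cvg u g ->
  (fun n => sqnormL2 (fun x => g x - u n x)) @ \oo --> 0%E.
Proof.
move=> uL gL ug.
rewrite (_ : (fun _ => _) = EFin \o (fun n => N2 (fun x => g x - u n x))); last first.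
  by apply/funext => n /=; rewrite sqnormE//; exact: L2B.
apply: cvg_EFin; first exact: nearW.
apply/cvgrPdist_le => e e0.
have [N hN] := ug (Num.sqrt e) (etrans (sqrtr_gt0 e) e0).
exists N => // n /= Nn; rewrite sub0r normrN ger0_norm ?N2_ge0//.
by rewrite -[e]sqr_sqrtr ?(ltW e0)// -nrm_le ?sqrtr_ge0// hN.
Qed.

Lemma sqnorm_L2cvg u g : (forall n, L2 (u n)) -> L2 g ->
  (fun n => sqnormL2 (fun x => g x - u n x)) @ \oo --> 0%E -> L2cvg u g.
Proof.
move=> uL gL ug e e0; have e2 : 0 < e ^+ 2 by rewrite exprn_gt0.
have /cvgrPdist_le /(_ _ e2) [N _ hN] : (fun n => N2 (fun x => g x - u n x)) @ \oo --> 0.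
  apply: (@fine_cvg _ _ _ _ (fun n => sqnormL2 (fun x => g x - u n x)) 0); exact: ug.
exists N => n Nn; rewrite nrm_le ?(ltW e0)//.
by have := hN n Nn; rewrite sub0r normrN ger0_norm ?N2_ge0.
Qed.

Lemma L2cvg_ae u f g : (forall n, L2 (u n)) -> L2 f -> L2 g ->
  L2cvg u f -> L2cvg u g -> {ae mu, forall x, f x = g x}.
Proof.
move=> uL fL gL uf ug.
suff h : nrm (fun x => f x - g x) = 0.
  have : N2 (fun x => f x - g x) = 0 by rewrite -nrm_sqr h expr0n.
  move/(ae_N2_eq0 (L2B fL gL)); apply: ae_imply => x.
  by move/eqP; rewrite subr_eq0 => /eqP.
apply/eqP; rewrite eq_le nrm_ge0 andbT; apply/ler_addgt0Pl => e e0; rewrite addr0.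
have e2 : 0 < e / 2 by rewrite divr_gt0.
have [N hN] := uf _ e2; have [M hM] := ug _ e2.
have := hN (maxn N M) (leq_maxl _ _); have := hM (maxn N M) (leq_maxr _ _).
set n := maxn N M => h1 h2.
apply: (le_trans (nrm_triangle fL (uL n) gL)).
by rewrite [leRHS]splitr lerD// nrmBC.
Qed.

Lemma L2cvg_nrm u v f g : (forall n, L2 (u n)) -> (forall n, L2 (v n)) ->
  L2 f -> L2 g -> L2cvg u f -> L2cvg v g ->
  (forall n, (0 < n)%N -> nrm (u n) = nrm (v n)) -> nrm f = nrm g.
Proof.
move=> uL vL fL gL uf vg uv.
apply/eqP; rewrite -subr_eq0 -normr_eq0 eq_le normr_ge0 andbT.
apply/ler_addgt0Pl => e e0; rewrite addr0.
have e2 : 0 < e / 2 by rewrite divr_gt0.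
have [N hN] := uf _ e2; have [M hM] := vg _ e2.
(* The successor makes the index positive, as the hypothesis on the norms requires. *)
pose n := (maxn N M).+1.
have Nn : (N <= n)%N by rewrite ltnW// ltnS leq_maxl.
have Mn : (M <= n)%N by rewrite ltnW// ltnS leq_maxr.
rewrite (_ : _ - _ = (nrm f - nrm (u n)) - (nrm g - nrm (v n))); last by rewrite uv//; ring.
apply: (le_trans (ler_normB _ _)); rewrite [leRHS]splitr.
by apply: lerD; apply: (le_trans (nrm_dist _ _)) => //; [exact: hN|exact: hM].
Qed.

Lemma L2cvgD u v f g : (forall n, L2 (u n)) -> (forall n, L2 (v n)) ->
  L2 f -> L2 g -> L2cvg u f -> L2cvg v g ->
  L2cvg (fun n x => u n x + v n x) (fun x => f x + g x).
Proof.
move=> uL vL fL gL uf vg e e0.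
have e2 : 0 < e / 2 by rewrite divr_gt0.
have [N hN] := uf _ e2; have [M hM] := vg _ e2.
exists (maxn N M) => n; rewrite geq_max => /andP[Nn Mn].
rewrite (_ : (fun x => _) = (fun x => (f x - u n x) + (g x - v n x))).
  apply: (le_trans (nrmD (L2B fL (uL n)) (L2B gL (vL n)))).
  by rewrite [leRHS]splitr; apply: lerD; [exact: hN|exact: hM].
by apply/funext => x; ring.
Qed.

Lemma L2cvgZ (c : R[i]) u f : (forall n, L2 (u n)) -> L2 f -> L2cvg u f ->
  L2cvg (fun n x => c * u n x) (fun x => c * f x).
Proof.
move=> uL fL uf e e0.
(* Adding 1 avoids a division by zero when c = 0. *)
have c0 : 0 < cmod c + 1 by rewrite ltr_wpDl// cmod_ge0.
have [N hN] := uf _ (divr_gt0 e0 c0); exists N => n Nn.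
rewrite nrm_le ?(ltW e0)// (_ : (fun x => _) = (fun x => c * (f x - u n x))); last first.
  by apply/funext => x; ring.
rewrite N2Z; last exact: L2B.
have -> : e = (cmod c + 1) * (e / (cmod c + 1)) by rewrite mulrCA divff ?mulr1// gt_eqF.
rewrite exprMn ler_pM ?sqr_ge0 ?N2_ge0//.
  by rewrite ler_pXn2r ?nnegrE ?cmod_ge0 ?lerDl// ltW.
by rewrite -nrm_le ?hN// divr_ge0 ?ltW.
Qed.

Definition L2Cauchy (u : nat -> R -> R[i]) := forall e : R, 0 < e ->
  exists N, forall m n, (N <= m)%N -> (N <= n)%N -> nrm (fun x => u m x - u n x) <= e.

Lemma limn_einf_le (w : nat -> \bar R) (c : \bar R) : (forall n, (w n <= c)%E) ->
  (limn_einf w <= c)%E.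
Proof.
move=> wc; rewrite limn_einf_lim; apply: lime_le; first exact: is_cvg_einfs.
apply: nearW => n; apply: (le_trans _ (wc n)).
by apply: ereal_inf_lbound; exists n => /=.
Qed.

(** This is X <= X^2 + 1 at X = 2^k a, divided by 2^k. It turns a weighted sum of squares of
    increments into a bound on the sum of the increments themselves. *)
Lemma ler_sqr_geo (k : nat) (a : R) : 0 <= a ->
  a <= 2 ^+ k * a ^+ 2 + (2^-1) ^+ k.
Proof.
move=> a0; have k0 : 0 < 2 ^+ k :> R by rewrite exprn_gt0.
rewrite exprVn -(ler_pM2l k0) mulrDr divff ?gt_eqF// mulrA -expr2.
have X0 : 0 <= 2 ^+ k * a by rewrite mulr_ge0// ltW.
by rewrite -exprMn; move: (2 ^+ k * a) X0 => X X0; have := sqr_ge0 (X - 1); lra.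
Qed.

Lemma cvg_of_increments (w : nat -> R) (D : nat -> R) :
  (forall k, `|w k.+1 - w k| <= D k) -> (forall k, 0 <= D k) ->
  (\sum_(k <oo) (2 ^+ k * D k ^+ 2)%:E < +oo)%E -> cvgn w.
Proof.
move=> wD D0 S; set s := (\sum_(k <oo) _)%E in S.
have s0 : (0 <= s)%E.
  by apply: nneseries_ge0 => k _ _; rewrite lee_fin mulr_ge0 ?sqr_ge0// exprn_ge0.
have c1 : cvgn (series (fun k => 2 ^+ k * D k ^+ 2)).
  apply: nondecreasing_is_cvgn.
    by apply: nondecreasing_series => n _; rewrite mulr_ge0 ?sqr_ge0// exprn_ge0.
  exists (fine s) => _ [n _ <-]; rewrite -lee_fin fineK ?ge0_fin_numE// -sumEFin.
  by apply: nneseries_lim_ge => k _ _; rewrite lee_fin mulr_ge0 ?sqr_ge0// exprn_ge0.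
have c2 : cvgn (series (fun k => (2^-1 : R) ^+ k)).
  have := @is_cvg_geometric_series R 1 (2^-1).
  rewrite /geometric /= (_ : (fun n => 1 * _) = (fun k => (2^-1 : R) ^+ k)).
    by apply; rewrite ger0_norm ?invr_ge0// invf_lt1// ltr1n.
  by apply/funext => n; rewrite mul1r.
have : cvgn (series (telescope w)).
  apply: normed_cvg; apply: (series_le_cvg _ _ _ (is_cvg_seriesD c1 c2)) => n /=.
  - exact: normr_ge0.
  - by rewrite addr_ge0 ?mulr_ge0 ?sqr_ge0 ?exprn_ge0.
  - by rewrite /telescope (le_trans (wD n))// ler_sqr_geo.
move=> c3; rewrite (_ : w = (fun n => w 0%N + series (telescope w) n)); last first.
  by apply/funext => n; rewrite [LHS]eq_sum_telescope.
by apply: is_cvgD => //; exact: is_cvg_cst.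
Qed.

Lemma cvg_cmod2 (w : nat -> R[i]) (l : R[i]) :
  (fun n => complex.Re (w n)) @ \oo --> complex.Re l ->
  (fun n => complex.Im (w n)) @ \oo --> complex.Im l ->
  (fun n => cmod (w n) ^+ 2) @ \oo --> cmod l ^+ 2.
Proof.
move=> h1 h2; rewrite cmod_sqr.
rewrite (_ : (fun n => cmod _ ^+ 2) = (fun n => complex.Re (w n) * complex.Re (w n)
  + complex.Im (w n) * complex.Im (w n))); last first.
  by apply/funext => n; rewrite cmod_sqr !expr2.
by rewrite !expr2; apply: cvgD; apply: cvgM.
Qed.

(* A subsequence with increments of norm at most 2^-(k+1) converges almost
   everywhere; Fatou's lemma gives the convergence in norm. *)
Lemma L2_complete u : (forall n, L2 (u n)) -> L2Cauchy u ->
  exists2 g, L2 g & L2cvg u g.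
Proof.
move=> uL uC; pose ep k : R := (2^-1) ^+ k.+1.
have ep0 k : 0 < ep k by rewrite exprn_gt0// invr_gt0.
have /choice[Nf hNf] k := uC _ (ep0 k).
(* Summing the thresholds makes the indices of the subsequence nondecreasing while each still
   dominates [Nf k]. *)
pose phi k := (\sum_(i < k.+1) Nf i)%N.
have phi_le k j : (k <= j)%N -> (phi k <= phi j)%N.
  move=> /subnK <-; elim: (j - k)%N => [//|m ih].
  by rewrite addSn {2}/phi big_ord_recr /= (leq_trans ih)// leq_addr.
have Nphi k : (Nf k <= phi k)%N by rewrite /phi big_ord_recr /= leq_addl.
pose v k := u (phi k).
have vL k : L2 (v k) by exact: uL.
have vC k j : (k <= j)%N -> nrm (fun x => v j x - v k x) <= ep k.
  by move=> kj; apply: hNf => //; rewrite (leq_trans (Nphi k))// phi_le.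
pose d k x := v k.+1 x - v k x.
have dL k : L2 (d k) by exact: L2B.
(* The weight 2^k is heavy enough for [cvg_of_increments] wherever [S x] is finite, and light enough
   for [S] to be integrable: the k-th integral is at most 2^k ([ep k])^2 = 2^-(k+2). *)
pose S x := (\sum_(k <oo) (2 ^+ k * cmod (d k x) ^+ 2)%:E)%E.
have t0 k x : (0 <= (2 ^+ k * cmod (d k x) ^+ 2)%:E)%E.
  by rewrite lee_fin mulr_ge0 ?sqr_ge0// exprn_ge0.
have mt k : measurable_fun [set: R] (fun x => (2 ^+ k * cmod (d k x) ^+ 2)%:E).
  apply/measurable_EFinP; apply: measurable_funM => //.
  exact: (measurable_cmod2 (L2_meas (dL k))).
have mS : measurable_fun [set: R] S by exact: ge0_emeasurable_sum.
have S0 x : (0 <= S x)%E by exact: nneseries_ge0.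
have iS : (\int[mu]_x S x < +oo)%E.
  rewrite integral_nneseries//.
  apply: (@le_lt_trans _ _ (\sum_(k <oo) (1 / (2 ^ (k + 1))%:R)%:E)%E); last first.
    have := @cvg_geometric_eseries_half R 1 0.
    by move=> /cvg_lim ->//; rewrite ltry.
  apply: lee_nneseries => [k _ _|k _]; first exact: integral_ge0.
  under eq_integral do rewrite EFinM.
  rewrite ge0_integralZl//; last 2 first.
  - exact: (measurable_cmod2E (L2_meas (dL k))).
  - by move=> x _; rewrite lee_fin sqr_ge0.
  rewrite -/(sqnormL2 (d k)) sqnormE// -EFinM lee_fin.
  have h : N2 (d k) <= ep k ^+ 2 by rewrite -nrm_le ?(ltW (ep0 k))// vC.
  apply: (@le_trans _ _ (2 ^+ k * ep k ^+ 2)); first by rewrite ler_wpM2l// exprn_ge0.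
  rewrite /ep exprVn addn1 natrX expr2 mulrA exprS.
  have k0 : 0 < 2 ^+ k :> R by rewrite exprn_gt0.
  rewrite [leLHS](_ : _ = (2 * 2 ^+ k)^-1 / 2); last by field; rewrite gt_eqF.
  by rewrite div1r ler_piMr ?invr_ge0 ?mulr_ge0 ?ltW// invf_lt1// ltr1n.
pose A := [set x | (S x < +oo)%E].
have mA : measurable A.
  by have := emeasurable_fun_infty_o measurableT mS +oo%E; rewrite setTI.
have aeA : {ae mu, forall x, x \in A}.
  have : {ae mu, forall x, [set: R] x -> S x \is a fin_num}.
    apply: integrable_ae => //; apply/integrableP; split => //.
    by under eq_integral do rewrite gee0_abs//.
  by apply: ae_imply => x /(_ I) h; rewrite inE /A /= -ge0_fin_numE.
have cRe x : x \in A -> cvgn (fun k => complex.Re (v k x)).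
  rewrite inE => Ax; apply: (@cvg_of_increments _ (fun k => cmod (d k x))) => // k.
    by rewrite -cReB ler_Re_cmod.
  exact: cmod_ge0.
have cIm x : x \in A -> cvgn (fun k => complex.Im (v k x)).
  rewrite inE => Ax; apply: (@cvg_of_increments _ (fun k => cmod (d k x))) => // k.
    by rewrite -cImB ler_Im_cmod.
  exact: cmod_ge0.
(* Set to 0 off the set of convergence, the sequence converges at every point, so its limit is
   measurable. *)
pose v' k x := ind A x * v k x.
have v'L k : L2 (v' k) by exact: L2_ind.
pose g x := ind A x * (limn (fun k => complex.Re (v k x)) +i* limn (fun k => complex.Im (v k x))).
have gRe x : (fun k => complex.Re (v' k x)) @ \oo --> complex.Re (g x).
  rewrite /v' /g indE; case: ifPn => xA.
    by under eq_fun do rewrite mul1r; rewrite mul1r /=; exact: cRe.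
  by under eq_fun do rewrite mul0r; rewrite mul0r /=; exact: cvg_cst.
have gIm x : (fun k => complex.Im (v' k x)) @ \oo --> complex.Im (g x).
  rewrite /v' /g indE; case: ifPn => xA.
    by under eq_fun do rewrite mul1r; rewrite mul1r /=; exact: cIm.
  by under eq_fun do rewrite mul0r; rewrite mul0r /=; exact: cvg_cst.
have mg : cmeasurable g.
  split.
    apply: (measurable_fun_cvg (h := fun k x => complex.Re (v' k x))) => [k|x _].
      by case: (L2_meas (v'L k)).
    exact: gRe.
  apply: (measurable_fun_cvg (h := fun k x => complex.Im (v' k x))) => [k|x _].
    by case: (L2_meas (v'L k)).
  exact: gIm.
have gv k : (sqnormL2 (fun x => g x - v' k x)%R <= (ep k ^+ 2)%:E)%E.
  (* Fatou's lemma in m, with k fixed: [v' (k + m)] - [v' k] tends pointwise to [g] - [v' k], with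
     norms at most [ep k]. *)
  pose f m x := (cmod (v' (k + m)%N x - v' k x) ^+ 2)%:E.
  have -> : sqnormL2 (fun x => g x - v' k x)%R = (\int[mu]_x limn_einf (f^~ x))%E.
    apply: eq_integral => x _; apply/esym.
    have cf : f^~ x @ \oo --> (cmod (g x - v' k x) ^+ 2)%:E.
      apply: cvg_EFin; first exact: nearW.
      apply: (@cvg_cmod2 (fun m => v' (k + m)%N x - v' k x)) => /=.
        rewrite cReB; under eq_fun do rewrite cReB; apply: cvgB; last exact: cvg_cst.
        by have := gRe x; rewrite -(cvg_shiftn k); under eq_fun do rewrite addnC.
      rewrite cImB; under eq_fun do rewrite cImB; apply: cvgB; last exact: cvg_cst.
      by have := gIm x; rewrite -(cvg_shiftn k); under eq_fun do rewrite addnC.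
    rewrite is_cvg_limn_einfE; last by apply/cvg_ex; eexists; exact: cf.
    exact/cvg_lim.
  have mf m : measurable_fun [set: R] (f m).
    by apply: measurable_cmod2E; apply: cmeasB; exact: L2_meas.
  have f0 m x : [set: R] x -> (0 <= f m x)%E by move=> _; rewrite lee_fin sqr_ge0.
  have ft := fatou mu measurableT mf f0.
  apply: (le_trans ft).
  apply: limn_einf_le => m.
  rewrite [X in (X <= _)%E]/(sqnormL2 _).
  apply: (@le_trans _ _ (1%:E * sqnormL2 (fun x => v (k + m)%N x - v k x)%R)%E).
    apply: sqnormL2_leM => //.
    - by apply: cmeasB; exact: L2_meas.
    - by apply: cmeasB; exact: L2_meas.
    - move=> x; rewrite /v' -mulrBr cmodM exprMn ler_wpM2r ?sqr_ge0//.
      by rewrite expr_le1// ?cmod_ge0// cmod_ind_le1.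
  rewrite mul1e sqnormE; last exact: L2B.
  by rewrite lee_fin -nrm_le ?(ltW (ep0 k))// vC// leq_addr.
have gL : L2 g.
  have h : L2 (fun x => g x - v' 0%N x).
    split; first by apply: cmeasB => //; exact: L2_meas.
    by apply: (le_lt_trans (gv 0%N)); rewrite ltry.
  have := L2D h (v'L 0%N).
  by rewrite (_ : (fun x => _ + _) = g)//; apply/funext => x; ring.
have gv' k : nrm (fun x => g x - v k x) <= ep k.
  rewrite nrm_le ?(ltW (ep0 k))// -lee_fin -sqnormE; last exact: L2B.
  rewrite (@ae_sqnormL2 _ _ (fun x => g x - v' k x))//.
  - by apply: cmeasB; exact: L2_meas.
  - by apply: cmeasB; exact: L2_meas.
  - by apply: ae_imply aeA => x xA; rewrite /v' indE xA mul1r.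
exists g => // e e0.
have [k hk] : exists k, ep k + ep k <= e.
  have h2 : `|2^-1 : R| < 1 by rewrite ger0_norm ?invr_ge0// invf_lt1// ltr1n.
  have /cvgrPdist_le /(_ _ e0) [k _ hk] := cvg_geometric 1 h2.
  exists k; have := hk k; rewrite /geometric /= mul1r sub0r normrN ger0_norm ?exprn_ge0//.
  by move=> /(_ (leqnn k)); rewrite /ep exprS; lra.
exists (phi k) => n kn; apply: (le_trans _ hk).
apply: (le_trans (nrm_triangle gL (vL k) (uL n))); apply: lerD => //.
by apply: hNf => //; rewrite (leq_trans (Nphi k)).
Qed.

End Convergence.

(** * Dominated convergence in L2 *)

Section DominatedL2.
Context {R : realType}.
Notation mu := (@lebesgue_measure R).

Lemma L2cvg_dominated (u : nat -> R -> R[i]) (f : R -> R[i]) (G : R -> R) :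
  (forall n, cmeasurable (u n)) -> cmeasurable f ->
  mu.-integrable [set: R] (EFin \o G) ->
  (forall n x, cmod (f x - u n x) ^+ 2 <= G x) ->
  {ae mu, forall x, (fun n => cmod (f x - u n x) ^+ 2) @ \oo --> 0} ->
  L2cvg u f.
Proof.
move=> mu_ mf iG fG cf e e0.
pose F n x := (cmod (f x - u n x) ^+ 2)%:E.
have mF n : measurable_fun [set: R] (F n) by apply: measurable_cmod2E; exact: cmeasB.
have cF : {ae mu, forall x, [set: R] x -> F ^~ x @ \oo --> (cst 0%E : R -> \bar R) x}.
  by apply: ae_imply cf => x h _; apply: cvg_EFin => //; exact: nearW.
have dF : {ae mu, forall x n, [set: R] x -> (`|F n x| <= (EFin \o G) x)%E}.
  by apply: aeW => x n _; rewrite /F /= lee_fin ger0_norm ?sqr_ge0.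
have [_ _] := @dominated_convergence _ _ _ mu _ measurableT F (cst 0%E) _ mF (measurable_cst _) cF iG dF.
rewrite integral0 => h.
have /cvgrPdist_le /(_ _ (exprn_gt0 2 e0)) [N _ hN] :
    (fun n => N2 (fun x => f x - u n x)) @ \oo --> 0.
  by apply: (@fine_cvg _ _ _ _ (fun n => sqnormL2 (fun x => f x - u n x)) 0).
exists N => n Nn; rewrite nrm_le ?(ltW e0)//.
by have := hN n Nn; rewrite sub0r normrN ger0_norm ?N2_ge0.
Qed.

Lemma ler_cmod_sqrB (z w : R[i]) (M : R) : cmod z <= M -> cmod w <= M ->
  cmod (z - w) ^+ 2 <= (2 * M) ^+ 2.
Proof.
move=> zM wM; have M0 := le_trans (cmod_ge0 z) zM.
rewrite ler_pXn2r// ?nnegrE ?cmod_ge0 ?mulr_ge0//.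
by rewrite (le_trans (ler_cmodD _ _))// cmodN mulr_natl mulr2n lerD.
Qed.

Lemma L2cvg_trunc (f : R -> R[i]) (A : nat -> set R) : L2 f ->
  (forall n, measurable (A n)) ->
  (forall x, exists N, forall n, (N <= n)%N -> A n x) ->
  L2cvg (fun n x => ind (A n) x * f x) f.
Proof.
move=> fL mA cA; apply: (@L2cvg_dominated _ _ (fun x => cmod (f x) ^+ 2)).
- by move=> n; apply: cmeasM; [exact: cmeas_ind|exact: L2_meas].
- exact: L2_meas.
- exact: integrable_cmod2.
- move=> n x; rewrite indE; case: ifP => _; rewrite ?mul1r ?subrr ?cmod0 ?mul0r ?subr0//.
  by rewrite expr0n sqr_ge0.
apply: aeW => x; have [N hN] := cA x.
apply: cvg_near_cst; exists N => // n /= Nn.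
by rewrite indE mem_set ?mul1r ?subrr ?cmod0 ?expr0n//=; exact: hN.
Qed.

End DominatedL2.

(** * Fourier series *)

Section TrigSystem.
Context {R : realType} (a T c : R) (T0 : 0 < T) (cT : c * T = 2 * pi).
Notation mu := (@lebesgue_measure R).
Local Notation ip := innerL2.
Implicit Types f g : R -> R[i].

(** Origin, length and frequency stay general because the system is used on several intervals: [-N,
    N[ for Plancherel's theorem, [0, h[ and [-h, 0[ for the frame coefficients. *)
Definition period : set R := `[a, a + T[%classic.
Local Notation I := period.

Definition ek (k : int) (x : R) : R[i] := expi (k%:~R * c * x).

Lemma measurable_period : measurable I. Proof. exact: measurable_itv. Qed.
Hint Resolve measurable_period : core.

Lemma mu_period : mu I = T%:E.
Proof.
by rewrite /I lebesgue_measure_itv /= lte_fin ltrDl T0 -EFinB addrAC subrr add0r.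
Qed.

Lemma ekD j k x : ek (j + k) x = ek j x * ek k x.
Proof. by rewrite -expiD /ek intrD; congr expi; ring. Qed.

Lemma ekN k x : ek (- k) x = (ek k x)^*.
Proof. by rewrite expiJ /ek mulrNz; congr expi; ring. Qed.

Lemma ek0 x : ek 0 x = 1.
Proof. by rewrite /ek !mul0r expi0. Qed.

Lemma ekB k x y : ek k (x - y) = ek k x * ek (- k) y.
Proof. by rewrite /ek -expiD mulrNz; congr expi; ring. Qed.

Lemma cmod_ek k x : cmod (ek k x) = 1. Proof. exact: cmod_expi. Qed.

Lemma ek_period k x : ek k (x + T) = ek k x.
Proof.
rewrite /ek mulrDr expiD -[k%:~R * c * T]mulrA cT expi_2piz mulr1//.
Qed.

Lemma cmeas_ek k : cmeasurable (ek k). Proof. exact: cmeas_expi. Qed.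

Lemma integrable_cst_ind (M : R) :
  mu.-integrable [set: R] (EFin \o (fun x => M * \1_I x)).
Proof.
by apply: integrable_Zl; exact: integrable_indic_itv.
Qed.

Lemma cintegrable_bnd (M : R) f : cmeasurable f -> (forall x, cmod (f x) <= M) ->
  cintegrable (fun x => ind I x * f x).
Proof.
move=> mf fM; apply: (cintegrable_dom _ (integrable_cst_ind M)) => [|x].
  by apply: cmeasM => //; exact: cmeas_ind.
rewrite cmodM indE indicE; case: ifP => _.
  by rewrite cmod1 mul1r mulr1.
by rewrite cmod0 mul0r mulr0.
Qed.

Lemma L2_bnd (M : R) f : cmeasurable f -> (forall x, cmod (f x) <= M) ->
  L2 (fun x => ind I x * f x).
Proof.
move=> mf fM; have M0 := le_trans (cmod_ge0 _) (fM 0); split.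
  by apply: cmeasM => //; exact: cmeas_ind.
have /integrableP[_] := integrable_cst_ind (M ^+ 2).
apply: le_lt_trans; apply: ge0_le_integral => //.
- by move=> x _; rewrite lee_fin sqr_ge0.
- by apply: measurable_cmod2E; apply: cmeasM => //; exact: cmeas_ind.
- apply: measurableT_comp => //; apply/measurable_EFinP.
  by apply: measurable_funM => //; exact: measurable_indic.
- move=> x _ /=; rewrite lee_fin cmodM indE indicE; case: ifP => _.
    rewrite cmod1 mul1r mulr1 ger0_norm ?sqr_ge0// ler_pXn2r// nnegrE//.
    exact: cmod_ge0.
  by rewrite cmod0 mul0r mulr0 normr0 expr0n.
Qed.

(** These functions are orthogonal but not normalized: their squared norm is T, which explains the
    factors T and T^-1 below. *)
Definition Ek k x : R[i] := ind I x * ek k x.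

Lemma L2_Ek k : L2 (Ek k).
Proof. by apply: (@L2_bnd 1) => [|x]; [exact: cmeas_ek|rewrite cmod_ek]. Qed.

Lemma Rint_period (F f : R -> R) : continuous f ->
  (forall x : R, is_derive x (1 : R) F (f x)) ->
  \int[mu]_(x in I) f x = F (a + T) - F a.
Proof.
move=> cf dF.
have dc x : {for x, continuous F}.
  by apply: differentiable_continuous; apply/derivable1_diffP; case: (dF x).
have aT : a < a + T by rewrite ltrDl.
rewrite /Rintegral /I integral_itv_bndo_bndc; last first.
  apply/measurable_EFinP; apply: measurable_funTS.
  exact: continuous_measurable_fun.
rewrite (@continuous_FTC2 _ f F)//.
- exact: continuous_subspaceT.
- split.
  + by move=> x _; case: (dF x).
  + exact: (cvg_at_right_filter (dc _)).
  + exact: (cvg_at_left_filter (dc _)).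
- by move=> x _; rewrite derive1E; exact: derive_val.
Qed.

Lemma cint_Ek k : cint (Ek k) = if k == 0 then T%:C else 0.
Proof.
have aT : a < a + T by rewrite ltrDl.
rewrite -cintegral_ind /cintegral /ek /expi /=; case: eqP => [->|/eqP k0].
  apply: eq_ReIm => /=; rewrite !mul0r.
    under eq_Rintegral do rewrite mul0r cos0.
    by rewrite Rintegral_cst// mul1r -[RHS]/(fine T%:E); congr fine; exact: mu_period.
  under eq_Rintegral do rewrite mul0r sin0.
  by rewrite Rintegral_cst// mul0r.
set w := k%:~R * c.
have c0 : c != 0.
  apply/eqP => c0; have := cT; rewrite c0 mul0r => /esym/eqP.
  by rewrite mulf_eq0 pnatr_eq0 /= gt_eqF// pi_gt0.
have w0 : w != 0 by rewrite mulf_neq0// intr_eq0.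
have periodize : expi (w * (a + T)) = expi (w * a) by exact: ek_period.
have [pc ps] : cos (w * (a + T)) = cos (w * a) /\ sin (w * (a + T)) = sin (w * a).
  by case: periodize.
have dl (x : R) : is_derive x (1 : R) ( *%R w) w.
  have := @is_deriveZ _ _ _ (id : R -> R) w x 1 1 (is_derive_id _ _).
  by rewrite /GRing.scale /= mulr1.
have ds (x : R) : is_derive x (1 : R) (fun x => w^-1 * sin (w * x)) (cos (w * x)).
  have := @is_deriveZ _ _ _ _ w^-1 x 1 _ (is_derive1_comp (is_derive_sin (w * x)) (dl x)).
  by rewrite /GRing.scale /= mulrCA mulVf// mulr1.
have dc (x : R) : is_derive x (1 : R) (fun x => - w^-1 * cos (w * x)) (sin (w * x)).
  have := @is_deriveZ _ _ _ _ (- w^-1) x 1 _ (is_derive1_comp (is_derive_cos (w * x)) (dl x)).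
  rewrite (_ : - w^-1 *: (- sin (w * x) * w) = sin (w * x))//.
  by rewrite /GRing.scale /=; field.
apply: eq_ReIm => /=.
  rewrite (Rint_period _ ds) ?ps ?subrr// => x.
  by apply: continuous_comp; [exact: mulrl_continuous|exact: continuous_cos].
rewrite (Rint_period _ dc) ?pc ?subrr// => x.
by apply: continuous_comp; [exact: mulrl_continuous|exact: continuous_sin].
Qed.

Lemma ip_Ek j k : ip (Ek j) (Ek k) = if j == k then T%:C else 0.
Proof.
rewrite /innerL2 -[LHS]/(cint _) -(subr_eq0 j k) -cint_Ek; apply: eq_cint => x.
by rewrite /Ek rmorphM /= indJ mulrACA indM -ekN -ekD.
Qed.

(** Frequencies may repeat in [s], so that a sum is a concatenation and a product runs over all
    pairs; [trig_tsum] collects equal frequencies afterwards. *)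
Definition trig (s : seq (R[i] * int)) (x : R) : R[i] :=
  \sum_(p <- s) p.1 * ek p.2 x.

Lemma trig_cat s s' x : trig (s ++ s') x = trig s x + trig s' x.
Proof. exact: big_cat. Qed.

Lemma trigZ w s x : trig [seq (w * p.1, p.2) | p <- s] x = w * trig s x.
Proof.
by rewrite /trig big_map mulr_sumr; apply: eq_bigr => p _; rewrite mulrA.
Qed.

Lemma trigM s s' x :
  trig [seq (p.1 * q.1, p.2 + q.2) | p <- s, q <- s'] x = trig s x * trig s' x.
Proof.
rewrite /trig big_allpairs_dep big_distrlr /=; apply: eq_bigr => p _.
by apply: eq_bigr => q _; rewrite ekD mulrACA.
Qed.

Lemma cmeas_trig s : cmeasurable (trig s).
Proof. by apply: cmeas_sum => p; apply: cmeasM; [exact: cmeas_cst|exact: cmeas_ek]. Qed.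

Lemma cmod_trig_le s x : cmod (trig s x) <= \sum_(p <- s) cmod p.1.
Proof.
apply: (le_trans (cmod_sum _ _)); apply: ler_sum => p _.
by rewrite cmodM cmod_ek mulr1.
Qed.

Lemma L2_trig s : L2 (fun x => ind I x * trig s x).
Proof. exact: (L2_bnd (cmeas_trig s) (cmod_trig_le s)). Qed.

(* The normalized powers of this trigonometric polynomial are an approximate
   identity on the period: their mass concentrates at the maximum of kappa. *)
Definition kappa (x : R) : R := (1 + cos (c * x)) / 2.

Lemma kappa_ge0 x : 0 <= kappa x.
Proof. by rewrite divr_ge0//; have := cos_geN1 (c * x); lra. Qed.

Lemma kappa_le1 x : kappa x <= 1.
Proof. by rewrite ler_pdivrMr// mul1r; have := cos_le1 (c * x); lra. Qed.

Lemma kappa_trig n : exists s, forall x, (kappa x ^+ n)%:C = trig s x.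
Proof.
elim: n => [|n [s hs]].
  by exists [:: (1, 0)] => x; rewrite /trig big_seq1 ek0 mulr1.
(* Euler's formula: (1 + cos t) / 2 = 1/2 + e^(it) / 4 + e^(-it) / 4. *)
pose s1 : seq (R[i] * int) := [:: ((2^-1)%:C, 0); ((4^-1)%:C, 1); ((4^-1)%:C, -1)].
have hs1 x : (kappa x)%:C = trig s1 x.
  rewrite /trig !big_cons big_nil ek0 ekN /ek mul1r /kappa.
  by apply: eq_ReIm; rewrite !cE /=; field.
exists [seq (p.1 * q.1, p.2 + q.2) | p <- s1, q <- s] => x.
by rewrite trigM -hs1 -hs exprS; apply: eq_ReIm; rewrite !cE; ring.
Qed.

Lemma cintegralR (u : R -> R) : cintegral I (fun y => (u y)%:C) = (\int[mu]_(y in I) u y)%:C.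
Proof. by apply: eq_ReIm => //=; rewrite /Rintegral integral0. Qed.

(** As e^(ikc(x - y)) separates into a factor in x and a factor in y, the convolution of any bounded
    g with a trigonometric polynomial is again a trigonometric polynomial. *)
Lemma cintegral_trig (g : R -> R[i]) (M : R) s x : cmeasurable g ->
  (forall y, cmod (g y) <= M) ->
  cintegral I (fun y => g y * trig s (x - y)) =
  trig [seq (p.1 * cintegral I (fun y => g y * ek (- p.2) y), p.2) | p <- s] x.
Proof.
move=> mg gM; rewrite /trig big_map /=.
have ig (p : R[i] * int) : cintegrable (fun y => ind I y * (g y * ek (- p.2) y)).
  apply: (@cintegrable_bnd M); first by apply: cmeasM => //; exact: cmeas_ek.
  by move=> y; rewrite cmodM cmod_ek mulr1.
rewrite cintegral_ind.
rewrite (@eq_cint _ _ (fun y => \sum_(p <- s) (p.1 * ek p.2 x) * (ind I y * (g y * ek (- p.2) y)))).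
  rewrite cint_sum; last by move=> p; exact: cintegrableZ.
  apply: eq_bigr => p _; rewrite cintZ// cintegral_ind; ring.
move=> y; rewrite /trig !mulr_sumr; apply: eq_bigr => p _.
by rewrite ekB; ring.
Qed.

Definition kmass n (x : R) : R := \int[mu]_(y in I) (kappa (x - y) ^+ n).

(** The mass is the convolution of 1 with the kernel, where only frequency 0 survives. Lower bounds
    on it can therefore be proved at the single point a. *)
Lemma kmass_cst n x x' : kmass n x = kmass n x'.
Proof.
have [s hs] := kappa_trig n.
suff h z : (kmass n z)%:C = \sum_(p <- s | p.2 == 0) p.1 * T%:C.
  by have := h x; rewrite -(h x') => -[].
rewrite -cintegralR.
rewrite (_ : (fun y => _) = (fun y => 1 * trig s (z - y))); last first.
  by apply/funext => y; rewrite mul1r hs.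
rewrite (@cintegral_trig _ 1); last 2 first.
- exact: cmeas_cst.
- by move=> y; rewrite cmod1.
rewrite /trig big_map /= [RHS]big_mkcond /=; apply: eq_bigr => p _.
rewrite cintegral_ind (@eq_cint _ _ (Ek (- p.2))); last by move=> y; rewrite mul1r.
rewrite cint_Ek oppr_eq0; case: eqP => [->|_]; first by rewrite ek0 mulr1.
by rewrite mulr0 mul0r.
Qed.

Lemma measurable_kappaX n x : measurable_fun [set: R] (fun y => kappa (x - y) ^+ n).
Proof.
apply: measurable_funX; apply: measurable_funM => //.
apply: measurable_funD => //; apply: (measurableT_comp (f := @cos R)).
  by apply: continuous_measurable_fun; exact: continuous_cos.
by apply: measurable_funM => //; exact: measurable_funB.
Qed.

Lemma integrable_period_bnd (M : R) (u : R -> R) : measurable_fun [set: R] u ->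
  (forall x, `|u x| <= M) -> mu.-integrable I (EFin \o u).
Proof.
move=> mu' uM.
have iM : mu.-integrable I (EFin \o cst M).
  apply/integrableP; split; first by apply/measurable_EFinP; exact: measurable_cst.
  by rewrite /= integral_cst// [X in (_ * X)%E]mu_period -EFinM ltry.
apply: le_integrable iM => //.
  by apply/measurable_EFinP; exact: measurable_funTS.
by move=> x _ /=; rewrite lee_fin (le_trans (uM x))// ler_norm.
Qed.

Lemma norm_kappaX n x : `|kappa x ^+ n| <= 1.
Proof. by rewrite ger0_norm ?exprn_ge0 ?kappa_ge0// exprn_ile1// ?kappa_ge0// kappa_le1. Qed.

Lemma kappa_lt (t u : R) : 0 < c -> 0 <= u -> u < t -> c * t <= pi -> kappa t < kappa u.
Proof.
move=> c0 u0 ut tpi.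
have inv_cutoff : c * u < c * t by rewrite ltr_pM2l.
have cu : 0 <= c * u by rewrite mulr_ge0// ltW.
rewrite /kappa ltr_pM2r// ltrD2l ltr_cos ?in_itv /=//.
- by rewrite cu (le_trans _ tpi)// ltW.
- by rewrite tpi andbT (le_trans cu)// ltW.
Qed.

Lemma kappaN t : kappa (- t) = kappa t.
Proof. by rewrite /kappa mulrN cosN. Qed.

(** [kappa] is even, T-periodic and decreasing on [0, T/2], and t is reflected into that interval.
    The bound T - d excludes the next maximum, at T. *)
Lemma kappa_le (d t : R) : 0 < c -> 0 <= d -> d <= T / 2 -> d <= `|t| -> `|t| <= T - d ->
  kappa t <= kappa d.
Proof.
move=> c0 d0 dT dt tT.
have -> : kappa t = kappa `|t|.
  by case: (leP 0 t) => t0; [rewrite ger0_norm|rewrite ltr0_norm// kappaN].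
have half : c * (T / 2) = pi by rewrite mulrA cT mulrAC divff ?mul1r.
move: `|t| (normr_ge0 t) dt tT => {}t t0 dt tT.
have key v : d <= v -> v <= T / 2 -> kappa v <= kappa d.
  move=> dv vT; move: dv; rewrite le_eqVlt => /predU1P[->//|dv].
  by apply/ltW/kappa_lt => //; rewrite -half ler_pM2l.
have [tT2|tT2] := leP t (T / 2); first exact: key.
have -> : kappa t = kappa (T - t).
  rewrite /kappa mulrBr cT -(cosN (2 * pi - _)) opprB mulr_natl.
  by rewrite -(cosD2pi (c * t - _)) subrK.
by apply: key; lra.
Qed.

Definition kconv n (g : R -> R) (x : R) : R :=
  (kmass n x)^-1 * \int[mu]_(y in I) (g y * kappa (x - y) ^+ n).

Lemma kconv_trig n (g : R -> R) (M : R) : measurable_fun [set: R] g ->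
  (forall x, `|g x| <= M) -> exists s, forall x, (kconv n g x)%:C = trig s x.
Proof.
move=> mg gM; have [s hs] := kappa_trig n.
pose s' := [seq (p.1 * cintegral I (fun y => (g y)%:C * ek (- p.2) y), p.2) | p <- s].
exists [seq (((kmass n 0)^-1)%:C * p.1, p.2) | p <- s'] => x.
rewrite trigZ /s' -(@cintegral_trig _ M).
- rewrite (_ : (fun y => _) = (fun y => (g y * kappa (x - y) ^+ n)%:C)); last first.
    by apply/funext => y; rewrite -hs; apply: eq_ReIm; rewrite !cE; ring.
  rewrite cintegralR /kconv (kmass_cst n x 0); apply: eq_ReIm; rewrite !cE; ring.
- exact: cmeasR.
- by move=> y; rewrite cmodC.
Qed.

Lemma c_gt0 : 0 < c.
Proof. by rewrite -(pmulr_lgt0 _ T0) cT mulr_gt0// pi_gt0. Qed.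

(** At x = a, only the part of the integral over [a, a + e[ is kept. For e < d this lower bound
    decays more slowly than [kappa d ^+ n], the size of the kernel at distance d. *)
Lemma kmass_ge n (e : R) : 0 < e -> e <= T / 2 ->
  kappa e ^+ n * e <= kmass n a.
Proof.
move=> e0 eT; have half : c * (T / 2) = pi by rewrite mulrA cT mulrAC divff ?mul1r.
have mI : measurable (`[a, a + e[%classic : set R) by exact: measurable_itv.
have sub : `[a, a + e[%classic `<=` I.
  move=> y; rewrite /I /= !in_itv /= => /andP[-> h] /=.
  by rewrite (lt_le_trans h)// lerD2l; lra.
have ik : mu.-integrable I (EFin \o (fun y => kappa (a - y) ^+ n)).
  apply: (@integrable_period_bnd 1); first exact: measurable_kappaX.
  by move=> y; exact: norm_kappaX.
have -> : kappa e ^+ n * e = \int[mu]_(y in `[a, a + e[) (kappa e ^+ n).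
  rewrite Rintegral_cst//; congr (_ * _).
  transitivity (fine (mu `[a, a + e[%classic)) => //.
  by rewrite lebesgue_measure_itv /= lte_fin ltrDl e0 /= addrAC subrr add0r.
apply: (@le_trans _ _ (\int[mu]_(y in `[a, a + e[) (kappa (a - y) ^+ n))).
  apply: le_Rintegral => //.
  - apply: (@integrableS _ _ _ mu I) => //; apply: (@integrable_period_bnd 1) => //.
    by move=> y; exact: norm_kappaX.
  - exact: (@integrableS _ _ _ mu I).
  - move=> y /=; rewrite in_itv /= => /andP[ay ye].
    rewrite lerXn2r ?nnegrE ?kappa_ge0//.
    rewrite -(kappaN (a - y)) opprB.
    have [->//|yN] := eqVneq (y - a) e.
    apply/ltW/kappa_lt; [exact: c_gt0|lra| |].
      by rewrite ltrBlDl.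
    by rewrite -half ler_pM2l// c_gt0.
rewrite /kmass /Rintegral fine_le//.
- by apply: integrable_fin_num => //; exact: (@integrableS _ _ _ mu I).
- exact: integrable_fin_num.
- apply: ge0_subset_integral => //; first by case/integrableP : ik.
  by move=> y _; rewrite lee_fin exprn_ge0// kappa_ge0.
Qed.

Lemma kappa_gt0 (e : R) : 0 < e -> e < T / 2 -> 0 < kappa e.
Proof.
move=> e0 eT; apply: (le_lt_trans (kappa_ge0 (T / 2))).
apply: kappa_lt => //; [exact: c_gt0|exact: ltW|].
by rewrite mulrA cT mulrAC divff ?mul1r.
Qed.

Lemma kmass_gt0 n x : 0 < kmass n x.
Proof.
rewrite (kmass_cst n x a); have T4 : 0 < T / 4 by rewrite divr_gt0.
apply: (lt_le_trans _ (@kmass_ge n (T / 4) T4 _)); last by lra.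
by rewrite mulr_gt0// exprn_gt0// kappa_gt0//; lra.
Qed.

Lemma integrable_kern (M : R) n (g : R -> R) x : measurable_fun [set: R] g ->
  (forall y, `|g y| <= M) ->
  mu.-integrable I (EFin \o (fun y => g y * kappa (x - y) ^+ n)).
Proof.
move=> mg gM; apply: (@integrable_period_bnd M).
  by apply: measurable_funM => //; exact: measurable_kappaX.
by move=> y; rewrite normrM -[leRHS]mulr1 ler_pM// norm_kappaX.
Qed.

Lemma kconv_bnd n (g : R -> R) (M : R) x : measurable_fun [set: R] g ->
  (forall y, `|g y| <= M) -> `|kconv n g x| <= M.
Proof.
move=> mg gM; rewrite /kconv normrM gtr0_norm ?invr_gt0 ?kmass_gt0//.
rewrite ler_pdivrMl ?kmass_gt0//.
apply: (le_trans (le_normr_Rintegral _ (integrable_kern n x mg gM))) => //.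
have h1 y : `|1 : R| <= 1 by rewrite normr1.
rewrite mulrC /kmass -RintegralZl//; last first.
  apply: (@integrable_period_bnd 1); first exact: measurable_kappaX.
  by move=> y; exact: norm_kappaX.
apply: le_Rintegral => //.
- apply: (@integrable_period_bnd M).
    apply: measurableT_comp => //; apply: measurable_funM => //; exact: measurable_kappaX.
  by move=> y; rewrite normr_id normrM -[leRHS]mulr1 ler_pM// norm_kappaX.
- by apply: (@integrable_kern `|M| n (fun=> M)) => // y.
- move=> y _; rewrite normrM (ger0_norm (exprn_ge0 _ (kappa_ge0 _))).
  by rewrite ler_wpM2r// exprn_ge0// kappa_ge0.
Qed.

(** The integral of (g y - g x) against the kernel splits at |x - y| = d: continuity bounds the near
    part by e times the mass, and the far part has |g y - g x| <= 2M and a kernel at most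
    [kappa d ^+ n]. Keeping x at distance d from both ends gives |x - y| <= T - d. *)
Lemma kconv_err n (g : R -> R) (M d e x : R) : measurable_fun [set: R] g ->
  (forall y, `|g y| <= M) -> 0 <= e -> 0 < d -> a + d <= x -> x <= a + T - d ->
  (forall y, `|x - y| < d -> `|g y - g x| <= e) ->
  `|kconv n g x - g x| <= e + (2 * M * kappa d ^+ n * T) / kmass n x.
Proof.
move=> mg gM e0 d0 adx xTd gd.
have M0 : 0 <= M := le_trans (normr_ge0 _) (gM 0).
have k0 := kmass_gt0 n x.
have dT : d <= T / 2 by lra.
have ik : mu.-integrable I (EFin \o (fun y => kappa (x - y) ^+ n)).
  apply: (@integrable_period_bnd 1); first exact: measurable_kappaX.
  by move=> y; exact: norm_kappaX.
have mgx : measurable_fun [set: R] (fun y => g y - g x) by exact: measurable_funB.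
have gxM y : `|g y - g x| <= 2 * M.
  by rewrite (le_trans (ler_normB _ _))// mulr_natl mulr2n lerD.
have -> : kconv n g x - g x
    = (kmass n x)^-1 * \int[mu]_(y in I) ((g y - g x) * kappa (x - y) ^+ n).
  rewrite /kconv -[X in _ - X](mulKf (lt0r_neq0 k0)) -mulrBr; congr (_ * _).
  rewrite mulrC -[X in _ - _ * X]/(kmass n x) /kmass -RintegralZl// -RintegralB//.
  - by apply: eq_Rintegral => y _; rewrite mulrBl.
  - exact: (integrable_kern n x mg gM).
  - by apply: (@integrable_kern `|g x| n (fun=> g x)).
rewrite normrM gtr0_norm ?invr_gt0// ler_pdivrMl// mulrDr mulrCA divff ?gt_eqF// mulr1.
apply: (le_trans (le_normr_Rintegral _ (integrable_kern n x mgx gxM))) => //.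
have ic : mu.-integrable I (EFin \o cst (2 * M * kappa d ^+ n)).
  by apply: (@integrable_period_bnd `|2 * M * kappa d ^+ n|) => //; exact: measurable_cst.
have -> : 2 * M * kappa d ^+ n * T = \int[mu]_(y in I) (2 * M * kappa d ^+ n).
  rewrite Rintegral_cst//; congr (_ * _).
  by transitivity (fine (mu I)) => //; rewrite mu_period.
have ie : mu.-integrable I (EFin \o (fun y => e * kappa (x - y) ^+ n)).
  by apply: (@integrable_kern `|e| n (fun=> e)).
rewrite mulrC /kmass -RintegralZl// -RintegralD//.
apply: le_Rintegral => //.
- apply: (@integrable_period_bnd (2 * M)).
    apply: measurableT_comp => //; apply: measurable_funM => //; exact: measurable_kappaX.
  by move=> y; rewrite normr_id normrM -[leRHS]mulr1 ler_pM// norm_kappaX.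
- by apply: (integrableD _ ie ic).
move=> y; rewrite /I /= in_itv /= => /andP[ay yT].
rewrite normrM (ger0_norm (exprn_ge0 _ (kappa_ge0 _))).
have [xyd|dxy] := ltP `|x - y| d.
  rewrite -[leLHS]addr0 lerD//.
    by rewrite ler_wpM2r ?gd// exprn_ge0// kappa_ge0.
  by rewrite !mulr_ge0// exprn_ge0// kappa_ge0.
rewrite -[leLHS]add0r lerD//.
  by rewrite mulr_ge0// exprn_ge0// kappa_ge0.
rewrite ler_pM ?exprn_ge0 ?kappa_ge0//.
rewrite lerXn2r ?nnegrE ?kappa_ge0// kappa_le//; [exact: c_gt0|exact: ltW|].
by rewrite ler_norml; apply/andP; split; lra.
Qed.

Lemma kconv_cvg (g : R -> R) (M x : R) : measurable_fun [set: R] g ->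
  (forall y, `|g y| <= M) -> {for x, continuous g} -> a < x -> x < a + T ->
  (fun n => kconv n g x) @ \oo --> g x.
Proof.
move=> mg gM gx ax xT.
have M0 : 0 <= M := le_trans (normr_ge0 _) (gM 0).
apply/cvgrPdist_le => e e0; have e2 : 0 < e / 2 by rewrite divr_gt0.
have /cvgrPdist_le /(_ _ e2) := gx.
rewrite near_nbhs => /nbhs_ballP [d1 /= d10 hd1].
pose d := Num.min d1 (Num.min (x - a) (a + T - x)).
have d0 : 0 < d by rewrite /d !lt_min d10 !subr_gt0 ax xT.
have dd1 : d <= d1 by rewrite /d ge_min lexx.
have dxa : d <= x - a by rewrite /d !ge_min lexx orbT.
have dxT : d <= a + T - x by rewrite /d !ge_min lexx !orbT.
have hd y : `|x - y| < d -> `|g y - g x| <= e / 2.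
  by move=> xy; rewrite distrC; apply: hd1 => /=; exact: (lt_le_trans xy).
(* With the mass bounded below through e = d / 2, the far part of the error is at most a constant
   times q^n. *)
pose q := kappa d / kappa (d / 2).
have kd2 : 0 < kappa (d / 2) by rewrite kappa_gt0//; lra.
have q1 : `|q| < 1.
  rewrite ger0_norm ?divr_ge0 ?kappa_ge0// ltr_pdivrMr// mul1r.
  apply: kappa_lt; [exact: c_gt0|lra|lra|].
  rewrite (_ : pi = c * (T / 2)); last by rewrite mulrA cT mulrAC divff ?mul1r.
  by rewrite ler_pM2l ?c_gt0//; lra.
(* The constant in front of q^n, increased by 1 to be positive even when M = 0. *)
have C0 : 0 < 2 * M * T / (d / 2) + 1.
  by rewrite ltr_wpDl// divr_ge0// ?mulr_ge0//; lra.
have /cvgrPdist_le /(_ _ (divr_gt0 e2 C0)) [N _ hN] := cvg_geometric 1 q1.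
exists N => // n Nn; rewrite distrC.
apply: (le_trans (@kconv_err n g M d (e / 2) x mg gM _ d0 _ _ hd)); [lra|lra|lra|].
rewrite [leRHS]splitr lerD2l.
have := hN n Nn; rewrite /geometric /= mul1r sub0r normrN.
rewrite ger0_norm ?exprn_ge0 ?divr_ge0 ?kappa_ge0// ler_pdivlMr// => hq.
apply: (le_trans _ hq).
rewrite (kmass_cst n x a).
have hm := @kmass_ge n (d / 2) ltac:(lra) ltac:(lra).
have p0 : 0 < kappa (d / 2) ^+ n * (d / 2) by rewrite mulr_gt0 ?exprn_gt0//; lra.
apply: (@le_trans _ _ (2 * M * kappa d ^+ n * T / (kappa (d / 2) ^+ n * (d / 2)))).
  rewrite ler_wpM2l ?lef_pV2 ?posrE ?kmass_gt0//.
  by rewrite !mulr_ge0 ?exprn_ge0 ?kappa_ge0// ltW.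
rewrite /q; move: (kappa d) (kappa (d / 2)) (kappa_ge0 d) kd2 => u w u0 w0.
rewrite expr_div_n mulrDr mulr1.
rewrite [leLHS](_ : _ = u ^+ n / w ^+ n * (2 * M * T / (d / 2))).
  by rewrite lerDl divr_ge0// exprn_ge0// ltW.
by field; rewrite !gt_eqF// exprn_gt0.
Qed.

Lemma ae_neq (b : R) : {ae mu, forall x : R, x != b}.
Proof.
exists [set b]; split => //; first exact: lebesgue_measure_set1.
by move=> x /= /negP; rewrite negbK => /eqP.
Qed.

(** * Density of the trigonometric polynomials *)

Definition trig_approx (F : R -> R[i]) := forall e : R, 0 < e ->
  exists s, nrm (fun x => F x - ind I x * trig s x) <= e.

(** The kernel means converge at each interior point of the period, whatever g does at its two ends;
    being bounded by M like g, they converge in L2 by domination. *)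
Lemma trig_approx_cont (g : R -> R) (M : R) : continuous g -> (forall y, `|g y| <= M) ->
  trig_approx (fun x => ind I x * (g x)%:C).
Proof.
move=> cg gM; have mg : measurable_fun [set: R] g by exact: continuous_measurable_fun.
have M0 : 0 <= M := le_trans (normr_ge0 _) (gM 0).
have /choice[sn hsn] n := kconv_trig n mg gM.
suff h : L2cvg (fun n x => ind I x * (kconv n g x)%:C) (fun x => ind I x * (g x)%:C).
  move=> e e0; have [N hN] := h e e0; exists (sn N).
  apply: le_trans (hN N (leqnn N)); rewrite le_eqVlt; apply/orP; left; apply/eqP.
  by congr nrm; apply/funext => x; rewrite -hsn.
apply: (@L2cvg_dominated _ _ _ (fun x => (2 * M) ^+ 2 * \1_I x)).
- move=> n; apply: cmeasM; first exact: cmeas_ind.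
  rewrite (_ : (fun x => _) = trig (sn n)); first exact: cmeas_trig.
  by apply/funext => x; rewrite hsn.
- by apply: cmeasM; [exact: cmeas_ind|exact: cmeasR].
- exact: integrable_cst_ind.
- move=> n x; rewrite indE indicE; case: ifP => _.
    rewrite !mul1r mulr1; apply: ler_cmod_sqrB; first by rewrite cmodC.
    by rewrite cmodC kconv_bnd.
  by rewrite !mul0r mulr0 subrr cmod0 expr0n.
apply: ae_imply (ae_neq a) => x xa; rewrite indE; case: ifPn => [|_]; last first.
  under eq_fun do rewrite !mul0r subrr cmod0 expr0n /=; exact: cvg_cst.
move=> xI; have /andP[ax xT] : a <= x < a + T.
  by move: xI; rewrite inE /I /= in_itv.
have {}ax : a < x by rewrite lt_neqAle eq_sym xa.
have h := kconv_cvg mg gM (cg x) ax xT.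
rewrite (_ : (fun n => _) = (fun n => (g x - kconv n g x) * (g x - kconv n g x))).
  have h2 : (fun n => g x - kconv n g x) @ \oo --> 0.
    by rewrite -(subrr (g x)); apply: cvgB => //; exact: cvg_cst.
  by rewrite -[X in _ --> X](mulr0 (0 : R)); apply: cvgM.
apply/funext => n; rewrite !mul1r cmod_sqr !cE subrr expr0n addr0; exact: expr2.
Qed.

Lemma trig_approx_limit (F : R -> R[i]) : L2 F ->
  (forall e : R, 0 < e -> exists G, [/\ L2 G, trig_approx G & nrm (fun x => F x - G x) <= e]) ->
  trig_approx F.
Proof.
move=> FL FG e e0; have e2 : 0 < e / 2 by rewrite divr_gt0.
have [G [GL /(_ _ e2)[s hs] h]] := FG _ e2; exists s.
apply: (le_trans (nrm_triangle FL GL (L2_trig s))).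
by rewrite [leRHS]splitr lerD.
Qed.

Lemma apprD (F G : R -> R[i]) : L2 F -> L2 G -> trig_approx F -> trig_approx G ->
  trig_approx (fun x => F x + G x).
Proof.
move=> FL GL aF aG e e0; have e2 : 0 < e / 2 by rewrite divr_gt0.
have [s hs] := aF _ e2; have [s' hs'] := aG _ e2; exists (s ++ s').
rewrite (_ : (fun x => _) = (fun x => (F x - ind I x * trig s x) +
   (G x - ind I x * trig s' x))); last by apply/funext => x; rewrite trig_cat; ring.
apply: (le_trans (nrmD (L2B FL (L2_trig s)) (L2B GL (L2_trig s')))).
by rewrite [leRHS]splitr lerD.
Qed.

Lemma nrmZ (w : R[i]) (F : R -> R[i]) : L2 F -> nrm (fun x => w * F x) = cmod w * nrm F.
Proof. by move=> FL; rewrite /nrm N2Z// sqrtrM ?sqr_ge0// sqrtr_sqr ger0_norm ?cmod_ge0. Qed.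

Lemma apprZ (w : R[i]) (F : R -> R[i]) : L2 F -> trig_approx F -> trig_approx (fun x => w * F x).
Proof.
move=> FL aF e e0; have c0 : 0 < cmod w + 1 by rewrite ltr_wpDl// cmod_ge0.
have [s hs] := aF _ (divr_gt0 e0 c0); exists [seq (w * p.1, p.2) | p <- s].
rewrite (_ : (fun x => _) = (fun x => w * (F x - ind I x * trig s x))); last first.
  by apply/funext => x; rewrite trigZ; ring.
rewrite nrmZ; last exact: (L2B FL (L2_trig s)).
apply: (@le_trans _ _ ((cmod w + 1) * (e / (cmod w + 1)))).
  by rewrite ler_pM ?cmod_ge0 ?nrm_ge0// lerDl.
by rewrite mulrCA divff ?mulr1// gt_eqF.
Qed.

Lemma nrm_ind (A : set R) (F : R -> R[i]) : measurable A -> L2 F ->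
  nrm (fun x => ind A x * F x) <= nrm F.
Proof.
move=> mA FL; rewrite nrm_le ?nrm_ge0// nrm_sqr -[leRHS]mul1r.
apply: N2_leM => //; first exact: L2_ind.
by move=> x; rewrite cmodM exprMn ler_wpM2r ?sqr_ge0// expr_le1// ?cmod_ge0 ?cmod_ind_le1.
Qed.

Definition clip (M y : R) : R := Num.max (- M) (Num.min y M).

Lemma clip_le (M y : R) : 0 <= M -> `|clip M y| <= M.
Proof.
by move=> M0; rewrite /clip ler_norml le_max lexx /= ge_max ge_min lexx orbT andbT; lra.
Qed.

Lemma clip_dist (M y z : R) : `|z| <= M -> `|z - clip M y| <= `|z - y|.
Proof.
rewrite ler_norml => /andP[h1 h2]; rewrite /clip.
have [yM|My] := leP y M.
  have [My|yM'] := leP (- M) y; first by [].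
  by rewrite !ger0_norm; lra.
have [_|h] := leP (- M) M; last by lra.
by rewrite !ler0_norm; lra.
Qed.

Lemma clip_continuous (M : R) : continuous (clip M).
Proof.
have -> : clip M = (fun=> - M) \max (id \min (fun=> M)) by [].
move=> x; apply: continuous_max; first exact: cvg_cst.
by apply: continuous_min; [exact: cvg_id|exact: cvg_cst].
Qed.

(** Continuous functions approximate f in L1. Clipping them to [-M, M] brings them no further from
    f, and then |f - clip g|^2 <= 2M |f - g| turns L1 closeness into L2 closeness. *)
Lemma trig_approx_bnd (f : R -> R) (M : R) : measurable_fun [set: R] f ->
  (forall y, `|f y| <= M) -> trig_approx (fun x => ind I x * (f x)%:C).
Proof.
move=> mf fM; have M0 : 0 <= M := le_trans (normr_ge0 _) (fM 0).
have fL : L2 (fun x => ind I x * (f x)%:C).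
  by apply: (@L2_bnd M) => [|x]; [exact: cmeasR|rewrite cmodC].
apply: trig_approx_limit => // e e0.
have muI : (mu I < +oo)%E by rewrite mu_period ltry.
have [g [cg ig hg]] := approximation_continuous_integrable measurable_period muI
  (integrable_period_bnd mf fM).
have C0 : 0 < 2 * M + 1 by lra.
have /fine_cvg := hg => /cvgrPdist_le /(_ _ (divr_gt0 (exprn_gt0 2 e0) C0)) [N _ /(_ N (leqnn N))].
rewrite /= sub0r normrN => hN.
have cc : continuous (fun x => clip M (g N x)).
  move=> x; apply: (@continuous_comp _ _ _ (g N) (clip M)); first exact: cg.
  exact: clip_continuous.
have mc : measurable_fun [set: R] (fun x => clip M (g N x)).
  exact: continuous_measurable_fun.
have cL : L2 (fun x => ind I x * (clip M (g N x))%:C).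
  by apply: (@L2_bnd M) => [|x]; [exact: cmeasR|rewrite cmodC clip_le].
exists (fun x => ind I x * (clip M (g N x))%:C); split => //.
  by apply: (@trig_approx_cont _ M) => // y; exact: clip_le.
rewrite nrm_le ?(ltW e0)// -lee_fin -sqnormE; last exact: L2B.
have ifg : mu.-integrable I (EFin \o (fun x => `|f x - g N x|)).
  rewrite (_ : _ \o _ = abse \o (EFin \o (fun x => f x - g N x))); last by [].
  apply: integrable_abse.
  rewrite (_ : _ \o _ = (fun x => (EFin \o f) x - (EFin \o (g N)) x)%E); last by [].
  by apply: integrableB => //; exact: (integrable_period_bnd mf fM).
apply: (@le_trans _ _ ((2 * M)%:E * \int[mu]_(x in I) (`|f x - g N x|)%:E)%E).
  rewrite -ge0_integralZl//; last 2 first.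
  - by case/integrableP : ifg.
  - by rewrite lee_fin mulr_ge0.
  rewrite [leRHS]integral_mkcond; apply: ge0_le_integral => //.
  - by move=> x _; rewrite lee_fin sqr_ge0.
  - by apply: measurable_cmod2E; apply: cmeasB; exact: L2_meas.
  - apply/(measurable_restrictT _ _).1 => //.
    by apply: measurable_funeM; case/integrableP : ifg.
  - move=> x _; rewrite patchE indE; case: ifPn => _; last first.
      by rewrite !mul0r subrr cmod0 expr0n.
    rewrite !mul1r -EFinM lee_fin cmod_sqr !cE subrr expr0n addr0.
    rewrite -real_normK ?num_real// expr2 ler_pM//; last exact: clip_dist.
    rewrite (le_trans (ler_normB _ _))// mulr_natl mulr2n lerD//; exact: clip_le.
have fin : (\int[mu]_(x in I) (`|f x - g N x|)%:E)%E \is a fin_num.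
  exact: integrable_fin_num ifg.
rewrite -(fineK fin) -EFinM lee_fin.
have h0 : 0 <= fine (\int[mu]_(x in I) (`|f x - g N x|)%:E)%E.
  by apply: fine_ge0; apply: integral_ge0 => x _; rewrite lee_fin.
move: hN; rewrite ger0_norm// ler_pdivlMr// => hN.
by apply: (le_trans _ hN); rewrite mulrC ler_wpM2l//; lra.
Qed.

Lemma trig_approx_real (f : R -> R) : L2 (fun x => (f x)%:C) ->
  trig_approx (fun x => ind I x * (f x)%:C).
Proof.
move=> fL; have mf : measurable_fun [set: R] f by case: (L2_meas fL).
apply: trig_approx_limit; first exact: L2_ind.
pose A n := [set x | `|f x| <= n%:R].
have mA n : measurable (A n).
  rewrite /A -[X in measurable X]setTI; apply: measurable_fun_le => //.
  exact: measurableT_comp.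
have h : L2cvg (fun n x => ind (A n) x * (f x)%:C) (fun x => (f x)%:C).
  apply: L2cvg_trunc => // x; exists (Num.truncn `|f x|).+1 => n hn; rewrite /A /=.
  apply: (@le_trans _ _ ((Num.truncn `|f x|).+1%:R)); last by rewrite ler_nat.
  exact/ltW/Num.Theory.truncnS_gt.
move=> e e0; have [N hN] := h e e0.
have AL n : L2 (fun x => ind (A n) x * (f x)%:C) by exact: L2_ind.
exists (fun x => ind I x * (ind (A N) x * (f x)%:C)); split.
- exact: L2_ind.
- rewrite (_ : (fun x => _) = (fun x => ind I x * (\1_(A N) x * f x)%:C)); last first.
    by apply/funext => x; congr (_ * _); apply: eq_ReIm; rewrite !cE /=; ring.
  apply: (@trig_approx_bnd _ N%:R).
    by apply: measurable_funM => //; exact: measurable_indic.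
  move=> y; rewrite indicE; case: (boolP (y \in A N)) => [|_].
    by rewrite inE mul1r.
  by rewrite mul0r normr0.
- rewrite (_ : (fun x => _) = (fun x => ind I x * ((f x)%:C - ind (A N) x * (f x)%:C))).
    by apply: (le_trans (nrm_ind _ (L2B fL (AL N)))) => //; exact: hN.
  by apply/funext => x; ring.
Qed.

Lemma L2_Re f : L2 f -> L2 (fun x => (complex.Re (f x))%:C).
Proof.
move=> fL; apply: (@L2_le _ 1 _ f) => //; first by apply: cmeasR; case: (L2_meas fL).
by move=> x; rewrite mul1r !cmod_sqr !cE expr0n addr0 lerDl sqr_ge0.
Qed.

Lemma L2_Im f : L2 f -> L2 (fun x => (complex.Im (f x))%:C).
Proof.
move=> fL; apply: (@L2_le _ 1 _ f) => //; first by apply: cmeasR; case: (L2_meas fL).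
by move=> x; rewrite mul1r !cmod_sqr !cE expr0n addr0 lerDr sqr_ge0.
Qed.

Lemma trig_approx_L2 f : L2 f -> trig_approx (fun x => ind I x * f x).
Proof.
move=> fL; have rL := L2_Re fL; have iL := L2_Im fL.
rewrite (_ : (fun x => _) = (fun x => ind I x * (complex.Re (f x))%:C
   + 'i%C * (ind I x * (complex.Im (f x))%:C))); last first.
  by apply/funext => x; rewrite [in LHS](complexE (f x)); ring.
apply: apprD; [exact: L2_ind|exact/L2Z/L2_ind|exact: trig_approx_real|].
by apply: apprZ; [exact: L2_ind|exact: trig_approx_real].
Qed.

(** * Bessel's inequality and Parseval's identity *)

Definition coef (F : R -> R[i]) (k : int) : R[i] := ip F (Ek k).

Definition tsum (A : seq int) (d : int -> R[i]) (x : R) : R[i] :=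
  \sum_(k <- A) d k * Ek k x.

Lemma L2_tsum A d : L2 (tsum A d).
Proof. by apply: L2_sum => k; apply: L2Z; exact: L2_Ek. Qed.

Lemma ip_tsumr F A d : L2 F ->
  ip F (tsum A d) = \sum_(k <- A) (d k)^* * coef F k.
Proof.
move=> FL; rewrite ip_sumr//; last by move=> k; apply: L2Z; exact: L2_Ek.
by apply: eq_bigr => k _; rewrite ipZr//; exact: L2_Ek.
Qed.

Lemma coef_tsum A d k : uniq A -> coef (tsum A d) k = if k \in A then d k * T%:C else 0.
Proof.
move=> uA; rewrite /coef ip_suml; [|by move=> j; apply: L2Z; exact: L2_Ek|exact: L2_Ek].
rewrite (eq_bigr (fun j => if j == k then d k * T%:C else 0)); last first.
  move=> j _; rewrite ipZl; [|exact: L2_Ek|exact: L2_Ek].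
  by rewrite ip_Ek; case: eqP => [->//|_]; rewrite mulr0.
rewrite -big_mkcond /=; case: ifPn => kA; first by rewrite -big_filter filter_pred1_uniq// big_seq1.
by rewrite big_seq_cond big1// => j /andP[jA /eqP jk]; rewrite -jk jA in kA.
Qed.

Lemma N2_tsum A d : uniq A -> N2 (tsum A d) = \sum_(k <- A) T * cmod (d k) ^+ 2.
Proof.
move=> uA; have := ipff (tsum A d); rewrite ip_tsumr; last exact: L2_tsum.
move=> /(congr1 (@complex.Re R)); rewrite cReC => <-; rewrite cRe_sum.
rewrite big_seq [RHS]big_seq; apply: eq_bigr => k kA.
rewrite coef_tsum// kA mulrA (mulrC _ (d k)) mulcJ_cmod !cE; ring.
Qed.

(** Completing the square in each coefficient. Taking the Fourier coefficients for d gives Bessel's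
    identity, and the positive squares give the best approximation property. *)
Lemma N2_sub_tsum F A d : L2 F -> uniq A ->
  N2 (fun x => F x - tsum A d x) = N2 F
    + \sum_(k <- A) (T * cmod (d k - T^-1%:C * coef F k) ^+ 2 - T^-1 * cmod (coef F k) ^+ 2).
Proof.
move=> FL uA; rewrite N2B//; last exact: L2_tsum.
rewrite N2_tsum// ip_tsumr// -addrA; congr (_ + _).
rewrite cRe_sum mulr_sumr -sumrB; apply: eq_bigr => k _.
rewrite !cmod_sqr !cE; field; exact: lt0r_neq0.
Qed.

Definition psum F (A : seq int) := tsum A (fun k => T^-1%:C * coef F k).

Lemma N2_psum F A : L2 F -> uniq A ->
  N2 (fun x => F x - psum F A x) = N2 F - \sum_(k <- A) T^-1 * cmod (coef F k) ^+ 2.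
Proof.
move=> FL uA; rewrite N2_sub_tsum// -sumrN; congr (_ + _); apply: eq_bigr => k _.
by rewrite subrr cmod0 expr0n mulr0 sub0r.
Qed.

Lemma psum_best F A d : L2 F -> uniq A ->
  N2 (fun x => F x - psum F A x) <= N2 (fun x => F x - tsum A d x).
Proof.
move=> FL uA; rewrite N2_psum// N2_sub_tsum// -sumrN lerD2l.
by apply: ler_sum => k _; rewrite lerDr mulr_ge0 ?sqr_ge0// ltW.
Qed.

Lemma trig_tsum s (A : seq int) : uniq A -> {subset [seq p.2 | p <- s] <= A} ->
  forall x, ind I x * trig s x = tsum A (fun k => \sum_(p <- s | p.2 == k) p.1) x.
Proof.
move=> uA sA x; rewrite /trig /tsum mulr_sumr.
under [RHS]eq_bigr do rewrite mulr_suml big_mkcond /=.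
rewrite exchange_big /=; apply: eq_big_seq => p ps.
rewrite -big_mkcond /= (eq_bigl (pred1 p.2)); last by move=> k; rewrite /= eq_sym.
have pA : p.2 \in A by apply: sA; exact: map_f.
by rewrite -big_filter filter_pred1_uniq// big_seq1 /Ek; ring.
Qed.

(** By best approximation, any finite set of frequencies that contains those of one good
    trigonometric polynomial does at least as well. Convergence is thus along finite sets, as
    [sum_inL2] asks. *)
Lemma psum_cvg f : L2 f -> let F := fun x => ind I x * f x in
  forall e : R, 0 < e -> exists A0 : {fset int}, forall A : {fset int},
    (A0 `<=` A)%fset -> N2 (fun x => F x - psum F A x) <= e.
Proof.
move=> fL F e e0; have FL : L2 F by exact: L2_ind.
have [s hs] := trig_approx_L2 fL (etrans (sqrtr_gt0 e) e0).
exists [fset k | k in [seq p.2 | p <- s]]%fset => A /fsubsetP sA.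
have sub : {subset [seq p.2 | p <- s] <= A} by move=> k ks; apply: sA; rewrite inE.
apply: (le_trans (psum_best (fun k => \sum_(p <- s | p.2 == k) p.1) FL (fset_uniq A))).
rewrite -[e]sqr_sqrtr ?(ltW e0)// -nrm_le ?sqrtr_ge0//.
apply: le_trans hs; rewrite le_eqVlt; apply/orP; left; apply/eqP; congr nrm.
by apply/funext => x; rewrite -(trig_tsum (fset_uniq A) sub).
Qed.

(** The sum over the integers is a supremum of finite sums: Bessel bounds them above, and [psum_cvg]
    shows that they come within e of the bound. *)
Lemma parseval f : L2 f -> let F := fun x => ind I x * f x in
  (\esum_(k in [set: int]) (cmod (coef F k) ^+ 2)%:E = (T * N2 F)%:E)%E.
Proof.
move=> fL F; have FL : L2 F by exact: L2_ind.
have fsE (X : set int) : finite_set X ->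
    (\sum_(k \in X) (cmod (coef F k) ^+ 2)%:E)%E =
    (\sum_(k <- fset_set X) cmod (coef F k) ^+ 2)%:E.
  by move=> fX; rewrite fsbig_finite// sumEFin.
have sumE (A : {fset int}) : \sum_(k <- A) cmod (coef F k) ^+ 2 =
    T * (N2 F - N2 (fun x => F x - psum F A x)).
  rewrite N2_psum ?fset_uniq// opprB addrCA subrr addr0 mulr_sumr.
  by apply: eq_bigr => k _; rewrite mulrA divff ?mul1r// gt_eqF.
apply/eqP; rewrite eq_le; apply/andP; split.
  apply: ge_ereal_sup => _ [X [fX _] <-]; rewrite fsE// lee_fin sumE.
  by rewrite ler_pM2l// gerDl oppr_le0 N2_ge0.
apply/lee_addgt0Pr => e e0.
have [A0 /(_ A0 (fsubset_refl A0)) h] := psum_cvg fL (divr_gt0 e0 T0).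
apply: (@le_trans _ _ ((\sum_(k <- A0) cmod (coef F k) ^+ 2)%:E + e%:E)%E).
  rewrite -EFinD lee_fin sumE mulrBr -subr_le0 opprD.
  have : T * N2 (fun x => F x - psum F A0 x) <= e by rewrite mulrC -ler_pdivlMr.
  by lra.
rewrite leeD2r//; apply: esum_ge; exists [set` A0].
  by split => //; exact: finite_fset.
by rewrite fsE ?set_fsetK//; exact: finite_fset.
Qed.

End TrigSystem.

(** * The Fourier-Plancherel transform *)

Section Fubini.
Context {R : realType}.
Notation mu := (@lebesgue_measure R).

Lemma Rintegral_fubini (k : R -> R -> R) (u v : R -> R) :
  measurable_fun [set: R * R] (fun p => k p.1 p.2) ->
  mu.-integrable [set: R] (EFin \o u) -> mu.-integrable [set: R] (EFin \o v) ->
  (forall x y, `|k x y| <= u x * v y) -> (forall x, 0 <= u x) -> (forall x, 0 <= v x) ->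
  \int[mu]_x \int[mu]_y k x y = \int[mu]_y \int[mu]_x k x y.
Proof.
move=> mk iu iv kuv u0 v0.
have mkx x : measurable_fun [set: R] (k x).
  exact: (measurableT_comp mk (pair1_measurable x)).
have mky y : measurable_fun [set: R] (k^~ y).
  exact: (measurableT_comp mk (pair2_measurable y)).
have ix x : mu.-integrable [set: R] (EFin \o k x).
  have m1 : measurable_fun [set: R] (EFin \o k x) by exact/measurable_EFinP.
  apply: le_integrable (integrable_Zl (u x) iv) => // y _ /=.
  by rewrite lee_fin (le_trans (kuv x y))// ler_norm.
have iy y : mu.-integrable [set: R] (EFin \o (k^~ y)).
  have m1 : measurable_fun [set: R] (EFin \o (k^~ y)) by exact/measurable_EFinP.
  apply: le_integrable (integrable_Zl (v y) iu) => // x _ /=.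
  by rewrite lee_fin (le_trans (kuv x y))// mulrC ler_norm.
have mK : measurable_fun [set: measurableTypeR R * measurableTypeR R]
  (fun p => (k p.1 p.2)%:E) by exact/measurable_EFinP.
have iK : (mu \x mu)%E.-integrable setT (fun p => (k p.1 p.2)%:E).
  apply/integrable12ltyP => //.
  apply: (@le_lt_trans _ _ (\int[mu]_x ((u x)%:E * \int[mu]_y (v y)%:E))%E).
    apply: ge0_le_integral => //.
    - by move=> x _; exact: integral_ge0.
    - apply: (measurable_fun_fubini_tonelli_F
        (fun p : measurableTypeR R * measurableTypeR R => `|(k p.1 p.2)%:E|%E)) => //.
      exact: measurableT_comp.
    - rewrite -(fineK (integrable_fin_num measurableT iv)).
      under eq_fun do rewrite -EFinM.
      apply/measurable_EFinP; apply: measurable_funM => //.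
      by case/integrableP : iu => /measurable_EFinP.
    - move=> x _; rewrite -ge0_integralZl//.
      + apply: ge0_le_integral => //.
        * have m1 : measurable_fun [set: R] (EFin \o k x) by exact/measurable_EFinP.
          exact: (measurableT_comp (f := abse) _ m1).
        * by apply: measurable_funeM; case/integrableP : iv.
        * by move=> y _; rewrite -EFinM /= lee_fin kuv.
      + by case/integrableP : iv.
      + by move=> y _; rewrite lee_fin.
      + by rewrite lee_fin.
  rewrite -(fineK (integrable_fin_num measurableT iv)).
  rewrite ge0_integralZr//.
  - by rewrite -(fineK (integrable_fin_num measurableT iu)) -EFinM ltry.
  - by case/integrableP : iu.
  - by move=> x _; rewrite lee_fin.
  - by rewrite lee_fin fine_ge0// integral_ge0// => x _; rewrite lee_fin.
have := Fubini iK => /= h; rewrite /Rintegral.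
transitivity (fine (\int[mu]_x \int[mu]_y (k x y)%:E)%E).
  congr fine; apply: eq_integral => x _; rewrite fineK//.
  exact: (integrable_fin_num measurableT (ix x)).
rewrite h; congr fine; apply: eq_integral => y _; rewrite fineK//.
exact: (integrable_fin_num measurableT (iy y)).
Qed.

Lemma cint_fubini (k : R -> R -> R[i]) (u v : R -> R) :
  measurable_fun [set: R * R] (fun p => complex.Re (k p.1 p.2)) ->
  measurable_fun [set: R * R] (fun p => complex.Im (k p.1 p.2)) ->
  mu.-integrable [set: R] (EFin \o u) -> mu.-integrable [set: R] (EFin \o v) ->
  (forall x y, cmod (k x y) <= u x * v y) -> (forall x, 0 <= u x) -> (forall x, 0 <= v x) ->
  cint (fun x => cint (k x)) = cint (fun y => cint (k^~ y)).
Proof.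
move=> m1 m2 iu iv kuv u0 v0; apply: eq_ReIm => /=.
  apply: (Rintegral_fubini m1 iu iv) => // x y.
  by rewrite (le_trans _ (kuv x y))// ler_Re_cmod.
apply: (Rintegral_fubini m2 iu iv) => // x y.
by rewrite (le_trans _ (kuv x y))// ler_Im_cmod.
Qed.

End Fubini.

(** * Folding an integral over the line onto one period *)

Section Tiling.
Context {R : realType}.
Notation mu := (@lebesgue_measure R).

(** An enumeration of the integers, even indices for the nonnegative ones, since countable unions
    and series are indexed by naturals. *)
Definition int_of_nat (n : nat) : int := if odd n then Negz n./2 else Posz n./2.

Lemma int_of_nat_bij : set_bij [set: nat] [set: int] int_of_nat.
Proof.
rewrite setTT_bijective.
exists (fun k : int => match k with Posz m => m.*2 | Negz m => m.*2.+1 end).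
  move=> n; rewrite /int_of_nat; case: ifPn => on /=.
    by rewrite -[RHS]odd_double_half on.
  by rewrite -[RHS]odd_double_half (negbTE on).
by case=> m; rewrite /int_of_nat /= ?odd_double /= ?doubleK// uphalf_double.
Qed.

Lemma integral_tiling (c : R) (G : R -> \bar R) : 0 < c ->
  measurable_fun [set: R] G -> (forall x, (0 <= G x)%E) ->
  (\int[mu]_x G x =
   \int[mu]_(s in `[0%R, c[) \esum_(k in [set: int]) G (s + k%:~R * c)%R)%E.
Proof.
move=> c0 mG G0.
pose F n : set R := `[(int_of_nat n)%:~R * c, (int_of_nat n)%:~R * c + c[%classic.
have mF n : measurable (F n) by exact: measurable_itv.
have UF : \bigcup_n F n = [set: R].
  apply/seteqP; split => // x _.
  have [_ _ surj] := int_of_nat_bij.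
  have [n _ hn] := surj (Num.floor (x / c)) I.
  exists n => //; rewrite /F /= in_itv /= hn -ler_pdivlMr// (Num.Theory.real_floor_le (num_real _)) /=.
  rewrite -[X in _ + X]mul1r -mulrDl -ltr_pdivrMr// -[X in _ + X]/(1%:~R) -intrD.
  exact: (Num.Theory.real_floorD1_gt (num_real _)).
have tF : trivIset [set: nat] F.
  apply/trivIsetP => i j _ _ ij; apply/seteqP; split => // x [].
  rewrite /F /= !in_itv /= => /andP[h1 h2] /andP[h3 h4].
  have [_ inj _] := int_of_nat_bij.
  case/negP: ij; apply/eqP; apply: inj; rewrite ?inE//.
  set a := int_of_nat i in h1 h2 *; set b := int_of_nat j in h3 h4 *.
  have ab : a%:~R * c < b%:~R * c + c by exact: le_lt_trans h1 h4.
  have ba : b%:~R * c < a%:~R * c + c by exact: le_lt_trans h3 h2.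
  move: ab ba; rewrite -[X in _ + X]mul1r -mulrDl ltr_pM2r// -[X in _ + X]/(1%:~R) -intrD ltr_int ltzD1 => ab.
  rewrite -[X in _ + X]mul1r -mulrDl ltr_pM2r// -[X in _ + X]/(1%:~R) -intrD ltr_int ltzD1 => ba.
  by apply/eqP; rewrite eq_le ab ba.
have shiftF n : (\int[mu]_(x in F n) G x =
    \int[mu]_(s in `[0%R, c[) G (s + (int_of_nat n)%:~R * c)%R)%E.
  rewrite integral_mkcond [RHS]integral_mkcond.
  rewrite -(@ge0_integral_shift _ ((int_of_nat n)%:~R * c)).
  - apply: eq_integral => x _; rewrite !patchE; congr (if _ then _ else _).
    by apply/idP/idP; rewrite !inE /F /= !in_itv /=; lra.
  - by apply/(measurable_restrictT _ _).1 => //; exact: measurable_funTS.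
  - by move=> x; rewrite patchE; case: ifP.
transitivity (\int[mu]_(x in \bigcup_n F n) G x)%E; first by rewrite UF.
rewrite ge0_integral_bigcup//; last by rewrite UF.
under eq_eseriesr do rewrite shiftF.
rewrite -integral_nneseries//.
  apply: eq_integral => s _.
  rewrite nneseries_esumT//; exact/esym/reindex_esum/int_of_nat_bij.
move=> n; apply: measurable_funTS.
exact: (measurableT_comp mG (measurable_shift _)).
Qed.

End Tiling.

(** * Transforms of truncated functions *)

Section FourierTrunc.
Context {R : realType}.
Notation mu := (@lebesgue_measure R).
Local Notation ip := innerL2.
Implicit Types f g : R -> R[i].

Definition sym_itv (N : nat) : set R := period (- N%:R) (2 * N%:R).

Definition truncate (N : nat) f (t : R) : R[i] := ind (sym_itv N) t * f t.

Lemma measurable_sym_itv N : measurable (sym_itv N). Proof. exact: measurable_period. Qed.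
Hint Resolve measurable_sym_itv : core.

Lemma in_sym_itv N t : (t \in sym_itv N) = (- N%:R <= t < N%:R).
Proof. by apply/idP/idP; rewrite inE /sym_itv /period /= in_itv /=; lra. Qed.

Lemma L2_truncate N f : L2 f -> L2 (truncate N f). Proof. exact: L2_ind. Qed.

Definition fourier_cst : R := (Num.sqrt (2 * pi))^-1.

Lemma fourier_cst_gt0 : 0 < fourier_cst.
Proof. by rewrite invr_gt0 sqrtr_gt0 mulr_gt0// pi_gt0. Qed.

Lemma fourier_cst_sqr : fourier_cst ^+ 2 = (2 * pi)^-1.
Proof. by rewrite exprVn sqr_sqrtr// mulr_ge0// pi_ge0. Qed.

(** The closed interval in [fourier_trunc] is exchanged for the half-open [sym_itv N], a period in
    the sense of the Fourier series above; they differ by a null set. *)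
Lemma fourier_truncE N f (xi : R) : cmeasurable f ->
  fourier_trunc N f xi = fourier_cst%:C * cint (fun t => truncate N f t * expi (- (t * xi))).
Proof.
move=> mf; rewrite /fourier_trunc; congr (_ * _).
have mF : cmeasurable (fun t => f t * expi (- (t * xi))).
  apply: cmeasM => //; rewrite (_ : (fun t => _) = (fun t => expi (- xi * t))).
    exact: cmeas_expi.
  by apply/funext => t; congr expi; ring.
transitivity (cintegral `[- N%:R, N%:R[ (fun t => f t * expi (- (t * xi)))).
  case: mF => m1 m2; apply: eq_ReIm => /=; rewrite /Rintegral integral_itv_bndo_bndc//.
    by apply/measurable_EFinP; exact: measurable_funTS.
  by apply/measurable_EFinP; exact: measurable_funTS.
rewrite cintegral_ind; apply: eq_cint => t; rewrite mulrA; congr (_ * _ * _).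
rewrite !indE in_sym_itv; congr (if _ then _ else _).
by apply/idP/idP; rewrite inE /= in_itv.
Qed.

Lemma trD N f g : truncate N (fun x => f x + g x) = (fun x => truncate N f x + truncate N g x).
Proof. by apply/funext => x; rewrite /truncate mulrDr. Qed.

Lemma trZ N (w : R[i]) f : truncate N (fun x => w * f x) = (fun x => w * truncate N f x).
Proof. by apply/funext => x; rewrite /truncate mulrCA. Qed.

(** From r <= r^2 + 1 on a bounded interval: a truncated L2 function is integrable, so its transform
    is a genuine integral. *)
Lemma cmod_truncate_le N f t : cmod (truncate N f t) <= cmod (truncate N f t) ^+ 2 + \1_(sym_itv N) t.
Proof.
rewrite /truncate indE indicE; case: ifP => _ /=.
  by rewrite mul1r; have := sqr_ge0 (cmod (f t) - 1); have := sqr_ge0 (cmod (f t)); lra.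
by rewrite mul0r cmod0 expr0n addr0.
Qed.

Lemma integrable_cmod_truncate N f : L2 f ->
  mu.-integrable [set: R] (EFin \o (fun t => cmod (truncate N f t))).
Proof.
move=> fL; have trL := L2_truncate N fL.
have i1 : mu.-integrable [set: R] (EFin \o (fun t => cmod (truncate N f t) ^+ 2 + \1_(sym_itv N) t)).
  rewrite (_ : _ \o _ = (fun t => (EFin \o (fun t => cmod (truncate N f t) ^+ 2)%R) t
    + (EFin \o \1_(sym_itv N)) t)%E); last by apply/funext.
  by apply: integrableD => //; [exact: integrable_cmod2|exact: integrable_indic_itv].
have m1 : measurable_fun [set: R] (EFin \o (fun t => cmod (truncate N f t))).
  by apply/measurable_EFinP; apply: measurable_cmod; exact: L2_meas.
apply: le_integrable i1 => // t _ /=.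
by rewrite lee_fin !ger0_norm ?cmod_ge0 ?addr_ge0 ?sqr_ge0// cmod_truncate_le.
Qed.

Lemma cmeas_expiN (xi : R) : cmeasurable (fun t => expi (- (t * xi))).
Proof.
rewrite (_ : (fun t => _) = (fun t => expi (- xi * t))); first exact: cmeas_expi.
by apply/funext => t; congr expi; ring.
Qed.

Lemma cintegrable_truncate N f (xi : R) : L2 f ->
  cintegrable (fun t => truncate N f t * expi (- (t * xi))).
Proof.
move=> fL; apply: (cintegrable_dom _ (integrable_cmod_truncate N fL)).
  by apply: cmeasM; [exact/L2_meas/L2_truncate|exact: cmeas_expiN].
by move=> t; rewrite cmodM cmod_expi mulr1.
Qed.

Lemma fourier_truncD N f g xi : L2 f -> L2 g ->
  fourier_trunc N (fun x => f x + g x) xi = fourier_trunc N f xi + fourier_trunc N g xi.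
Proof.
move=> fL gL; have mf := L2_meas fL; have mg := L2_meas gL.
have mfg := L2_meas (L2D fL gL); rewrite !fourier_truncE//.
rewrite -mulrDr -cintD; try exact: cintegrable_truncate.
by congr (_ * _); apply: eq_cint => t; rewrite trD mulrDl.
Qed.

Lemma fourier_truncZ N (w : R[i]) f xi : L2 f ->
  fourier_trunc N (fun x => w * f x) xi = w * fourier_trunc N f xi.
Proof.
move=> fL; have mf := L2_meas fL; have mg := L2_meas (L2Z w fL).
rewrite !fourier_truncE// mulrCA; congr (_ * _).
rewrite -cintZ; last exact: cintegrable_truncate.
by apply: eq_cint => t; rewrite trZ mulrA.
Qed.

Lemma fourier_truncB N f g xi : L2 f -> L2 g ->
  fourier_trunc N (fun x => f x - g x) xi = fourier_trunc N f xi - fourier_trunc N g xi.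
Proof.
move=> fL gL.
rewrite (_ : (fun x => f x - g x) = (fun x => f x + (-1) * g x)).
  by rewrite fourier_truncD ?fourier_truncZ ?mulN1r//; exact: L2Z.
by apply/funext => x; rewrite mulN1r.
Qed.

Lemma truncate_truncate M N f : (N <= M)%N -> truncate M (truncate N f) = truncate N f.
Proof.
move=> NM; have NM' : N%:R <= M%:R :> R by rewrite ler_nat.
apply/funext => t; rewrite /truncate !indE !in_sym_itv.
case: ifP => //= h1; rewrite ?mul1r ?mul0r//; case: ifP => h2; rewrite ?mul0r//.
by case/negP: (negbT h1); move: h2; lra.
Qed.

Lemma fourier_trunc_truncate M N f : (N <= M)%N -> L2 f ->
  fourier_trunc M (truncate N f) = fourier_trunc N f.
Proof.
move=> NM fL; have mf := L2_meas fL; have mtf := L2_meas (L2_truncate N fL).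
by apply/funext => xi; rewrite !fourier_truncE// truncate_truncate.
Qed.

Lemma continuous_expi_Re (w : R[i]) (t : R) :
  continuous (fun xi => complex.Re (w * expi (- (t * xi)))).
Proof.
rewrite (_ : (fun xi => _) = (fun xi => complex.Re w * cos (- (t * xi)) - complex.Im w * sin (- (t * xi)))).
  move=> xi; have c1 : {for xi, continuous (fun xi => - (t * xi))}.
    by apply: continuousN; exact: mulrl_continuous.
  apply: cvgB; apply: cvgM; try exact: cvg_cst.
    by apply: (continuous_comp c1); exact: continuous_cos.
  by apply: (continuous_comp c1); exact: continuous_sin.
by apply/funext => xi; rewrite cE.
Qed.

Lemma continuous_expi_Im (w : R[i]) (t : R) :
  continuous (fun xi => complex.Im (w * expi (- (t * xi)))).
Proof.
rewrite (_ : (fun xi => _) = (fun xi => complex.Re w * sin (- (t * xi)) + complex.Im w * cos (- (t * xi)))).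
  move=> xi; have c1 : {for xi, continuous (fun xi => - (t * xi))}.
    by apply: continuousN; exact: mulrl_continuous.
  apply: cvgD; apply: cvgM; try exact: cvg_cst.
    by apply: (continuous_comp c1); exact: continuous_sin.
  by apply: (continuous_comp c1); exact: continuous_cos.
by apply/funext => xi; rewrite cE.
Qed.

(** The integrand is continuous in xi and dominated by an integrable function of t, so the transform
    is continuous, hence measurable. *)
Lemma cmeas_fourier_trunc N f : L2 f -> cmeasurable (fourier_trunc N f).
Proof.
move=> fL; rewrite (_ : fourier_trunc N f = (fun xi => fourier_cst%:C *
    cint (fun t => truncate N f t * expi (- (t * xi))))); last first.
  by apply/funext => xi; rewrite fourier_truncE//; exact: L2_meas.
apply: cmeasM; first exact: cmeas_cst.
have key (p : R -> R -> R) :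
    (forall xi, mu.-integrable [set: R] (EFin \o p xi)) ->
    (forall t, continuous (p^~ t)) ->
    (forall xi t, `|p xi t| <= cmod (truncate N f t)) ->
    measurable_fun [set: R] (fun xi => \int[mu]_t p xi t).
  move=> ip cp bp; apply: continuous_measurable_fun => xi.
  have h1 : {ae mu, forall y, [set: R] y -> {in `]xi - 1, xi + 1[%classic, continuous (p^~ y)}}.
    by apply: aeW => t _ x _; exact: cp.
  have h2 x : `]xi - 1, xi + 1[%classic x ->
      {ae mu, forall y, [set: R] y -> `|p x y| <= cmod (truncate N f y)}.
    by move=> _; apply: aeW => t _; exact: bp.
  have := @continuity_under_integral _ _ _ mu p _ measurableT (xi - 1) (xi + 1)
    (fun x _ => ip x) h1 _ (integrable_cmod_truncate N fL) h2.
  by apply; rewrite inE /= in_itv /=; apply/andP; split; lra.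
split => /=; apply: key => //.
- by move=> xi; case: (cintegrable_truncate N xi fL).
- by move=> t; exact: continuous_expi_Re.
- by move=> xi t; rewrite (le_trans (ler_Re_cmod _))// cmodM cmod_expi mulr1.
- by move=> xi; case: (cintegrable_truncate N xi fL).
- by move=> t; exact: continuous_expi_Im.
- by move=> xi t; rewrite (le_trans (ler_Im_cmod _))// cmodM cmod_expi mulr1.
Qed.

(* Tiling the frequency line by intervals of length c = pi / N, the integral of
   |fourier_trunc N f|^2 is the integral over s in [0, c[ of the sum of the
   squared Fourier coefficients on [-N, N] of t |-> f t * e^(-ist), to which
   Parseval's identity applies. *)
Lemma plancherel_trunc N f : (0 < N)%N -> L2 f ->
  sqnormL2 (fourier_trunc N f) = sqnormL2 (truncate N f).
Proof.
move=> N0 fL; have N0' : 0 < N%:R :> R by rewrite ltr0n.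
pose T : R := 2 * N%:R; pose c : R := pi / N%:R.
have T0 : 0 < T by rewrite mulr_gt0.
have cT : c * T = 2 * pi by rewrite /c /T; field; rewrite gt_eqF.
have c0 : 0 < c by rewrite divr_gt0// pi_gt0.
rewrite /sqnormL2 (integral_tiling c0); last 2 first.
- by apply: measurable_cmod2E; exact: cmeas_fourier_trunc.
- by move=> x; rewrite lee_fin sqr_ge0.
have trL := L2_truncate N fL.
(* For every s the inner sum has the same value: Parseval contributes T, the normalization squared 1
   / (2 pi), and T / (2 pi) = 1 / c. *)
transitivity (\int[mu]_(s in `[0%R, c[) (c^-1 * N2 (truncate N f))%:E)%E; last first.
  rewrite integral_cst//= lebesgue_measure_itv /= lte_fin c0 -EFinB subr0 -EFinM.
  rewrite mulrAC mulVf ?gt_eqF// mul1r.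
  by rewrite -/(sqnormL2 (truncate N f)) sqnormE.
apply: eq_integral => s _.
pose fs t := fourier_cst%:C * (expi (- (t * s)) * f t).
have fsL : L2 fs.
  apply: L2Z; apply: (@L2M_bnd _ 1) => //; first exact: cmeas_expiN.
  by move=> t; rewrite cmod_expi.
have := @parseval R (- N%:R) T c T0 cT fs fsL.
set F := (fun x => _); move=> pars.
have coefE k : fourier_trunc N f (s + k%:~R * c) = coef (- N%:R) T c F k.
  rewrite fourier_truncE; last exact: L2_meas.
  rewrite -cintZ; last exact: cintegrable_truncate.
  rewrite /coef /innerL2 -[RHS]/(cint _); apply: eq_cint => t.
  rewrite /F /fs /Ek rmorphM /= indJ -ekN /truncate -/(sym_itv N).
  have -> : expi (- (t * (s + k%:~R * c))) = expi (- (t * s)) * ek c (- k) t.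
    by rewrite /ek -expiD; congr expi; rewrite mulrNz; ring.
  by rewrite -[in LHS](indM (sym_itv N)); ring.
have NF : N2 F = fourier_cst ^+ 2 * N2 (truncate N f).
  rewrite -[fourier_cst]gtr0_norm ?fourier_cst_gt0// -cmodC -N2Z//.
  rewrite /N2 /sqnormL2; congr fine; apply: eq_integral => t _.
  by rewrite /F /fs /truncate !cmodM cmod_expi mul1r mulrCA.
rewrite -[RHS](_ : (T * N2 F)%:E = _).
  by rewrite -pars; apply: eq_esum => k _; rewrite coefE.
by rewrite NF fourier_cst_sqr -cT; congr (_%:E); field; rewrite !gt_eqF.
Qed.

End FourierTrunc.

(** * Plancherel's theorem, the shift rule and inversion *)

Section Plancherel.
Context {R : realType}.
Notation mu := (@lebesgue_measure R).
Local Notation ip := innerL2.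
Implicit Types f g : R -> R[i].

Lemma eq_N2 f g : (forall x, cmod (f x) = cmod (g x)) -> N2 f = N2 g.
Proof.
by move=> fg; rewrite /N2 /sqnormL2; congr fine; apply: eq_integral => x _; rewrite fg.
Qed.

Lemma eq_nrm f g : (forall x, cmod (f x) = cmod (g x)) -> nrm f = nrm g.
Proof. by move=> /eq_N2 fg; rewrite /nrm fg. Qed.

(** Transforming the truncation at N with the window N + 1 covers N = 0, for which the period is
    empty. *)
Lemma sqnormL2_fourier_trunc N f : L2 f ->
  sqnormL2 (fourier_trunc N f) = sqnormL2 (truncate N f).
Proof.
move=> fL; rewrite -(fourier_trunc_truncate (leqnSn N) fL) plancherel_trunc ?truncate_truncate//.
exact: L2_truncate.
Qed.

Lemma L2_fourier_trunc N f : L2 f -> L2 (fourier_trunc N f).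
Proof.
move=> fL; split; first exact: cmeas_fourier_trunc.
by rewrite sqnormL2_fourier_trunc//; case: (L2_truncate N fL).
Qed.

Lemma nrm_fourier_trunc N f : L2 f -> nrm (fourier_trunc N f) = nrm (truncate N f).
Proof. by move=> fL; rewrite /nrm /N2 sqnormL2_fourier_trunc. Qed.

Lemma L2cvg_truncate f : L2 f -> L2cvg (fun N => truncate N f) f.
Proof.
move=> fL; apply: L2cvg_trunc => // [n|x]; first exact: measurable_period.
exists (Num.truncn `|x|).+1 => n hn.
have h : `|x| < n%:R by rewrite (lt_le_trans (Num.Theory.truncnS_gt _))// ler_nat.
by apply: set_mem; rewrite in_sym_itv; move: h; rewrite ltr_norml; lra.
Qed.

(** The transform as a relation. Any representative g is allowed, so linearity and the shift rule
    can be stated with exact pointwise formulas; [isFT_uniq] returns to [fourier]. *)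
Definition isFT f g := [/\ L2 f, L2 g & L2cvg (fun N => fourier_trunc N f) g].

(** For n >= N the difference of the truncated transforms is the n-th truncated transform of f -
    [truncate N f], with norm at most that of this tail; so the sequence is Cauchy. *)
Lemma isFT_exists f : L2 f -> exists g, isFT f g.
Proof.
move=> fL; have fNL N := L2_fourier_trunc N fL.
have [|g gL cg] := L2_complete fNL; last by exists g.
move=> e e0; have e20 : 0 < e / 2 by rewrite divr_gt0.
have [N hN] := L2cvg_truncate fL e20.
have key n : (N <= n)%N -> nrm (fun x => fourier_trunc n f x - fourier_trunc N f x) <= e / 2.
  move=> Nn; rewrite -(fourier_trunc_truncate Nn fL).
  have trL := L2_truncate N fL.
  rewrite (_ : (fun x => _) = fourier_trunc n (fun x => f x - truncate N f x)).
    rewrite nrm_fourier_trunc; last exact: L2B.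
    apply: le_trans (hN N (leqnn N)); apply: nrm_ind; last exact: L2B.
    exact: measurable_period.
  by apply/funext => x; rewrite fourier_truncB.
exists N => m n hm hn.
apply: le_trans (nrm_triangle (fNL m) (fNL N) (fNL n)) _.
rewrite (nrmBC (fourier_trunc N f)) [e]splitr.
by apply: lerD; exact: key.
Qed.

Lemma isFT_fourier f : L2 f -> isFT f (fourier f).
Proof.
move=> fL; have fNL N := L2_fourier_trunc N fL.
have [g [_ gL cg]] := isFT_exists fL.
suff [h1 h2] : L2 (fourier f) /\ (fun N => sqnormL2 (fun xi =>
    fourier f xi - fourier_trunc N f xi)) @ \oo --> 0%E.
  by split => //; exact: sqnorm_L2cvg.
apply: (@xgetPex _ (fun=> 0) [set g | L2 g /\ (fun N => sqnormL2 (fun xi =>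
    g xi - fourier_trunc N f xi)) @ \oo --> 0%E]).
by exists g; split => //; exact: L2cvg_sqnorm.
Qed.

Lemma isFT_uniq f g g' : isFT f g -> isFT f g' -> {ae mu, forall x, g x = g' x}.
Proof.
move=> [fL gL cg] [_ gL' cg'].
exact: (L2cvg_ae (fun N => L2_fourier_trunc N fL) gL gL' cg cg').
Qed.

Lemma isFT_aer f g g' : isFT f g -> cmeasurable g' ->
  {ae mu, forall x, g x = g' x} -> isFT f g'.
Proof.
move=> [fL gL cg] mg' gg'; split => //; first exact: L2_ae gL mg' gg'.
move=> e /cg[N hN]; exists N => n /hN.
have mt := cmeas_fourier_trunc n fL.
rewrite /nrm /N2 (@ae_sqnormL2 _ _ (fun x => g' x - fourier_trunc n f x))//.
- exact: cmeasB (L2_meas gL) mt.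
- exact: cmeasB.
- by apply: ae_imply gg' => x ->.
Qed.

Lemma isFTD f g f' g' : isFT f g -> isFT f' g' ->
  isFT (fun x => f x + f' x) (fun x => g x + g' x).
Proof.
move=> [fL gL cg] [fL' gL' cg']; split; try exact: L2D.
rewrite (_ : (fun N => _) = (fun N x => fourier_trunc N f x + fourier_trunc N f' x)).
  exact: (@L2cvgD _ (fun N => fourier_trunc N f) (fun N => fourier_trunc N f') _ _
    (fun n => L2_fourier_trunc n fL) (fun n => L2_fourier_trunc n fL')).
by apply/funext => N; apply/funext => x; rewrite fourier_truncD.
Qed.

Lemma isFTZ (w : R[i]) f g : isFT f g ->
  isFT (fun x => w * f x) (fun x => w * g x).
Proof.
move=> [fL gL cg]; split; try exact: L2Z.
rewrite (_ : (fun N => _) = (fun N x => w * fourier_trunc N f x)).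
  exact: (@L2cvgZ _ w (fun N => fourier_trunc N f) _ (fun n => L2_fourier_trunc n fL)).
by apply/funext => N; apply/funext => x; rewrite fourier_truncZ.
Qed.

Lemma isFTB f g f' g' : isFT f g -> isFT f' g' ->
  isFT (fun x => f x - f' x) (fun x => g x - g' x).
Proof.
move=> fg /(isFTZ (-1)) /(isFTD fg).
by congr isFT; apply/funext => x; rewrite mulN1r.
Qed.

Lemma isFT_sum (I : Type) (s : seq I) (F G : I -> R -> R[i]) :
  (forall i, isFT (F i) (G i)) ->
  isFT (fun x => \sum_(i <- s) F i x) (fun x => \sum_(i <- s) G i x).
Proof.
move=> FG; elim: s => [|i s IH].
  rewrite (_ : (fun x => _) = (fun x => 0 * (0 : R[i]))); last first.
    by apply/funext => x; rewrite big_nil mul0r.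
  rewrite [X in isFT _ X](_ : _ = (fun x => 0 * fourier (fun=> 0 : R[i]) x)).
    by apply: isFTZ; apply: isFT_fourier; exact: L20.
  by apply/funext => x; rewrite big_nil mul0r.
have := isFTD (FG i) IH.
by congr isFT; apply/funext => x; rewrite big_cons.
Qed.

Lemma isFT_nrm f g : isFT f g -> nrm f = nrm g.
Proof.
move=> [fL gL cg]; apply: (@L2cvg_nrm _ (fun N => truncate N f) (fun N => fourier_trunc N f)) => //.
- by move=> n; exact: L2_truncate.
- by move=> n; exact: L2_fourier_trunc.
- exact: L2cvg_truncate.
- by move=> n _; rewrite nrm_fourier_trunc.
Qed.

Lemma isFT_N2 f g : isFT f g -> N2 f = N2 g.
Proof. by move=> /isFT_nrm fg; rewrite -!nrm_sqr fg. Qed.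

(** Polarization: the real part comes from the norm of f + f', the imaginary part from the same
    identity with i f in place of f. *)
Lemma isFT_ip f g f' g' : isFT f g -> isFT f' g' -> ip f f' = ip g g'.
Proof.
have reip (u v u' v' : R -> R[i]) : isFT u v -> isFT u' v' ->
    complex.Re (ip u u') = complex.Re (ip v v').
  move=> h h'; have [uL vL _] := h; have [uL' vL' _] := h'.
  have := isFT_N2 (isFTD h h'); rewrite !N2D// (isFT_N2 h) (isFT_N2 h'); lra.
move=> h h'; apply: eq_ReIm; first exact: reip.
have := reip _ _ _ _ (isFTZ 'i h) h'.
have [uL vL _] := h; have [uL' vL' _] := h'.
by rewrite !ipZl// !cE /= !mul0r !mul1r !sub0r => /oppr_inj.
Qed.

Lemma isFT_ael f f' g : isFT f g -> L2 f' -> {ae mu, forall x, f x = f' x} -> isFT f' g.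
Proof.
move=> fg fL' ff'; have [fL gL _] := fg.
have [g' fg'] := isFT_exists fL'; have [_ gL' _] := fg'.
apply: (isFT_aer fg' (L2_meas gL)).
have := isFT_N2 (isFTB fg fg').
rewrite {1}/N2 (@ae_sqnormL2 _ _ (fun=> 0)); last 3 first.
- by apply: cmeasB; exact: L2_meas.
- exact: cmeas_cst.
- by apply: ae_imply ff' => x ->; rewrite subrr.
rewrite -/(N2 _) N20 => /esym/(ae_N2_eq0 (L2B gL gL')).
by apply: ae_imply => x /eqP; rewrite subr_eq0 => /eqP ->.
Qed.

Lemma isFT_inj f f' g : isFT f g -> isFT f' g -> {ae mu, forall x, f x = f' x}.
Proof.
move=> fg fg'; have [fL gL _] := fg; have [fL' _ _] := fg'.
have := isFT_N2 (isFTB fg fg').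
rewrite (_ : (fun x => g x - g x) = (fun=> 0)); last by apply/funext => x; rewrite subrr.
rewrite N20 => /(ae_N2_eq0 (L2B fL fL')).
by apply: ae_imply => x /eqP; rewrite subr_eq0 => /eqP.
Qed.

(** Truncating the translate on [-N, N[ amounts to truncating f on the shifted window [A N]. The
    discrepancy with a symmetric truncation of f is controlled, through Plancherel, by the part of f
    outside [A N]. *)
Lemma isFT_tau (a : R) f g : isFT f g ->
  isFT (tau a f) (fun xi => expi (a * xi) * g xi).
Proof.
move=> [fL gL cg]; split; first exact: L2_tau.
  by apply: (@L2M_bnd _ 1) => //; [exact: cmeas_expi|move=> x; rewrite cmod_expi].
pose A N : set R := [set s | sym_itv N (s - a)].
have AE N : A N = `[- N%:R + a, N%:R + a[%classic.
  apply/seteqP; split => s; rewrite /A /sym_itv /period /= !in_itv /=; lra.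
have mA N : measurable (A N) by rewrite AE; exact: measurable_itv.
pose fN N s := ind (A N) s * f s.
have fNL N : L2 (fN N) by exact: L2_ind.
have cfN : L2cvg fN f.
  apply: L2cvg_trunc => // x.
  exists (Num.truncn `|x - a|).+1 => n hn.
  have h : `|x - a| < n%:R by rewrite (lt_le_trans (Num.Theory.truncnS_gt _))// ler_nat.
  by rewrite AE /= in_itv /=; move: h; rewrite ltr_norml; lra.
(* K exceeds the shift, so the window [A N] lies inside [-(N + K), N + K[. *)
pose K := (Num.truncn `|a|).+1.
have aK : `|a| < K%:R by exact: Num.Theory.truncnS_gt.
have trfN N : truncate (N + K) (fN N) = fN N.
  apply/funext => s; rewrite /truncate /fN !indE in_sym_itv; case: (boolP (s \in A N)) => sA.
    rewrite ifT ?mul1r//; move: sA; rewrite inE AE /= in_itv /= natrD.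
    by move: aK; rewrite ltr_norml; lra.
  by rewrite mul0r mulr0.
have ftE N xi : fourier_trunc N (tau a f) xi = expi (a * xi) * fourier_trunc (N + K) (fN N) xi.
  rewrite !fourier_truncE; last 2 first.
  - exact: L2_meas.
  - by apply: L2_meas; exact: L2_tau.
  rewrite trfN mulrCA; congr (_ * _).
  have ifN : cintegrable (fun t => fN N t * expi (- (t * xi))).
    by rewrite -(trfN N); exact: cintegrable_truncate.
  rewrite -cintZ// -[RHS](cint_tau a); last first.
    by apply: cmeasM; [exact: cmeas_cst|apply: cmeasM; [exact: L2_meas|exact: cmeas_expiN]].
  apply: eq_cint => t; rewrite /tau /fN /truncate.
  have -> : ind (A N) (t + a) = ind (sym_itv N) t.
    by rewrite !indE in_sym_itv; congr (if _ then _ else _); apply/idP/idP; rewrite inE AE /= in_itv /=; lra.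
  have -> : expi (- (t * xi)) = expi (a * xi) * expi (- ((t + a) * xi)).
    by rewrite -expiD; congr expi; ring.
  ring.
move=> e e0; have e20 : 0 < e / 2 by rewrite divr_gt0.
have [N1 h1] := cg _ e20; have [N' h2] := cfN _ e20.
exists (maxn N1 N') => n; rewrite geq_max => /andP[n1 n2].
have fL1 := L2_fourier_trunc (n + K) fL.
have fL2 := L2_fourier_trunc (n + K) (fNL n).
apply: (@le_trans _ _ (nrm (fun x => g x - fourier_trunc (n + K) (fN n) x))).
  rewrite le_eqVlt; apply/orP; left; apply/eqP; apply: eq_nrm => x.
  by rewrite ftE -mulrBr cmodM cmod_expi mul1r.
apply: le_trans (nrm_triangle gL fL1 fL2) _.
rewrite [e]splitr; apply: lerD; first by apply: h1; rewrite (leq_trans n1)// leq_addr.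
rewrite (_ : (fun x => _) = fourier_trunc (n + K) (fun x => f x - fN n x)); last first.
  by apply/funext => x; rewrite fourier_truncB.
rewrite nrm_fourier_trunc; last exact: L2B.
apply: le_trans (h2 n n2); apply: nrm_ind; last exact: L2B.
exact: measurable_period.
Qed.

(** Fubini's theorem computes the adjoint of the truncated transform: it is the inverse transform,
    written as the conjugate of the transform of conj G. The bounded support of G makes it
    integrable, as the exchange of integrals requires. *)
Lemma ip_fourier_trunc M N f G : L2 f -> L2 G -> truncate M G = G ->
  ip (fourier_trunc N f) G = ip (truncate N f) (fun t => (fourier_trunc M (fun x => (G x)^*) t)^*).
Proof.
move=> fL GL trG; have GJL := L2J GL.
have trGJ : truncate M (fun x => (G x)^*) = (fun x => (G x)^*).
  by apply/funext => x; rewrite -[in RHS]trG /truncate rmorphM /= indJ.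
rewrite /innerL2 -!/(cint _).
transitivity (fourier_cst%:C * cint (fun x => cint (fun t => truncate N f t * expi (- (t * x)) * (G x)^*))).
  have ii : cintegrable (fun x => cint (fun t => truncate N f t * expi (- (t * x)) * (G x)^*)).
    (* Scaling f by the inverse of the normalization makes the inner integral exactly a truncated
       transform, so integrability follows from L2 membership. *)
    have := cintegrable_ip (L2_fourier_trunc N (L2Z (fourier_cst^-1)%:C fL)) GL.
    congr cintegrable; apply/funext => x.
    rewrite fourier_truncZ// fourier_truncE; last exact: L2_meas.
    rewrite mulrA -rmorphM /= mulVf ?gt_eqF ?fourier_cst_gt0// rmorph1 mul1r.
    rewrite mulrC -cintZ; last exact: cintegrable_truncate.
    by apply: eq_cint => t; rewrite mulrC.
  rewrite -cintZ//; apply: eq_cint => x; rewrite fourier_truncE; last exact: L2_meas.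
  rewrite -mulrA; congr (_ * _); rewrite mulrC -cintZ; last exact: cintegrable_truncate.
  by apply: eq_cint => t; rewrite mulrC.
pose m2 (k : R * R -> R[i]) := measurable_fun [set: R * R] (fun p => complex.Re (k p)) /\
  measurable_fun [set: R * R] (fun p => complex.Im (k p)).
have m2M (k l : R * R -> R[i]) : m2 k -> m2 l -> m2 (fun p => k p * l p).
  move=> [f1 f2] [g1 g2]; split.
    rewrite (_ : (fun p => _) = (fun p => complex.Re (k p) * complex.Re (l p) - complex.Im (k p) * complex.Im (l p))).
      exact: (measurable_funB (measurable_funM f1 g1) (measurable_funM f2 g2)).
    by apply/funext => x; rewrite cE.
  rewrite (_ : (fun p => _) = (fun p => complex.Re (k p) * complex.Im (l p) + complex.Im (k p) * complex.Re (l p))).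
    exact: (measurable_funD (measurable_funM f1 g2) (measurable_funM f2 g1)).
  by apply/funext => x; rewrite cE.
have m2fst (u : R -> R[i]) : cmeasurable u -> m2 (fun p => u p.1).
  by move=> [u1 u2]; split; [exact: (measurableT_comp u1)|exact: (measurableT_comp u2)].
have m2snd (u : R -> R[i]) : cmeasurable u -> m2 (fun p => u p.2).
  by move=> [u1 u2]; split; [exact: (measurableT_comp u1)|exact: (measurableT_comp u2)].
have m2e : m2 (fun p => expi (- (p.2 * p.1))).
  have mp : measurable_fun [set: R * R] (fun p : R * R => - (p.2 * p.1)).
    rewrite (_ : (fun p => _) = (fun p : R * R => (-1 * p.2) * p.1)).
      by apply: measurable_funM => //; exact: measurable_funM.
    by apply/funext => p; rewrite mulN1r mulNr.
  split => /=; apply: measurableT_comp mp.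
    by apply: continuous_measurable_fun; exact: continuous_cos.
  by apply: continuous_measurable_fun; exact: continuous_sin.
have [mre mim] : m2 (fun p => truncate N f p.2 * expi (- (p.2 * p.1)) * (G p.1)^*).
  apply: (m2M _ (fun p => (G p.1)^*)); last exact: (m2fst _ (L2_meas GJL)).
  by apply: m2M => //; exact: (m2snd _ (L2_meas (L2_truncate N fL))).
rewrite (cint_fubini mre mim (integrable_cmod_truncate M GL) (integrable_cmod_truncate N fL)); last 3 first.
- move=> x t; rewrite trG mulrC; set w := _ * expi _.
  by rewrite cmodM cmodJ {}/w [X in _ * X]cmodM cmod_expi mulr1.
- by move=> x; exact: cmod_ge0.
- by move=> x; exact: cmod_ge0.
have eqt t : fourier_cst%:C * cint (fun x => truncate N f t * expi (- (t * x)) * (G x)^*) =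
    truncate N f t * fourier_trunc M (fun x => (G x)^*) t.
  rewrite fourier_truncE ?trGJ; last exact: L2_meas.
  rewrite mulrCA; congr (_ * _); rewrite -cintZ.
    by apply: eq_cint => x; rewrite -mulrA [(G x)^* * _]mulrC [t * x]mulrC.
  by have := cintegrable_truncate M t GJL; rewrite trGJ.
rewrite -cintZ.
  by apply: eq_cint => t; rewrite eqt conjCK.
have := cintegrable_ip (L2Z (fourier_cst^-1)%:C (L2_truncate N fL)) (L2J (L2_fourier_trunc M GJL)).
congr cintegrable; apply/funext => t; rewrite conjCK -mulrA -eqt mulrA -rmorphM /=.
by rewrite mulVf ?gt_eqF ?fourier_cst_gt0// rmorph1 mul1r.
Qed.

(* The candidate f is the inverse transform of G; by Fubini, the truncated
   transforms of f satisfy ||G - fourier_trunc n f||^2 = ||f||^2 - ||f 1_[-n,n[||^2. *)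
Lemma isFT_inversion M G : L2 G -> truncate M G = G -> exists f, isFT f G.
Proof.
move=> GL trG; have GJL := L2J GL.
pose f (t : R) : R[i] := (fourier_trunc M (fun x => (G x)^*) t)^*.
have fL : L2 f by apply: L2J; exact: L2_fourier_trunc.
have NJ (u : R -> R[i]) : N2 (fun x => (u x)^*) = N2 u.
  by apply: eq_N2 => x; rewrite cmodJ.
have NfG : N2 f = N2 G.
  rewrite /f NJ -nrm_sqr nrm_fourier_trunc// nrm_sqr -[RHS]NJ; congr N2.
  by apply/funext => x; rewrite -[in RHS]trG /truncate rmorphM /= indJ.
have trff N : ip (truncate N f) f = (N2 (truncate N f))%:C.
  rewrite -ipff; apply: eq_cint => t; rewrite /truncate rmorphM /= indJ.
  by rewrite -[in LHS](indM (sym_itv N)); ring.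
exists f; split => // e e0; have [N hN] := L2cvg_truncate fL e0.
exists N => n /hN; rewrite !nrm_le ?(ltW e0)//; apply: le_trans.
have L1 := L2_fourier_trunc n fL; have L2' := L2_truncate n fL.
have e1 : complex.Re (ip G (fourier_trunc n f)) = N2 (truncate n f).
  by rewrite (ipC L1 GL) (ip_fourier_trunc n fL GL trG) -/f trff !cE.
have e2 : complex.Re (ip f (truncate n f)) = N2 (truncate n f) by rewrite (ipC L2' fL) trff !cE.
have e3 : N2 (fourier_trunc n f) = N2 (truncate n f) by rewrite -!nrm_sqr nrm_fourier_trunc.
by rewrite (N2B GL L1) (N2B fL L2') e1 e2 e3 NfG; lra.
Qed.

End Plancherel.

(** * The frame operator on the Fourier side *)

Section AlmostEverywhere.
Context {R : realType}.
Notation mu := (@lebesgue_measure R).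
Implicit Types f g : R -> R[i].

Lemma ae_shift (a : R) (P : R -> Prop) :
  {ae mu, forall x, P x} -> {ae mu, forall x, P (x + a)}.
Proof.
move=> [N [mN N0 PN]]; exists [set x | N (x + a)]; split.
- rewrite -[X in measurable X]setTI.
  exact: (measurable_shift a measurableT mN).
- by rewrite -lebesgue_measure_shift.
- by move=> x Px; exact: PN.
Qed.

(** The pointwise inequalities couple F x and F (x - h) with two periodizations, so only sums of two
    squares can be compared. *)
Lemma N2_pair_le (c : R) (f1 f2 g1 g2 : R -> R[i]) : 0 <= c ->
  L2 f1 -> L2 f2 -> L2 g1 -> L2 g2 ->
  {ae mu, forall x, cmod (f1 x) ^+ 2 + cmod (f2 x) ^+ 2 <=
     c * (cmod (g1 x) ^+ 2 + cmod (g2 x) ^+ 2)} ->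
  N2 f1 + N2 f2 <= c * (N2 g1 + N2 g2).
Proof.
move=> c0 f1L f2L g1L g2L fg.
have pairE (u v : R -> R[i]) : L2 u -> L2 v -> (N2 u + N2 v)%:E =
    (\int[mu]_x (cmod (u x) ^+ 2 + cmod (v x) ^+ 2)%:E)%E.
  move=> uL vL; rewrite EFinD -!sqnormE// /sqnormL2 -ge0_integralD//.
  - by move=> x _; rewrite lee_fin sqr_ge0.
  - by apply: measurable_cmod2E; exact: L2_meas.
  - by move=> x _; rewrite lee_fin sqr_ge0.
  - by apply: measurable_cmod2E; exact: L2_meas.
have mpair (u v : R -> R[i]) : L2 u -> L2 v ->
    measurable_fun [set: R] (fun x => (cmod (u x) ^+ 2 + cmod (v x) ^+ 2)%:E).
  move=> uL vL; apply/measurable_EFinP; apply: measurable_funD;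
    by apply: measurable_cmod2; exact: L2_meas.
rewrite -lee_fin EFinM !pairE// -ge0_integralZl//; last 2 first.
- exact: mpair.
- by move=> x _; rewrite lee_fin addr_ge0 ?sqr_ge0.
apply: ae_ge0_le_integral => //.
- by move=> x _; rewrite lee_fin addr_ge0 ?sqr_ge0.
- exact: mpair.
- by move=> x _; rewrite -EFinM lee_fin mulr_ge0// addr_ge0 ?sqr_ge0.
- by apply: measurable_funeM; exact: mpair.
- by apply: ae_imply fg => x h _; rewrite -EFinM lee_fin.
Qed.

End AlmostEverywhere.

(** The right-hand side is the first column of the outer matrix. Its invertibility reduces the
    system to H (u A + v B) = 1 and H (u A' + v B') = 0, which Cramer's rule solves with the entries
    A' and B' of the other generator: this is where the vector [perp] comes from. *)
Lemma cramer2_uniq (K : fieldType) (H a b a' b' A B A' B' u v : K) :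
  H != 0 -> b * a' - b' * a != 0 -> B * A' - B' * A != 0 ->
  H * (a * (u * A + v * B) + a' * (u * A' + v * B')) = a /\
  H * (b * (u * A + v * B) + b' * (u * A' + v * B')) = b <->
  u = - B' / (H * (B * A' - B' * A)) /\ v = A' / (H * (B * A' - B' * A)).
Proof.
move=> H0 d0 E0; split; last first.
  by move=> [-> ->]; split; field; rewrite H0 E0.
move=> [h1 h2].
have /eqP : (b * a' - b' * a) * (H * (u * A + v * B) - 1) = 0.
  rewrite (_ : _ * _ = a' * (H * (b * (u * A + v * B) + b' * (u * A' + v * B')) - b) -
    b' * (H * (a * (u * A + v * B) + a' * (u * A' + v * B')) - a)); last by ring.
  by rewrite h1 h2 !subrr !mulr0 subrr.
rewrite mulf_eq0 (negbTE d0) /= subr_eq0 => /eqP e1.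
have /eqP : (b * a' - b' * a) * (H * (u * A' + v * B')) = 0.
  rewrite (_ : _ * _ = b * (H * (a * (u * A + v * B) + a' * (u * A' + v * B')) - a) -
    a * (H * (b * (u * A + v * B) + b' * (u * A' + v * B')) - b)); last by ring.
  by rewrite h1 h2 !subrr !mulr0 subrr.
rewrite mulf_eq0 (negbTE d0) /= => /eqP e2.
have HE0 : H * (B * A' - B' * A) != 0 by rewrite mulf_neq0.
split; apply/(canRL (mulfK HE0)).
  transitivity (B * (H * (u * A' + v * B')) - B' * (H * (u * A + v * B))); first by ring.
  by rewrite e1 e2; ring.
transitivity (A' * (H * (u * A + v * B)) - A * (H * (u * A' + v * B'))); first by ring.
by rewrite e1 e2; ring.
Qed.

(** * Pointwise linear systems for the dual generators *)

Section Solve.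
Context {R : realType}.
Notation mu := (@lebesgue_measure R).
Local Notation ip := innerL2.
Context (omega h delta gamma kap : R) (psi : 'I_2 -> R -> R[i]).
Context (omega_gt0 : 0 < omega) (omega_le_h : omega <= h) (h_lt : h < 2 * omega).
Context (delta_gt0 : 0 < delta) (gamma_gt0 : 0 < gamma) (kap_gt0 : 0 < kap).
Context (mpsi : forall j, cmeasurable (psi j)).
Context (psi_le : forall j x, cmod (psi j x) ^+ 2 <= gamma).

(** Vanishing holds at every point, the ends of the band included, so that the systems below are
    exact identities at each x, even when h = omega. *)
Definition band (F : R -> R[i]) := forall x, ~~ (- omega < x < omega) -> F x = 0.

Context (psi_band : forall j, band (psi j)).

Definition other (i : 'I_2) : 'I_2 := if i == 0 then 1 else 0.

Lemma sum_other (V : nmodType) (u : 'I_2 -> V) i : \sum_j u j = u i + u (other i).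
Proof.
have eqo (j k : 'I_2) : val j = val k -> u j = u k by move=> /val_inj ->.
rewrite big_ord_recl big_ord1 /other; case: i => [[|[|//]] i2] /=.
  by congr (_ + _); exact: eqo.
by rewrite addrC; congr (_ + _); exact: eqo.
Qed.

Definition periodize (G : R -> R[i]) x : R[i] := G (x - h) + G x + G (x + h).

(* The frame operator read on the Fourier side: the sum over n of the frame
   coefficients times e^(i n t0 x) is h times the Fourier series of the
   h-periodization of F * conj psi_j.  As F and psi_j vanish outside
   ]-omega, omega[ and omega <= h, only three terms of it matter. *)
Definition frame_op_hat (F : R -> R[i]) x : R[i] :=
  h%:C * \sum_(j < 2) psi j x * periodize (fun y => F y * (psi j y)^*) x.

Definition energy x := \sum_(j < 2) cmod (psi j x) ^+ 2.

(** On the overlap, [minor 0] is the conjugate of the pre-Gramian determinant divided by h;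
    [minor 1] is its opposite, which lets one formula serve both generators. *)
Definition minor i x : R[i] := (psi i (x - h))^* * (psi (other i) x)^* -
  (psi (other i) (x - h))^* * (psi i x)^*.

Lemma band_outl F x : band F -> x <= - omega -> F x = 0.
Proof. by move=> bF hx; apply: bF; apply/negP => /andP[? ?]; lra. Qed.

Lemma band_outr F x : band F -> omega <= x -> F x = 0.
Proof. by move=> bF hx; apply: bF; apply/negP => /andP[? ?]; lra. Qed.

Lemma band_frame_op_hat F : band (frame_op_hat F).
Proof.
move=> x hx; rewrite /frame_op_hat big1 ?mulr0// => j _.
by rewrite (psi_band j hx) mul0r.
Qed.

Lemma h_gt0 : 0 < h. Proof. exact: lt_le_trans omega_le_h. Qed.

Lemma hC_neq0 : h%:C != 0 :> R[i].
Proof. by rewrite -cmod_eq0 cmodC normr_eq0 gt_eqF// h_gt0. Qed.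

(** Both x and x - h lie in the band, while x + h and x - 2h do not: the values of [frame_op_hat F]
    at x and x - h involve only F x and F (x - h). *)
Lemma solve_overlap i F x : band F -> h - omega < x < omega -> minor i x != 0 ->
  frame_op_hat F x = psi i x /\ frame_op_hat F (x - h) = psi i (x - h) <->
  F x = - (psi (other i) (x - h))^* / (h%:C * minor i x) /\
  F (x - h) = (psi (other i) x)^* / (h%:C * minor i x).
Proof.
move=> bF /andP[x1 x2] E0; rewrite -(@cramer2_uniq _ h%:C (psi i x) (psi i (x - h)) (psi (other i) x)
  (psi (other i) (x - h)) (psi i x)^* _ _ _ _ _ hC_neq0 _ E0); last first.
  apply: contraNneq E0 => e; rewrite /minor -!rmorphM -rmorphB /=.
  by rewrite [X in X^*](_ : _ = 0) ?rmorph0// -[RHS]e; ring.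
rewrite /frame_op_hat !(sum_other _ i) /periodize.
have F1 : F (x + h) = 0 by apply: band_outr => //; move: omega_le_h h_lt; lra.
have F2 : F (x - h - h) = 0 by apply: band_outl => //; move: omega_le_h h_lt; lra.
rewrite subrK F1 F2 !mul0r !addr0 !add0r.
by rewrite -/(F x) ![F (x - h) * _ + F x * _]addrC.
Qed.

Lemma solve_center i F x : band F -> omega - h < x < h - omega -> energy x != 0 ->
  frame_op_hat F x = psi i x <-> F x = psi i x / (h * energy x)%:C.
Proof.
move=> bF /andP[x1 x2] e0.
have F1 : F (x + h) = 0 by apply: band_outr => //; move: omega_le_h h_lt; lra.
have F2 : F (x - h) = 0 by apply: band_outl => //; move: omega_le_h h_lt; lra.
have he0 : (h * energy x)%:C != 0 :> R[i].
  by rewrite -cmod_eq0 cmodC normr_eq0 mulf_neq0// gt_eqF// h_gt0.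
have -> : frame_op_hat F x = F x * (h * energy x)%:C.
  rewrite /frame_op_hat rmorphM /= /energy raddf_sum /= mulrCA; congr (_ * _).
  rewrite big_distrr /=; apply: eq_bigr => j _.
  by rewrite /periodize F1 F2 !mul0r add0r addr0 -mulcJ_cmod; ring.
by split => [<-|->]; rewrite ?mulfK ?mulfVK.
Qed.

(** The lower bounds hold almost everywhere only. Returning 0 where they fail keeps the candidate
    bounded, hence square integrable on the band, without changing its class. *)
Definition inv_cutoff (e : R) (t : R) (z : R[i]) : R[i] := if e <= t then z^-1 else 0.

Definition dual_hat_core i (y : R) : R[i] :=
  if y \in `]h - omega, omega[%classic then
     - (inv_cutoff kap (cmod (minor i y)) (h%:C * minor i y) * (psi (other i) (y - h))^*)
  else if y \in `]omega - h, h - omega[%classic then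
     inv_cutoff delta (energy y) (h * energy y)%:C * psi i y
  else if y \in `](- omega), (omega - h)[%classic then
     inv_cutoff kap (cmod (minor i (y + h))) (h%:C * minor i (y + h)) * (psi (other i) (y + h))^*
  else 0.

(** The window [-h, h[ contains the band, so the factor alters no value; it presents the function as
    a bounded one on a period, the form that [L2_bnd] handles. *)
Definition dual_hat i (y : R) : R[i] := ind (period (- h) (2 * h)) y * dual_hat_core i y.

Lemma cmod_psi_le j x : cmod (psi j x) <= gamma + 1.
Proof. by have := psi_le j x; have := sqr_ge0 (cmod (psi j x) - 1); have := sqr_ge0 (cmod (psi j x)); lra. Qed.

Lemma cmeas_minor i : cmeasurable (minor i).
Proof.
by apply: cmeasB; apply: cmeasM; apply: cmeasJ => //; exact: (cmeas_tau (- h)).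
Qed.

Lemma measurable_energy : measurable_fun [set: R] energy.
Proof.
rewrite (_ : energy = (fun x => cmod (psi 0 x) ^+ 2 + cmod (psi (other 0) x) ^+ 2)).
  by apply: measurable_funD; exact: measurable_cmod2.
by apply/funext => x; rewrite /energy (sum_other _ 0).
Qed.

Lemma cmeas_inv_cutoff (e : R) (t : R -> R) (z : R -> R[i]) : measurable_fun [set: R] t ->
  cmeasurable z -> cmeasurable (fun x => inv_cutoff e (t x) (z x)).
Proof.
move=> mt mz; pose A : set R := [set x | e <= t x].
rewrite (_ : (fun x => _) = (fun x => if x \in A then (z x)^-1 else 0)); last first.
  by apply/funext => x; rewrite /inv_cutoff; congr (if _ then _ else _); apply/idP/idP; rewrite inE.
apply: cmeas_if; [|exact: cmeasV|exact: cmeas_cst].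
rewrite (_ : A = t @^-1` `[e, +oo[); last first.
  by apply/seteqP; split => x; rewrite /A /= in_itv /= andbT.
by rewrite -[X in measurable X]setTI; exact: mt.
Qed.

Lemma cmod_inv_cutoff_le (e t : R) z : 0 < e -> h * t <= cmod z -> cmod (inv_cutoff e t z) <= (h * e)^-1.
Proof.
move=> e0 tz; have h0 := h_gt0; rewrite /inv_cutoff; case: ifP => et; last first.
  by rewrite cmod0 invr_ge0 mulr_ge0// ltW.
have he : 0 < h * e by rewrite mulr_gt0.
have hez : h * e <= cmod z by rewrite (le_trans _ tz)// ler_pM2l.
by rewrite cmodV lef_pV2 ?posrE// (lt_le_trans he).
Qed.

Lemma L2_dual_hat i : L2 (dual_hat i).
Proof.
have h0 := h_gt0.
have g0 : 0 <= gamma + 1 by rewrite addr_ge0// ltW.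
have hk0 : 0 <= (h * kap)^-1 by rewrite invr_ge0 mulr_ge0// ltW.
have hd0 : 0 <= (h * delta)^-1 by rewrite invr_ge0 mulr_ge0// ltW.
have mE := cmeas_minor i.
have mE' := measurable_energy.
pose M := ((h * kap)^-1 + (h * delta)^-1) * (gamma + 1).
suff [mc bc] : cmeasurable (dual_hat_core i) /\ forall x, cmod (dual_hat_core i x) <= M.
  exact: (@L2_bnd _ (- h) (2 * h) M (dual_hat_core i) mc bc).
split.
  rewrite /dual_hat_core; have cutm : cmeasurable (fun y => inv_cutoff kap (cmod (minor i y)) (h%:C * minor i y)).
    by apply: cmeas_inv_cutoff; [exact: measurable_cmod|apply: cmeasM => //; exact: cmeas_cst].
  apply: cmeas_if => //.
    by apply: cmeasN; apply: cmeasM => //; apply: cmeasJ; exact: (cmeas_tau (- h)).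
  apply: cmeas_if => //.
    by apply: cmeasM => //; apply: cmeas_inv_cutoff => //; apply: cmeasR; exact: measurable_funM.
  apply: cmeas_if => //.
  apply: cmeasM; first exact: (cmeas_tau h cutm).
  by apply: cmeasJ; exact: (cmeas_tau h).
have cutk y : cmod (inv_cutoff kap (cmod (minor i y)) (h%:C * minor i y)) <= (h * kap)^-1.
  by apply: cmod_inv_cutoff_le => //; rewrite cmodM cmodC ger0_norm// ltW.
move=> y; rewrite /dual_hat_core; case: ifP => _.
  rewrite cmodN cmodM cmodJ; apply: ler_pM; rewrite ?cmod_ge0 ?cmod_psi_le//.
  by rewrite (le_trans (cutk y))// lerDl.
case: ifP => _.
  rewrite cmodM; apply: ler_pM; rewrite ?cmod_ge0 ?cmod_psi_le//.
  apply: (@le_trans _ _ (h * delta)^-1); last by rewrite lerDr.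
  by apply: cmod_inv_cutoff_le => //; rewrite cmodC ler_norm.
case: ifP => _; last by rewrite cmod0 mulr_ge0// addr_ge0.
rewrite cmodM cmodJ; apply: ler_pM; rewrite ?cmod_ge0 ?cmod_psi_le//.
by rewrite (le_trans (cutk _))// lerDl.
Qed.

Lemma ind_window y : - h <= y < h -> ind (period (- h) (2 * h)) y = 1 :> R[i].
Proof.
move=> yh; rewrite indE ifT// inE /period /= in_itv /=; move: yh; lra.
Qed.

Lemma dual_hat_right i y : h - omega < y < omega -> kap <= cmod (minor i y) ->
  dual_hat i y = - (psi (other i) (y - h))^* / (h%:C * minor i y).
Proof.
move=> hy k; rewrite /dual_hat /dual_hat_core ind_window; last by move: hy omega_le_h h_lt; lra.
by rewrite ifT ?inE /= ?in_itv//= /inv_cutoff k mul1r mulrC mulNr.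
Qed.

Lemma dual_hat_left i y : h - omega < y < omega -> kap <= cmod (minor i y) ->
  dual_hat i (y - h) = (psi (other i) y)^* / (h%:C * minor i y).
Proof.
move=> hy k; have h0 := h_gt0; rewrite /dual_hat /dual_hat_core ind_window; last by move: hy omega_le_h h_lt; lra.
rewrite ifF; last by apply/negP; rewrite inE /= in_itv /=; move: hy omega_le_h h_lt; lra.
rewrite ifF; last by apply/negP; rewrite inE /= in_itv /=; move: hy omega_le_h h_lt; lra.
rewrite ifT; last by rewrite inE /= in_itv /=; move: hy omega_le_h h_lt; lra.
by rewrite subrK /inv_cutoff k mul1r mulrC.
Qed.

Lemma dual_hat_center i y : omega - h < y < h - omega -> delta <= energy y ->
  dual_hat i y = psi i y / (h * energy y)%:C.
Proof.
move=> hy k; rewrite /dual_hat /dual_hat_core ind_window; last by move: hy omega_le_h h_lt; lra.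
rewrite ifF; last by apply/negP; rewrite inE /= in_itv /=; move: hy omega_le_h h_lt; lra.
by rewrite ifT ?inE /= ?in_itv//= /inv_cutoff k mul1r mulrC.
Qed.

Lemma band_dual_hat i : band (dual_hat i).
Proof.
move=> y hy; have h0 := h_gt0; rewrite /dual_hat /dual_hat_core.
do 3 (rewrite ifF; last by apply/negP; rewrite inE /= in_itv /= => /andP[? ?];
  case/negP: hy; move: omega_le_h h_lt; lra).
by rewrite mulr0.
Qed.

Context (energy_ge : {ae mu, forall x, - omega < x < omega -> delta <= energy x}).
Context (minor_ge : forall i, {ae mu, forall x, h - omega < x < omega -> kap <= cmod (minor i x)}).

Lemma minor_neq0 i x : kap <= cmod (minor i x) -> minor i x != 0.
Proof. by move=> k; rewrite -cmod_eq0 gt_eqF// (lt_le_trans kap_gt0). Qed.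

Lemma energy_neq0 x : delta <= energy x -> energy x != 0.
Proof. by move=> k; rewrite gt_eqF// (lt_le_trans delta_gt0). Qed.

Lemma frame_op_hat_dual_hat i : {ae mu, forall x, frame_op_hat (dual_hat i) x = psi i x}.
Proof.
have h1 := minor_ge i; have h2 := ae_shift h h1.
apply: ae_imply3 energy_ge (ae_imply2 (fun x a b => conj a b) h1 h2)
  (ae_imply2 (fun x a b => conj a b) (ae_neq (h - omega)) (ae_neq (omega - h))).
move=> x e [m1 m2] [n1 n2].
have bc := @band_dual_hat i.
have solve y : h - omega < y < omega -> kap <= cmod (minor i y) ->
    frame_op_hat (dual_hat i) y = psi i y /\ frame_op_hat (dual_hat i) (y - h) = psi i (y - h).
  move=> hy k; apply/(solve_overlap bc hy (minor_neq0 k)).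
  by rewrite dual_hat_right// dual_hat_left.
case: (boolP (- omega < x < omega)) => [hx|hx]; last first.
  by rewrite (band_frame_op_hat _ hx) (psi_band i hx).
case: (ltrgtP (h - omega) x) => c1; last by rewrite c1 eqxx in n1.
  by have [] : frame_op_hat (dual_hat i) x = psi i x /\ frame_op_hat (dual_hat i) (x - h) = psi i (x - h);
   [apply: solve; [|apply: m1]; move: hx; lra|].
case: (ltrgtP (omega - h) x) => c2; last by rewrite c2 eqxx in n2.
  apply/(solve_center _ bc); [lra|exact/energy_neq0/e|].
  by rewrite dual_hat_center//; [lra|exact: e].
(* The left part of the band is reached through the second equation of the system at x + h. *)
have hx' : h - omega < x + h < omega by move: hx; lra.
by have [] := solve _ hx' (m2 hx'); rewrite addrK.
Qed.

Lemma frame_op_hat_solution i F : band F -> {ae mu, forall x, frame_op_hat F x = psi i x} ->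
  {ae mu, forall x, [/\
    - omega < x < omega - h ->
      F x = (psi (other i) (x + h))^* / (h%:C * minor i (x + h)),
    omega - h < x < h - omega -> F x = psi i x / (h * energy x)%:C
  & h - omega < x < omega ->
      F x = - (psi (other i) (x - h))^* / (h%:C * minor i x)]}.
Proof.
move=> bF e0; have h1 := minor_ge i; have h2 := ae_shift h h1.
apply: ae_imply3 energy_ge (ae_imply2 (fun x a b => conj a b) h1 h2)
  (ae_imply3 (fun x a b c => conj a (conj b c)) e0 (ae_shift h e0) (ae_shift (- h) e0)).
move=> x e [m1 m2] [s0 [s1 s2]]; split => hx.
- have hx' : h - omega < x + h < omega by move: hx; lra.
  have [+ _] := solve_overlap (i := i) bF hx' (minor_neq0 (m2 hx')).
  by rewrite addrK => -[].
- apply/(solve_center _ bF hx) => //; apply/energy_neq0/e.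
  by move: hx omega_le_h h_lt omega_gt0; lra.
- by have [+ _] := solve_overlap (i := i) bF hx (minor_neq0 (m1 hx)); case.
Qed.

End Solve.

(** * Frame bounds and the frame series *)

Section FrameSystem.
Context {R : realType}.
Notation mu := (@lebesgue_measure R).
Local Notation ip := innerL2.
Context (omega h gamma t0 : R) (Phi psi : 'I_2 -> R -> R[i]).
Context (omega_gt0 : 0 < omega) (omega_le_h : omega <= h) (t0h : t0 * h = 2 * pi).
Context (gamma_gt0 : 0 < gamma).
Context (mpsi : forall j, cmeasurable (psi j)).
Context (psi_le : forall j x, cmod (psi j x) ^+ 2 <= gamma).
Context (psi_band : forall j, band omega (psi j)).
Context (psiFT : forall j, isFT (Phi j) (psi j)).

Local Notation I0 := (period 0 h).

Lemma period_gt0 : 0 < h. Proof. exact: lt_le_trans omega_le_h. Qed.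

Lemma in_I0 x : (x \in I0) = (0 <= x < h).
Proof. by apply/idP/idP; rewrite inE /period /= in_itv /= add0r. Qed.

Lemma band_window F x : band omega F -> ~~ (- h <= x < h) -> F x = 0.
Proof.
move=> bF hx; apply: bF; apply: contra hx => /andP[? ?]; move: omega_le_h; lra.
Qed.

(** The band lies in [-h, h[. The half over [-h, 0[ is translated by h, which leaves the
    exponentials unchanged because t0 h = 2 pi, and is added to the half over [0, h[. *)
Lemma coef_periodize (G : R -> R[i]) n : L2 G -> band omega G ->
  cint (fun x => G x * (ek t0 n x)^*) = coef 0 h t0 (fun x => ind I0 x * periodize h G x) n.
Proof.
move=> GL bG; have h0 := period_gt0.
have mI : measurable I0 by exact: measurable_period.
have mJ : measurable (period (- h) h) by exact: measurable_period.
have inJ x : (x \in period (- h) h) = (- h <= x < 0).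
  by apply/idP/idP; rewrite inE /period /= in_itv /= addNr.
have G2L := L2_tau (- h) GL.
pose u x := ind I0 x * G x * (Ek 0 h t0 n x)^*.
pose v x := ind (period (- h) h) x * G x * (Ek (- h) h t0 n x)^*.
pose w x := ind I0 x * tau (- h) G x * (Ek 0 h t0 n x)^*.
have iu : cintegrable u by apply: cintegrable_ip (L2_ind mI GL) (L2_Ek _ _ _ _).
have iv : cintegrable v by apply: cintegrable_ip (L2_ind mJ GL) (L2_Ek _ _ _ _).
have iw : cintegrable w by apply: cintegrable_ip (L2_ind mI G2L) (L2_Ek _ _ _ _).
transitivity (cint u + cint v).
  rewrite -cintD//; apply: eq_cint => x; rewrite /u /v /Ek !rmorphM /= !indJ !indE in_I0 inJ.
  case: (boolP (- h <= x < h)) => [/andP[h1 h2]|hx]; last first.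
    by rewrite (band_window bG hx) !(mulr0, mul0r) addr0.
  rewrite h1 h2 andbT; case: (ltP x 0) => x0 /=;
    by rewrite !(mul1r, mul0r) ?(addr0, add0r).
have -> : cint v = cint w.
  rewrite -(cint_tau (- h)); last first.
    apply: cmeasM; first exact: L2_meas (L2_ind mJ GL).
    by apply: cmeasJ; exact: L2_meas (L2_Ek _ _ _ _).
  apply: eq_cint => x; rewrite /tau /v /w /Ek -(ek_period t0h n (x + - h)) subrK.
  have -> : ind (period (- h) h) (x + - h) = ind I0 x :> R[i]; last by [].
  by rewrite !indE in_I0 inJ; congr (if _ then _ else _); apply/idP/idP; lra.
rewrite -cintD//; rewrite /coef /innerL2; apply: eq_cint => x; rewrite /u /w -mulrDl.
congr (_ * _); rewrite -mulrDr !indE in_I0; case: ifP => hx; rewrite ?mul0r// !mul1r /periodize /tau.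
rewrite addrC [G (x + h)](band_window bG) ?addr0//; apply/negP; lra.
Qed.

Definition mod_conj (F : R -> R[i]) j x := F x * (psi j x)^*.

Lemma band_mod_conj F j : band omega (mod_conj F j).
Proof. by move=> x hx; rewrite /mod_conj (psi_band j hx) rmorph0 mulr0. Qed.

Lemma L2_mod_conj F j : L2 F -> L2 (mod_conj F j).
Proof.
move=> FL; rewrite (_ : mod_conj F j = (fun x => (psi j x)^* * F x)).
  apply: (@L2M_bnd _ (gamma + 1)) => //; first exact: cmeasJ.
  by move=> x; rewrite cmodJ; exact: (cmod_psi_le psi_le).
by apply/funext => x; rewrite /mod_conj mulrC.
Qed.

Lemma L2_periodize (G : R -> R[i]) : L2 G -> L2 (periodize h G).
Proof.
by move=> GL; apply: L2D; [apply: L2D => //; exact: (L2_tau (- h) GL)|exact: (L2_tau h GL)].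
Qed.

Definition periodized j F x := ind I0 x * periodize h (mod_conj F j) x.

Lemma L2_periodized j F : L2 F -> L2 (periodized j F).
Proof.
by move=> FL; apply: L2_ind; [exact: measurable_period|exact/L2_periodize/L2_mod_conj].
Qed.

Lemma ip_shift_family f F j n : isFT f F ->
  ip f (shift_family t0 Phi (j, n)) = coef 0 h t0 (periodized j F) n.
Proof.
move=> fF; have [_ FL _] := fF.
rewrite (isFT_ip fF (isFT_tau (n%:~R * t0) (psiFT j))) -coef_periodize.
- by apply: eq_cint => x; rewrite /mod_conj rmorphM /= -mulrA [X in _ * X]mulrC.
- exact: L2_mod_conj.
- exact: band_mod_conj.
Qed.

Lemma frame_sum f F : isFT f F ->
  (\sum_(j < 2) \esum_(n in [set: int])
      ((cmod (ip f (shift_family t0 Phi (j, n)))) ^+ 2)%:E =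
   (h * (N2 (periodized 0 F) + N2 (periodized 1 F)))%:E)%E.
Proof.
move=> fF; have [_ FL _] := fF; have h0 := period_gt0.
have e j : (\esum_(n in [set: int]) ((cmod (ip f (shift_family t0 Phi (j, n)))) ^+ 2)%:E
    = (h * N2 (periodized j F))%:E)%E.
  rewrite -(parseval 0 h0 t0h (L2_periodize (L2_mod_conj j FL))).
  by apply: eq_esum => n _; rewrite (ip_shift_family _ _ fF).
by rewrite (sum_other _ 0) !e -EFinD -mulrDr.
Qed.

Lemma N2_periodized_split F : L2 F -> band omega F ->
  N2 F = N2 (fun x => ind I0 x * F x) + N2 (fun x => ind I0 x * F (x - h)).
Proof.
move=> FL bF; have h0 := period_gt0.
pose J := period (- h) h.
have mI : measurable I0 by exact: measurable_period.
have mJ : measurable J by exact: measurable_period.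
have inJ x : (x \in J) = (- h <= x < 0).
  by apply/idP/idP; rewrite inE /J /period /= in_itv /= addNr.
have -> : N2 (fun x => ind I0 x * F (x - h)) = N2 (fun x => ind J x * F x).
  rewrite -[RHS](N2_tau (- h)); last exact: L2_meas (L2_ind mJ FL).
  apply: eq_N2 => x; rewrite /tau; congr (cmod (_ * _)).
  by rewrite !indE in_I0 inJ; congr (if _ then _ else _); apply/idP/idP; lra.
have -> : N2 F = N2 (fun x => ind I0 x * F x + ind J x * F x).
  apply: eq_N2 => x; rewrite -mulrDl !indE in_I0 inJ.
  case: (boolP (- h <= x < h)) => [/andP[h1 h2]|hx]; last by rewrite (band_window bF hx) mulr0.
  by rewrite h1 h2 andbT; case: (ltP x 0) => x0 /=; rewrite ?(addr0, add0r) mul1r.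
rewrite (N2D (L2_ind mI FL) (L2_ind mJ FL)) (_ : ip _ _ = 0) ?mulr0 ?addr0//.
rewrite -(cint0 (R := R)); apply: eq_cint => x; rewrite rmorphM /= indJ !indE in_I0 inJ.
by case: (ltP x 0) => x0; case: (ltP x h) => xh; case: (leP (- h) x) => hx' /=;
    rewrite ?(mulr0, mul0r).
Qed.

Lemma foldE j F x : band omega F -> x \in I0 ->
  periodized j F x = F x * (psi j x)^* + F (x - h) * (psi j (x - h))^*.
Proof.
move=> bF xI; rewrite /periodized indE xI mul1r /periodize /mod_conj.
rewrite (band_window bF (x := x + h)) ?mul0r ?addr0 1?addrC//.
by move: xI; rewrite in_I0 => ?; apply/negP; lra.
Qed.

(** Each of the two generators contributes 2 gamma, by |z + w|^2 <= 2 |z|^2 + 2 |w|^2. *)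
Lemma periodized_upper F : L2 F -> band omega F ->
  N2 (periodized 0 F) + N2 (periodized 1 F) <= 4 * gamma * N2 F.
Proof.
move=> FL bF; rewrite (N2_periodized_split FL bF).
have mI : measurable I0 by exact: measurable_period.
apply: N2_pair_le; [by rewrite mulr_ge0// ltW|exact: L2_periodized|exact: L2_periodized|
  exact: L2_ind|by apply: L2_ind => //; exact: (L2_tau (- h) FL)|].
apply: aeW => x; case: (boolP (x \in I0)) => xI; last first.
  by rewrite /periodized indE (negbTE xI) !mul0r cmod0 expr0n addr0 mulr0.
have b j : cmod (periodized j F x) ^+ 2 <= 2 * gamma * (cmod (F x) ^+ 2 + cmod (F (x - h)) ^+ 2).
  rewrite foldE//; apply: le_trans (cmod_sqrD_le _ _) _.
  rewrite !cmodM !cmodJ !exprMn.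
  have := ler_wpM2l (sqr_ge0 (cmod (F x))) (psi_le j x).
  have := ler_wpM2l (sqr_ge0 (cmod (F (x - h)))) (psi_le j (x - h)).
  lra.
rewrite indE xI !mul1r; have := b 0; have := b 1; lra.
Qed.

(** The two summands of the constant belong to disjoint regions: delta^-1 where one of F x, F (x -
    h) vanishes, 4 gamma / kap^2 on the overlap. Their sum serves everywhere on [0, h[. *)
Lemma periodized_lower (delta kap : R) F : h < 2 * omega -> 0 < delta -> 0 < kap ->
  {ae mu, forall x, - omega < x < omega -> delta <= energy psi x} ->
  {ae mu, forall x, h - omega < x < omega -> kap <= cmod (minor h psi 0 x)} ->
  L2 F -> band omega F ->
  N2 F <= (delta^-1 + 4 * gamma / kap ^+ 2) * (N2 (periodized 0 F) + N2 (periodized 1 F)).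
Proof.
move=> h2 d0 k0 eg mg FL bF; rewrite (N2_periodized_split FL bF).
have mI : measurable I0 by exact: measurable_period.
have kg0 : 0 <= 4 * gamma / kap ^+ 2 by rewrite divr_ge0 ?sqr_ge0// mulr_ge0// ltW.
have di0 : 0 <= delta^-1 by rewrite invr_ge0 ltW.
apply: N2_pair_le; [exact: addr_ge0|exact: L2_ind|
  by apply: L2_ind => //; exact: (L2_tau (- h) FL)|exact: L2_periodized|exact: L2_periodized|].
apply: ae_imply3 (ae_imply2 (fun x a b => conj a b) eg (ae_shift (- h) eg)) mg (ae_neq (h - omega)).
move=> x [e1 e2] m n; case: (boolP (x \in I0)) => xI; last first.
  rewrite indE (negbTE xI) !mul0r cmod0 expr0n addr0 mulr_ge0 ?addr_ge0 ?sqr_ge0//.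
rewrite indE xI !mul1r; have := xI; rewrite in_I0 => /andP[x0 xh].
set S := _ + _; set P := (X in _ <= _ * X).
have P0 : 0 <= P by rewrite addr_ge0// sqr_ge0.
have PE : P = \sum_(j < 2) cmod (periodized j F x) ^+ 2 by rewrite (sum_other _ 0).
have single y : delta <= energy psi y -> S = cmod (F y) ^+ 2 ->
    (forall j, periodized j F x = F y * (psi j y)^*) -> S <= (delta^-1 + 4 * gamma / kap ^+ 2) * P.
  move=> ey SE fE; apply: (@le_trans _ _ (delta^-1 * P)); last first.
    by rewrite ler_wpM2r// lerDl.
  rewrite mulrC ler_pdivlMr// SE PE.
  under eq_bigr do rewrite fE cmodM cmodJ exprMn.
  by rewrite -big_distrr /= ler_wpM2l// sqr_ge0.
case: (ltrgtP x (h - omega)) => c1; last by rewrite c1 eqxx in n.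
  have F0 : F (x - h) = 0 by apply: (band_outl bF); lra.
  apply: (single x) => [||j].
  - by apply: e1; lra.
  - by rewrite /S F0 cmod0 expr0n addr0.
  - by rewrite foldE// F0 mul0r addr0.
case: (ltP x omega) => c2; last first.
  have F0 : F x = 0 by apply: (band_outr bF).
  apply: (single (x - h)) => [||j].
  - by apply: e2; lra.
  - by rewrite /S F0 cmod0 expr0n add0r.
  - by rewrite foldE// F0 mul0r add0r.
have {}m : kap <= cmod (minor h psi 0 x) by apply: m; rewrite c1.
apply: (@le_trans _ _ (4 * gamma / kap ^+ 2 * P)); last by rewrite ler_wpM2r// lerDr.
rewrite mulrAC ler_pdivlMr ?exprn_gt0//.
apply: (@le_trans _ _ (S * cmod (minor h psi 0 x) ^+ 2)).
  by rewrite ler_wpM2l ?addr_ge0 ?sqr_ge0// lerXn2r ?nnegrE ?cmod_ge0// ltW.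
have bnd (z w a b : R[i]) : cmod a ^+ 2 <= gamma -> cmod b ^+ 2 <= gamma ->
    cmod (z * a^* - w * b^*) ^+ 2 <= 2 * gamma * (cmod z ^+ 2 + cmod w ^+ 2).
  move=> a1 b1; apply: le_trans (cmod_sqrD_le _ _) _; rewrite cmodN !cmodM !cmodJ !exprMn.
  have := ler_wpM2l (sqr_ge0 (cmod z)) a1; have := ler_wpM2l (sqr_ge0 (cmod w)) b1; lra.
(* Cramer's rule: the minor times an unknown is a combination of the two periodizations with
   coefficients bounded through gamma. Each unknown costs 2 gamma, whence 4 gamma in all. *)
have u1 : cmod (F x) ^+ 2 * cmod (minor h psi 0 x) ^+ 2 <= 2 * gamma * P.
  rewrite -exprMn -cmodM.
  rewrite (_ : F x * _ = periodized 1 F x * (psi 0 (x - h))^* - periodized 0 F x * (psi 1 (x - h))^*).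
    by rewrite /P [X in _ <= _ * X]addrC; exact: bnd.
  by rewrite !foldE// /minor; ring.
have u2 : cmod (F (x - h)) ^+ 2 * cmod (minor h psi 0 x) ^+ 2 <= 2 * gamma * P.
  rewrite -exprMn -cmodM.
  rewrite (_ : F (x - h) * _ = periodized 0 F x * (psi 1 x)^* - periodized 1 F x * (psi 0 x)^*).
    exact: bnd.
  by rewrite !foldE// /minor; ring.
rewrite /S mulrDl; lra.
Qed.

Definition slice (A : seq ('I_2 * int)) (j : 'I_2) : seq int := [seq k.2 | k <- A & k.1 == j].

Lemma sum_slice (V : nmodType) (A : seq ('I_2 * int)) (u : 'I_2 * int -> V) :
  \sum_(k <- A) u k = \sum_(j < 2) \sum_(n <- slice A j) u (j, n).
Proof.
rewrite (partition_big (fun k => k.1) xpredT)//=; apply: eq_bigr => j _.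
by rewrite /slice big_map big_filter; apply: eq_bigr => -[j' n] /= /eqP ->.
Qed.

Lemma psum_perm (a T c : R) (F : R -> R[i]) (A B : seq int) :
  perm_eq A B -> psum a T c F A = psum a T c F B.
Proof. by move=> AB; apply/funext => x; rewrite /psum /tsum (perm_big _ AB). Qed.

Definition residual (A : seq ('I_2 * int)) F j x :=
  periodized j F x - psum 0 h t0 (periodized j F) (slice A j) x.

(** The residual lives on [0, h[ whereas x ranges over ]-omega, omega[. One of its two values is
    always 0: the term at x + h serves x < 0, where the exponentials repeat by periodicity, and the
    term at x serves x >= 0. *)
Lemma frame_op_hat_sub_sum (A : seq ('I_2 * int)) F x : band omega F ->
  frame_op_hat h psi F x - \sum_(k <- A) coef 0 h t0 (periodized k.1 F) k.2 * (ek t0 k.2 x * psi k.1 x) =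
  \sum_(j < 2) h%:C * psi j x * (residual A F j x + residual A F j (x + h)).
Proof.
move=> bF; have h0 := period_gt0.
have hC : h%:C != 0 :> R[i] by rewrite -cmod_eq0 cmodC normr_eq0 gt_eqF.
rewrite sum_slice /frame_op_hat big_distrr /= -sumrB; apply: eq_bigr => j _.
case: (boolP (- omega < x < omega)) => hx; last first.
  by rewrite (psi_band j hx) !(mul0r, mulr0) big1 ?subrr// => n _; rewrite !mulr0.
rewrite -/(mod_conj F j).
have hs : \sum_(n <- slice A j) coef 0 h t0 (periodized j F) n * (ek t0 n x * psi j x) =
    h%:C * psi j x * \sum_(n <- slice A j) h^-1%:C * coef 0 h t0 (periodized j F) n * ek t0 n x.
  rewrite big_distrr /=; apply: eq_bigr => n _.
  rewrite rmorphV/= ?unitfE ?gt_eqF//; field.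
  by rewrite hC.
rewrite hs mulrA -mulrBr; congr (_ * _); rewrite /residual /psum /tsum /periodized.
have bG := @band_mod_conj F j.
case: (ltP x 0) => x0.
  have xI : x \in I0 = false by rewrite in_I0; apply/negP; lra.
  have xhI : x + h \in I0 by rewrite in_I0; move: hx omega_le_h; lra.
  rewrite (indE _ x) (indE _ (x + h)) xI xhI mul0r mul1r.
  rewrite [X in _ = _ - X + _]big1; last by move=> n _; rewrite /Ek indE xI mul0r mulr0.
  rewrite subrr add0r; congr (_ - _); last first.
    by apply: eq_bigr => n _; rewrite /Ek indE xhI mul1r ek_period.
  rewrite /periodize addrK (band_outl bG (x := x - h)) ?(band_outr bG (x := x + h + h)) ?add0r ?addr0//;
    by move: hx omega_le_h; lra.
have xI : x \in I0 by rewrite in_I0; move: hx omega_le_h; lra.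
have xhI : x + h \in I0 = false by rewrite in_I0; apply/negP; lra.
rewrite (indE _ x) (indE _ (x + h)) xI xhI mul0r mul1r.
rewrite [X in _ = _ + (0 - X)]big1 ?subr0 ?addr0; last first.
  by move=> n _; rewrite /Ek indE xhI mul0r mulr0.
by congr (_ - _); apply: eq_bigr => n _; rewrite /Ek indE xI mul1r.
Qed.

Lemma L2_psum a T c F A : L2 (psum a T c F A : R -> R[i]).
Proof. exact: L2_tsum. Qed.

(** The 8 collects a factor 2 for the sum of the two generators and a factor 4 for the two
    translates of the residual, which have equal norms. *)
Lemma N2_frame_op_hat_sub_sum (A : seq ('I_2 * int)) F : L2 F -> band omega F ->
  N2 (fun x => frame_op_hat h psi F x -
    \sum_(k <- A) coef 0 h t0 (periodized k.1 F) k.2 * (ek t0 k.2 x * psi k.1 x)) <=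
  8 * h ^+ 2 * gamma * (N2 (residual A F 0) + N2 (residual A F 1)).
Proof.
move=> FL bF; have h0 := period_gt0.
have rL j : L2 (residual A F j) by apply: L2B; [exact: L2_periodized|exact: L2_psum].
have r2L j : L2 (fun x => residual A F j x + residual A F j (x + h)).
  by apply: L2D; [|exact: (L2_tau h)].
pose v j x := h%:C * psi j x * (residual A F j x + residual A F j (x + h)).
have bv j x : cmod (v j x) ^+ 2 <= h ^+ 2 * gamma * cmod (residual A F j x + residual A F j (x + h)) ^+ 2.
  rewrite /v !cmodM !exprMn cmodC (ger0_norm (ltW h0)) ler_wpM2r ?sqr_ge0// ler_wpM2l ?sqr_ge0//.
have hg0 : 0 <= h ^+ 2 * gamma by rewrite mulr_ge0 ?sqr_ge0// ltW.
have vL j : L2 (v j).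
  apply: (L2_le _ (r2L j) hg0 (bv j)); apply: cmeasM; last exact: L2_meas.
  by apply: cmeasM => //; exact: cmeas_cst.
have vN j : N2 (v j) <= h ^+ 2 * gamma * (4 * N2 (residual A F j)).
  apply: le_trans (N2_leM (vL j) (r2L j) hg0 (bv j)) _; rewrite ler_wpM2l//.
  apply: le_trans (N2D_le (rL j) (L2_tau h (rL j))) _.
  by rewrite N2_tau; [lra|exact: L2_meas].
have lin (a b c d e k l : R) : a <= 2 * b + 2 * c -> b <= k * l * (4 * d) ->
    c <= k * l * (4 * e) -> a <= 8 * k * l * (d + e).
  by move=> ? ? ?; lra.
rewrite (_ : (fun x => _) = (fun x => v 0 x + v 1 x)); last first.
  by apply/funext => x; rewrite frame_op_hat_sub_sum// (sum_other _ 0).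
exact: (lin _ _ _ _ _ _ _ (N2D_le (vL 0) (vL 1)) (vN 0) (vN 1)).
Qed.

Lemma L2_frame_op_hat F : L2 F -> L2 (frame_op_hat h psi F).
Proof.
move=> FL; apply: L2Z; apply: L2_sum => j; apply: (@L2M_bnd _ (gamma + 1)) => //.
  exact: (cmod_psi_le psi_le).
exact/L2_periodize/L2_mod_conj.
Qed.

(** The sum is produced by inverting the transform that it must have; the distance from the partial
    sums is then measured on the Fourier side, where it is controlled by the partial Fourier series
    of two periodizations. *)
Lemma frame_series f F : isFT f F -> band omega F -> exists g, isFT g (frame_op_hat h psi F) /\
  sum_inL2 (fun k x => ip f (shift_family t0 Phi k) * shift_family t0 Phi k x) g.
Proof.
move=> fF bF; have [fL FL _] := fF; have h0 := period_gt0.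
have SL := L2_frame_op_hat FL.
pose M := (Num.truncn omega).+1.
have oM : omega < M%:R by exact: Num.Theory.truncnS_gt.
have trS : truncate M (frame_op_hat h psi F) = frame_op_hat h psi F.
  apply/funext => x; rewrite /truncate indE in_sym_itv; case: ifPn => hx; rewrite ?mul1r// mul0r.
  rewrite (band_frame_op_hat h psi_band)//; apply: contra hx => /andP[? ?]; move: oM; lra.
have [g gS] := isFT_inversion SL trS; have [gL _ _] := gS.
exists g; split => // e e0.
(* Chosen so that 8 h^2 gamma (e' + e') = e. *)
pose e' := e / (16 * h ^+ 2 * gamma).
have c0 : 0 < 16 * h ^+ 2 * gamma by rewrite !mulr_gt0 ?exprn_gt0.
have e'0 : 0 < e' by rewrite divr_gt0.
have /choice[A0 hA0] : forall j : 'I_2, exists A0 : {fset int}, forall A : {fset int},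
    (A0 `<=` A)%fset -> N2 (fun x => periodized j F x - psum 0 h t0 (periodized j F) A x) <= e'.
  by move=> j; exact: (psum_cvg 0 h0 t0h (L2_periodize (L2_mod_conj j FL)) e'0).
exists [fset k in [seq (j, n) | j <- enum 'I_2, n <- A0 j]]%fset => A A0A.
have rle j : N2 (residual A F j) <= e'.
  (* The slice of a finite set of pairs has no repetition, so it enumerates a finite set of
     integers, which contains [A0 j]. *)
  pose B : {fset int} := [fset n in slice A j]%fset.
  have sB : perm_eq (slice A j) B.
    apply: uniq_perm; [|exact: fset_uniq|by move=> n; rewrite inE].
    rewrite map_inj_in_uniq ?filter_uniq ?fset_uniq// => -[j1 n1] [j2 n2].
    by rewrite !mem_filter /= => /andP[/eqP-> _] /andP[/eqP-> _] ->.
  rewrite /residual (psum_perm _ _ _ _ sB); apply: hA0; apply/fsubsetP => n nA.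
  rewrite inE; apply/mapP; exists (j, n) => //; rewrite mem_filter /= eqxx /=.
  apply: (fsubsetP A0A); rewrite inE; apply/allpairsPdep; exists j, n.
  by rewrite mem_enum.
pose u (k : 'I_2 * int) x := ip f (shift_family t0 Phi k) * shift_family t0 Phi k x.
have uFT (k : 'I_2 * int) : isFT (u k)
    (fun x => coef 0 h t0 (periodized k.1 F) k.2 * (ek t0 k.2 x * psi k.1 x)).
  case: k => j n; rewrite /u (ip_shift_family j n fF).
  exact: (isFTZ _ (isFT_tau (n%:~R * t0) (psiFT j))).
have sFT := isFTB gS (isFT_sum A uFT); have [sL _ _] := sFT.
rewrite (sqnormE sL) lee_fin (isFT_N2 sFT).
apply: le_trans (N2_frame_op_hat_sub_sum A FL bF) _.
apply: (@le_trans _ _ (8 * h ^+ 2 * gamma * (e' + e'))).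
  by rewrite ler_wpM2l ?lerD// !mulr_ge0 ?sqr_ge0// ltW.
by rewrite le_eqVlt; apply/orP; left; apply/eqP; rewrite /e'; field; rewrite !gt_eqF.
Qed.

End FrameSystem.

Lemma ord2_ind (P : 'I_2 -> Prop) : P 0 -> P 1 -> forall j, P j.
Proof.
move=> P0 P1 [[|[|//]] hj].
  by rewrite (_ : Ordinal hj = 0)//; exact: val_inj.
by rewrite (_ : Ordinal hj = 1)//; exact: val_inj.
Qed.

Lemma det_mx2 (K : comNzRingType) (M : 'M[K]_2) :
  \det M = M 0 0 * M 1 1 - M 0 1 * M 1 0.
Proof.
have o1 : lift 0 0 = 1 :> 'I_2 by apply/val_inj.
have o2 : lift 1 0 = 0 :> 'I_2 by apply/val_inj.
rewrite (expand_det_row _ 0) big_ord_recl big_ord1 o1 /cofactor !det_mx11 !mxE !o1 !o2 /=.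
by rewrite expr0 mul1r expr1 mulN1r mulrN.
Qed.

(** * The determinant of the pre-Gramian *)

Section Pregramian.
Context {R : realType}.
Implicit Types (Phi : 'I_2 -> R -> R[i]) (h x : R).

Lemma mod_period_id h x : 0 <= x < h -> mod_period h x = x.
Proof.
move=> /andP[x0 xh]; have h0 : 0 < h by exact: le_lt_trans xh.
rewrite /mod_period (_ : Num.floor _ = 0) ?mul0r ?subr0//.
by apply: floor_def; rewrite add0r divr_ge0 ?(ltW h0)//= ltr_pdivrMr// mul1r.
Qed.

Lemma mod_period_shift h x : - h <= x < 0 -> mod_period h x = x + h.
Proof.
move=> /andP[x0 xh]; have h0 : 0 < h by move: x0 xh; lra.
rewrite /mod_period (_ : Num.floor _ = -1) ?mulN1r ?opprK//.
by apply: floor_def; rewrite addNr ler_pdivlMr// ltr_pdivrMr// mul0r mulN1r x0 xh.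
Qed.

Lemma det_pregramian h Phi x y : 0 <= h -> mod_period h x = y ->
  \det (pregramian h Phi x) =
  h%:C * (fourier (Phi 0) (y - h) * fourier (Phi 1) y -
          fourier (Phi 1) (y - h) * fourier (Phi 0) y).
Proof.
move=> h0 xy; rewrite /pregramian detZ -rmorphXn /= sqr_sqrtr// xy; congr (_ * _).
have r0 j : col_mx (fourier_vec Phi (y - h)) (fourier_vec Phi y) (0 : 'I_(1 + 1)) j =
    fourier (Phi j) (y - h).
  by rewrite mxE; case: splitP => // k _; rewrite mxE.
have r1 j : col_mx (fourier_vec Phi (y - h)) (fourier_vec Phi y) (1 : 'I_(1 + 1)) j =
    fourier (Phi j) y.
  rewrite mxE; case: splitP => k /= hk; last by rewrite mxE.
  by have := ltn_ord k; rewrite -hk.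
have := @det_mx2 _ (col_mx (fourier_vec Phi (y - h)) (fourier_vec Phi y)).
by rewrite !r0 !r1.
Qed.

Lemma conj_det2 h (a b c d : R[i]) :
  (h%:C * (a * b - c * d))^* = h%:C * (a^* * b^* - c^* * d^*).
Proof. by apply: eq_ReIm; rewrite !cE; ring. Qed.

Lemma invdetE h Phi x y : 0 <= h -> mod_period h x = y ->
  invdet h Phi x =
  (h%:C * ((fourier (Phi 0) (y - h))^* * (fourier (Phi 1) y)^* -
           (fourier (Phi 1) (y - h))^* * (fourier (Phi 0) y)^*))^-1.
Proof.
move=> h0 xy; rewrite /invdet /adjoint_mx det_tr det_map_mx (det_pregramian Phi h0 xy).
by rewrite -conj_det2.
Qed.

End Pregramian.

(** * Uniqueness of sums, and transforms supported in the open band *)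

Section FrameOperator.
Context {R : realType}.
Notation mu := (@lebesgue_measure R).
Local Notation ip := innerL2.
Implicit Types f g : R -> R[i].

Lemma sum_inL2_uniq (K : choiceType) (u : K -> R -> R[i]) g g' :
  (forall k, L2 (u k)) -> L2 g -> L2 g' -> sum_inL2 u g -> sum_inL2 u g' ->
  {ae mu, forall x, g x = g' x}.
Proof.
move=> uL gL gL' sg sg'.
have dL := L2B gL gL'.
suff d0 : N2 (fun x => g x - g' x) = 0.
  by apply: ae_imply (ae_N2_eq0 dL d0) => x /eqP; rewrite subr_eq0 => /eqP.
apply/eqP; rewrite eq_le N2_ge0 andbT; apply/ler_addgt0Pl => e e0; rewrite addr0.
(* The squared norm of a difference costs a factor 2 on each of the two terms. *)
have e40 : 0 < e / 4 by rewrite divr_gt0.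
have [F0 h0] := sg _ e40; have [F1 h1] := sg' _ e40.
pose F := (F0 `|` F1)%fset.
have sL : L2 (fun x => \sum_(k <- F) u k x) by exact: L2_sum.
have {h0} := h0 F (fsubsetUl _ _); have {h1} := h1 F (fsubsetUr _ _).
rewrite (sqnormE (L2B gL sL)) (sqnormE (L2B gL' sL)) !lee_fin => h1 h0.
rewrite (_ : (fun x => _) = (fun x => (g x - \sum_(k <- F) u k x) -
    (g' x - \sum_(k <- F) u k x))); last by apply/funext => x; ring.
by apply: le_trans (N2B_le (L2B gL sL) (L2B gL' sL)) _; lra.
Qed.

(** Cutting the transform to the open band changes it only on a null set, the two end points
    included, and makes it vanish outside at every point. *)
Lemma Bspace_band omega f : 0 < omega -> Bspace omega f -> exists F, isFT f F /\ band omega F.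
Proof.
move=> o0 [fL f0]; have fF := isFT_fourier fL; have [_ FL _] := fF.
exists (fun x => ind `](- omega), omega[%classic x * fourier f x); split; last first.
  by move=> x hx; rewrite indE ifF ?mul0r//; apply/negP; rewrite inE /= in_itv /=; exact/negP.
apply: (isFT_aer fF).
  by apply: cmeasM; [exact: cmeas_ind|exact: L2_meas].
apply: ae_imply3 f0 (ae_neq omega) (ae_neq (- omega)) => x f0 n1 n2.
rewrite indE; case: ifPn => hx; first by rewrite mul1r.
rewrite mul0r f0// => /andP[x1 x2]; case/negP: hx; rewrite inE /= in_itv /=.
by rewrite !lt_neqAle x1 x2 n1 eq_sym n2.
Qed.

Lemma band_Bspace omega f F : isFT f F -> band omega F -> Bspace omega f.
Proof.
move=> fF bF; have [fL _ _] := fF; split => //.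
apply: ae_imply (isFT_uniq (isFT_fourier fL) fF) => x -> hx; apply: bF.
by apply/negP => /andP[? ?]; apply: hx; apply/andP; split; exact: ltW.
Qed.

End FrameOperator.

(** * The frame property and the transforms of the dual generators *)

Section DualGenerators.
Context {R : realType}.
Notation mu := (@lebesgue_measure R).
Local Notation ip := innerL2.
Context (omega h gamma delta kap t0 : R) (Phi psi : 'I_2 -> R -> R[i]).
Context (omega_gt0 : 0 < omega) (omega_le_h : omega <= h) (h_lt : h < 2 * omega).
Context (t0h : t0 * h = 2 * pi).
Context (delta_gt0 : 0 < delta) (gamma_gt0 : 0 < gamma) (kap_gt0 : 0 < kap).
Context (mpsi : forall j, cmeasurable (psi j)).
Context (psi_le : forall j x, cmod (psi j x) ^+ 2 <= gamma).
Context (psi_band : forall j, band omega (psi j)).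
Context (psiFT : forall j, isFT (Phi j) (psi j)).
Context (energy_ge : {ae mu, forall x, - omega < x < omega -> delta <= energy psi x}).
Context (minor_ge : forall i, {ae mu, forall x, h - omega < x < omega -> kap <= cmod (minor h psi i x)}).

Lemma is_frameP : is_frame omega t0 Phi.
Proof.
have h0 : 0 < h by exact: lt_le_trans omega_le_h.
pose C := delta^-1 + 4 * gamma / kap ^+ 2.
have C0 : 0 < C.
  by rewrite addr_gt0 ?invr_gt0// divr_gt0 ?exprn_gt0// mulr_gt0.
(* The maximum secures A <= B directly, with no nonzero function of the space to test the two
   inequalities on. *)
exists (h / C), (Num.max (h / C) (4 * gamma * h)); split.
- by rewrite divr_gt0.
- by rewrite le_max lexx.
move=> f /(Bspace_band omega_gt0)[F [fF bF]]; have [fL FL _] := fF.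
rewrite (frame_sum omega_gt0 omega_le_h t0h mpsi psi_le psi_band psiFT fF).
have low := periodized_lower omega_gt0 omega_le_h gamma_gt0 mpsi psi_le h_lt
  delta_gt0 kap_gt0 energy_ge (minor_ge 0) FL bF.
have up := periodized_upper omega_gt0 omega_le_h gamma_gt0 mpsi psi_le FL bF.
rewrite (sqnormE fL) (isFT_N2 fF) /= -!EFinM !lee_fin.
set P := _ + _ in low up *; split.
  by rewrite mulrAC ler_pdivrMr// -mulrA ler_pM2l// mulrC.
apply: (@le_trans _ _ (4 * gamma * h * N2 F)); last first.
  by rewrite ler_wpM2r ?N2_ge0// le_max lexx orbT.
by rewrite [_ * h * _]mulrAC [_ * h]mulrC ler_pM2l.
Qed.

(** [frame_operator] returns some L2 sum of the series: one exists by [frame_series], and any two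
    agree almost everywhere, hence have the same transform. *)
Lemma frame_operator_FT f F : isFT f F -> band omega F ->
  isFT (frame_operator t0 Phi f) (frame_op_hat h psi F).
Proof.
move=> fF bF.
have [g [gS gsum]] := frame_series omega_gt0 omega_le_h t0h gamma_gt0 mpsi psi_le psi_band psiFT fF bF.
have [gL _ _] := gS.
pose u (k : 'I_2 * int) x := ip f (shift_family t0 Phi k) * shift_family t0 Phi k x.
have [oL osum] : L2 (frame_operator t0 Phi f) /\ sum_inL2 u (frame_operator t0 Phi f).
  by apply: (@xgetPex _ (fun=> 0) [set g | L2 g /\ sum_inL2 u g]); exists g.
apply: (isFT_ael gS oL); apply: (sum_inL2_uniq _ gL oL gsum osum) => k.
by apply: L2Z; apply: L2_tau; have [] := psiFT k.1.
Qed.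

(** The inverse transform of [dual_hat] is a preimage of phi_i, so the choice in
    [frame_operator_inv] does not fall back on 0. Whichever preimage it returns, its transform
    solves the same pointwise equation. *)
Lemma dual_generatorsP i : exists F, [/\ band omega F,
  isFT (dual_generators omega t0 Phi i) F & {ae mu, forall x, frame_op_hat h psi F x = psi i x}].
Proof.
pose G := dual_hat omega h delta kap psi i.
have bG : band omega G by exact: band_dual_hat.
have GL : L2 G by exact: (L2_dual_hat omega_gt0 omega_le_h delta_gt0 gamma_gt0 kap_gt0 mpsi psi_le).
pose M := (Num.truncn omega).+1.
have oM : omega < M%:R by exact: Num.Theory.truncnS_gt.
have trG : truncate M G = G.
  apply/funext => x; rewrite /truncate indE in_sym_itv; case: ifPn => hx; rewrite ?mul1r// mul0r.
  by rewrite bG//; apply: contra hx => /andP[? ?]; move: oM; lra.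
have [f fG] := isFT_inversion GL trG.
have SG := frame_op_hat_dual_hat omega_gt0 omega_le_h h_lt delta_gt0 kap_gt0 psi_band energy_ge minor_ge i.
have [PL piL _] := psiFT i.
have Sf : {ae mu, forall x, frame_operator t0 Phi f x = Phi i x}.
  have SfG := frame_operator_FT fG bG.
  exact: isFT_inj (isFT_aer SfG (L2_meas piL) SG) (psiFT i).
have [Bd Sd] : Bspace omega (dual_generators omega t0 Phi i) /\
    {ae mu, forall x, frame_operator t0 Phi (dual_generators omega t0 Phi i) x = Phi i x}.
  apply: (@xgetPex _ (fun=> 0) [set f | Bspace omega f /\
      {ae mu, forall x, frame_operator t0 Phi f x = Phi i x}]).
  by exists f; split => //; exact: band_Bspace fG bG.
have [F [dF bF]] := Bspace_band omega_gt0 Bd.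
exists F; split => //.
exact: isFT_uniq (isFT_ael (frame_operator_FT dF bF) PL Sd) (psiFT i).
Qed.

Lemma fourier_dual i : {ae mu, forall x, [/\
    - omega < x < omega - h ->
      fourier (dual_generators omega t0 Phi i) x =
        (psi (other i) (x + h))^* / (h%:C * minor h psi i (x + h)),
    omega - h < x < h - omega ->
      fourier (dual_generators omega t0 Phi i) x = psi i x / (h * energy psi x)%:C
  & h - omega < x < omega ->
      fourier (dual_generators omega t0 Phi i) x =
        - (psi (other i) (x - h))^* / (h%:C * minor h psi i x)]}.
Proof.
have [F [bF dF SF]] := dual_generatorsP i; have [dL _ _] := dF.
apply: ae_imply2 (isFT_uniq (isFT_fourier dL) dF)
  (frame_op_hat_solution omega_gt0 omega_le_h h_lt delta_gt0 kap_gt0 energy_ge minor_ge bF SF).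
by move=> x ->.
Qed.

End DualGenerators.

(** * Generators with transforms bounded everywhere *)

Section Representative.
Context {R : realType}.
Notation mu := (@lebesgue_measure R).
Context (omega gamma : R) (Phi : 'I_2 -> R -> R[i]).
Context (omega_gt0 : 0 < omega) (gamma_gt0 : 0 < gamma).
Context (PhiB : forall j, Bspace omega (Phi j)).
Context (Phi_le : {ae mu, forall x, - omega < x < omega ->
  cmod (fourier (Phi 0) x) ^+ 2 + cmod (fourier (Phi 1) x) ^+ 2 <= gamma}).

(* The hypotheses bound the transforms almost everywhere only; this
   representative is bounded everywhere. *)
Definition bounded_repr j (x : R) : R[i] :=
  if x \in [set x | - omega < x < omega /\
     cmod (fourier (Phi 0) x) ^+ 2 + cmod (fourier (Phi 1) x) ^+ 2 <= gamma]
  then fourier (Phi j) x else 0.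

Lemma cmeas_fourier j : cmeasurable (fourier (Phi j)).
Proof. by have [fL _] := PhiB j; have [_ /L2_meas] := isFT_fourier fL. Qed.

Lemma cmeas_bounded_repr j : cmeasurable (bounded_repr j).
Proof.
apply: cmeas_if; [|exact: cmeas_fourier|exact: (cmeas_cst 0)].
rewrite (_ : mkset _ = `](- omega), omega[%classic `&`
  (fun x => cmod (fourier (Phi 0) x) ^+ 2 + cmod (fourier (Phi 1) x) ^+ 2) @^-1` `]-oo, gamma]).
  apply: measurableI => //; rewrite -[X in measurable X]setTI.
  by apply: measurable_funD => //; apply: measurable_cmod2; exact: cmeas_fourier.
by apply/seteqP; split => x /=; rewrite !in_itv.
Qed.

Lemma bounded_repr_le j x : cmod (bounded_repr j x) ^+ 2 <= gamma.
Proof.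
rewrite /bounded_repr; case: ifP => hx; last by rewrite cmod0 expr0n /= ltW.
move: hx; rewrite inE /= => -[_]; apply: le_trans.
have -> : cmod (fourier (Phi 0) x) ^+ 2 + cmod (fourier (Phi 1) x) ^+ 2 =
    \sum_(k < 2) cmod (fourier (Phi k) x) ^+ 2 by rewrite (sum_other _ 0).
by rewrite (sum_other _ j) lerDl sqr_ge0.
Qed.

Lemma band_bounded_repr j : band omega (bounded_repr j).
Proof. by move=> x hx; rewrite /bounded_repr ifF//; apply/negP; rewrite inE /= => -[xo _]; case/negP: hx. Qed.

Lemma ae_bounded_repr : {ae mu, forall x, forall j, fourier (Phi j) x = bounded_repr j x}.
Proof.
have f0 j : {ae mu, forall xi, ~ (- omega <= xi <= omega) -> fourier (Phi j) xi = 0}.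
  by have [] := PhiB j.
apply: ae_imply3 (ae_imply2 (fun x a b => conj a b) (f0 0) (f0 1)) Phi_le
  (ae_imply2 (fun x a b => conj a b) (ae_neq omega) (ae_neq (- omega))).
move=> x [a0 a1] le [n1 n2] j; rewrite /bounded_repr.
case: (boolP (- omega < x < omega)) => hx.
  by rewrite ifT// inE; split => //; exact: le.
rewrite ifF; last by apply/negP; rewrite inE => -[xo _]; case/negP: hx.
have hx' : ~ (- omega <= x <= omega).
  by move=> /andP[x1 x2]; case/negP: hx; rewrite !lt_neqAle x1 x2 n1 eq_sym n2.
by elim/ord2_ind: j; [exact: a0|exact: a1].
Qed.

Lemma bounded_repr_FT j : isFT (Phi j) (bounded_repr j).
Proof.
have [fL _] := PhiB j; apply: isFT_aer (isFT_fourier fL) (cmeas_bounded_repr j) _.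
by apply: ae_imply ae_bounded_repr => x.
Qed.

End Representative.

Theorem theorem4p1 (R : realType) (omega t0 h : R) (Phi : 'I_2 -> R -> R[i])
    (delta gamma eta : R)
    (omega_gt0 : 0 < omega) (t0_gt0 : 0 < t0) (hE : h = 2 * pi / t0)
    (omega_le_h : omega <= h) (h_lt_2omega : h < 2 * omega)
    (PhiB : forall j, Bspace omega (Phi j))
    (delta_gt0 : 0 < delta) (gamma_gt0 : 0 < gamma) (eta_gt0 : 0 < eta)
    (Phi_bounds : {ae (@lebesgue_measure R), forall x, - omega < x < omega ->
       delta <= (cmod (fourier (Phi 0) x)) ^+ 2
                + (cmod (fourier (Phi 1) x)) ^+ 2 <= gamma})
    (det_bound : {ae (@lebesgue_measure R), forall x, h - omega < x < omega ->
       eta <= cmod (\det (pregramian h Phi x))}) :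
  is_frame omega t0 Phi /\
  {ae (@lebesgue_measure R), forall x,
    let PhiS_hat := fourier_vec (dual_generators omega t0 Phi) in
    let D := invdet h Phi in
    [/\ - omega <= x <= omega - h ->
          PhiS_hat x =
            D x *: tau h (fun y => perp (conj_vec (fourier_vec Phi y))) x,
        omega - h < x < h - omega ->
          PhiS_hat x =
            (h^-1 * (enorm (fourier_vec Phi x)) ^- 2)%:C *: fourier_vec Phi x
      & h - omega <= x <= omega ->
          PhiS_hat x =
            - D x *: tau (- h) (fun y => perp (conj_vec (fourier_vec Phi y))) x]}.
Proof.
have h0 : 0 < h by exact: lt_le_trans omega_le_h.
have t0h : t0 * h = 2 * pi by rewrite hE mulrC divfK ?gt_eqF.
have Phi_le := ae_imply (fun x H xo => proj2 (andP (H xo))) Phi_bounds.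
pose psi := bounded_repr omega gamma Phi.
have mpsi : forall j, cmeasurable (psi j) by exact: cmeas_bounded_repr.
have psi_le : forall j x, cmod (psi j x) ^+ 2 <= gamma by exact: bounded_repr_le.
have psi_band : forall j, band omega (psi j) by exact: band_bounded_repr.
have psiFT : forall j, isFT (Phi j) (psi j) by exact: bounded_repr_FT.
have psiE := ae_bounded_repr PhiB Phi_le; rewrite -/psi in psiE.
clearbody psi.
(* The rows of the pre-Gramian carry a factor sqrt h each, so its determinant has modulus h times
   that of the minor. *)
have kap_gt0 : 0 < eta / h by rewrite divr_gt0.
have energy_ge : {ae (@lebesgue_measure R), forall x, - omega < x < omega -> delta <= energy psi x}.
  apply: ae_imply2 Phi_bounds psiE => x H e xo; case/andP: (H xo) => + _.
  by rewrite /energy (sum_other _ 0) -!e.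
have minor1 x : minor h psi 1 x = - minor h psi 0 x by rewrite /minor opprB.
have minor_ge i : {ae (@lebesgue_measure R), forall x, h - omega < x < omega ->
    eta / h <= cmod (minor h psi i x)}.
  apply: ae_imply3 det_bound psiE (ae_shift (- h) psiE) => x H e e' xo.
  have -> : cmod (minor h psi i x) = cmod (minor h psi 0 x).
    by elim/ord2_ind: i; [reflexivity|rewrite minor1 cmodN].
  have xh : 0 <= x < h by move: xo; lra.
  rewrite ler_pdivrMr// (le_trans (H xo))// (det_pregramian _ (ltW h0) (mod_period_id xh)).
  rewrite !e !e' -cmodJ conj_det2 cmodM cmodC ger0_norm ?(ltW h0)// mulrC.
  exact: lexx.
split.
  exact: (is_frameP omega_gt0 omega_le_h h_lt_2omega t0h delta_gt0 gamma_gt0 kap_gt0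
    mpsi psi_le psi_band psiFT energy_ge minor_ge).
have dual i := fourier_dual omega_gt0 omega_le_h h_lt_2omega t0h delta_gt0 gamma_gt0 kap_gt0
    mpsi psi_le psi_band psiFT energy_ge minor_ge i.
(* The formulas hold on open intervals and the statement has closed ones; the four end points form a
   null set. *)
have endpoints : {ae (@lebesgue_measure R), forall x, (x != omega /\ x != - omega) /\
    (x != omega - h /\ x != h - omega)}.
  exact: ae_imply2 (fun x a b => conj a b) (ae_imply2 (fun x a b => conj a b) (ae_neq omega) (ae_neq (- omega)))
    (ae_imply2 (fun x a b => conj a b) (ae_neq (omega - h)) (ae_neq (h - omega))).
apply: ae_imply3 endpoints (ae_imply2 (fun x a b => conj a b) (dual 0) (dual 1))
  (ae_imply3 (fun x a b c => conj a (conj b c)) psiE (ae_shift h psiE) (ae_shift (- h) psiE)).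
move=> x [[n1 n2] [n3 n4]] [d0 d1] [e [eh e'h]] /=.
have o0 : other 0 = 1 by [].
have o1 : other 1 = 0 by [].
split => xo; apply/rowP => i; rewrite /tau !mxE.
- have {}xo : - omega < x < omega - h by rewrite !lt_neqAle eq_sym n2 n3.
  (* On the left interval the representative of x modulo h is x + h, so D x is the inverse of h
     times the minor at x + h. *)
  have xh : - h <= x < 0 by move: xo; lra.
  rewrite (invdetE _ (ltW h0) (mod_period_shift xh)) addrK !e !eh.
  have m0 : minor h psi 0 (x + h) = (psi 0 x)^* * (psi 1 (x + h))^* - (psi 1 x)^* * (psi 0 (x + h))^*.
    by rewrite /minor addrK.
  elim/ord2_ind: i => /=.
    by have [-> // _ _] := d0; rewrite o0 m0 mulrC.
  (* The opposite sign of [minor 1] produces the minus sign in the second component of [perp]. *)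
  by have [-> // _ _] := d1; rewrite o1 minor1 m0 mulrN invrN mulrN [in RHS]mulrN mulrC.
- rewrite e; have -> : enorm (fourier_vec Phi x) ^+ 2 = energy psi x.
    rewrite /enorm sqr_sqrtr; last by rewrite sumr_ge0// => j _; rewrite sqr_ge0.
    by apply: eq_bigr => j _; rewrite mxE e.
  have eV : ((h * energy psi x)%:C)^-1 = (h^-1 * (energy psi x)^-1)%:C.
    by rewrite -invfM -fmorphV.
  by elim/ord2_ind: i; [have [_ -> // _] := d0|have [_ -> // _] := d1]; rewrite eV mulrC.
- have {}xo : h - omega < x < omega by rewrite !lt_neqAle eq_sym n4 n1.
  have xh : 0 <= x < h by move: xo; lra.
  rewrite (invdetE _ (ltW h0) (mod_period_id xh)) !e !e'h.
  rewrite -[X in h%:C * X]/(minor h psi 0 x).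
  elim/ord2_ind: i => /=.
    by have [_ _ -> //] := d0; rewrite o0 mulNr mulrC mulNr.
  by have [_ _ -> //] := d1; rewrite o1 minor1 mulrN invrN mulrNN [in RHS]mulrNN mulrC.
Qed.
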